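(* Let $N,K,M\ge 1$ be integers and $\gamma>0$. Let $q'(x)$ be a positive, bounded probability density on $\mathbb{R}^N$ whose second-moment matrix $\mathscr{X}=\left(\int x_ix_j\,q'(x)\,dx\right)_{i,j=1}^N$ is positive definite. For $A\in\mathbb{R}^{M\times K}$, $B\in\mathbb{R}^{K\times N}$ let $$p_1(y,c\mid A,B,x)\propto \exp\!\left(-\tfrac12\lVert y-ABx\rVert^2\right)\exp\!\left(-\tfrac{\gamma}{2}\lVert c-Bx\rVert^2\right),\qquad (y,c)\in\mathbb{R}^M\times\mathbb{R}^K,$$ (a normalized Gaussian density in $(y,c)$ given $x$), and let $q_1(y,c\mid x)=p_1(y,c\mid A_0,B_0,x)$ for fixed true parameters $A_0\in\mathbb{R}^{M\times K}$, $B_0\in\mathbb{R}^{K\times N}$. Let $$K_1(A,B)=\iiint q'(x)\,q_1(y,c\mid x)\log\frac{q_1(y,c\mid x)}{p_1(y,c\mid A,B,x)}\,dy\,dc\,dx,$$ and let $(A,B)$ range over a compact (sufficiently large) parameter set $\mathcal{W}$ containing $(A_0,B_0)$. Then this model (the three-layered linear concept bottleneck model) is a regular statistical model, and its real log canonical threshold $\lambda_1$ and multiplicity $m_1$ are $$\lambda_1=\tfrac12(M+N)K,\qquad m_1=1.$$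
   Context: Real log canonical threshold (RLCT): for a non-negative analytic function $K$ on a compact parameter set $\mathcal{W}$, the zeta function $\zeta(z)=\int_{\mathcal{W}}K(w)^z\,dw$ is holomorphic on $\mathrm{Re}(z)>0$ and extends to a meromorphic function on $\mathbb{C}$ whose poles are negative rational numbers; if the largest pole is $-\lambda$, then $\lambda$ is the RLCT and the order $m$ of that pole is its multiplicity. Here $\zeta_1(z)=\iint_{\mathcal{W}} K_1(A,B)^z\,dA\,dB$. A prior density positive and bounded on $K_1^{-1}(0)$ is assumed. A model is regular if its parameter-to-distribution map is injective (so the zero set of the KL divergence is the single true parameter); otherwise singular.
   Formalization: Proved assuming B_0 has full row rank K (for rank B_0 < K the model is singular and λ_1 < (M+N)K/2) and (A_0,B_0) interior to W (''sufficiently large''); ''regular'' means K_1 vanishes on W only at (A_0,B_0), since global injectivity fails where B is rank-deficient. *)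

(* Defs.v *)
From HB Require Import structures.
From mathcomp Require Import all_boot all_order all_algebra.
From mathcomp Require Import all_classical all_reals all_analysis.
From mathcomp Require Import complex.
Set Implicit Arguments.
Unset Strict Implicit.
Unset Printing Implicit Defensive.
Import Order.TTheory GRing.Theory Num.Theory.
Import numFieldNormedType.Exports.
Local Open Scope classical_set_scope.
Local Open Scope ring_scope.

Section Defs.
Context {R : realType}.

(* Lebesgue measure on R^n, realised on n.-tuple R (which carries the  *)
(* product sigma-algebra of the library) as the iterated product of    *)
(* one-dimensional Lebesgue measures, exactly as the library defines   *)
(* binary product measures: (mu \x nu)(A) = \int mu(dt) nu(A_t).        *)
Fixpoint lebn (n : nat) : set (n.-tuple R) -> \bar R :=
  match n return set (n.-tuple R) -> \bar R with
  | 0 => fun A => ((\1_A : _ -> R) [tuple])%:E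
  | n'.+1 => fun A =>
      (\int[@lebesgue_measure R]_t @lebn n' [set v | A (cons_tuple t v)])%E
  end.
Arguments lebn : clear implicits.

Definition vec_of_tuple n (t : n.-tuple R) : 'cV[R]_n := \col_i tnth t i.

Definition intRn n (f : 'cV[R]_n -> \bar R) : \bar R :=
  (\int[lebn n]_t f (vec_of_tuple t))%E.

Definition sqnorm n (v : 'cV[R]_n) : R := \sum_i v i 0 ^+ 2.

Definition posdefmx n (X : 'M[R]_n) : Prop :=
  X^T = X /\ forall v : 'cV[R]_n, v != 0 -> 0 < (v^T *m X *m v) 0 0.

Definition second_moment N (q' : 'cV[R]_N -> R) : 'M[R]_N :=
  \matrix_(i, j) fine (intRn (fun x => (x i 0 * x j 0 * q' x)%:E)).

Definition is_density N (q' : 'cV[R]_N -> R) : Prop :=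
  (forall x, 0 <= q' x) /\
  measurable_fun [set: N.-tuple R] (fun t => q' (vec_of_tuple t)) /\
  intRn (fun x => (q' x)%:E) = 1%E.

Definition p1 (M K N : nat) (gam : R) (A : 'M[R]_(M, K)) (B : 'M[R]_(K, N))
    (x : 'cV[R]_N) (y : 'cV[R]_M) (c : 'cV[R]_K) : R :=
  (Num.sqrt (2 * pi))^-M * expR (- (sqnorm (y - A *m B *m x)) / 2) *
  ((Num.sqrt (gam / (2 * pi))) ^+ K * expR (- gam * sqnorm (c - B *m x) / 2)).

Definition K1 (M K N : nat) (gam : R) (q' : 'cV[R]_N -> R)
    (A0 : 'M[R]_(M, K)) (B0 : 'M[R]_(K, N))
    (A : 'M[R]_(M, K)) (B : 'M[R]_(K, N)) : R :=
  fine (intRn (fun v : 'cV[R]_(N + (M + K)) =>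
    let x := usubmx v in
    let y := usubmx (dsubmx v) in
    let c := dsubmx (dsubmx v) in
    let q1 := p1 gam A0 B0 x y c in
    (q' x * q1 * ln (q1 / p1 gam A B x y c))%:E)).

Definition param_of_tuple (M K N : nat) (t : (M * K + K * N).-tuple R) :
    'M[R]_(M, K) * 'M[R]_(K, N) :=
  let r : 'rV[R]_(M * K + K * N) := \row_i tnth t i in
  (vec_mx (lsubmx r), vec_mx (rsubmx r)).

(* complex power k^z for a real k >= 0 and Re z > 0:                        *)
(* k^z = exp(z log k) (and 0^z = 0)                                       *)
Definition cpow (k : R) (z : R[i]) : R[i] :=
  if k == 0 then 0 else
  ((k `^ complex.Re z) * cos (complex.Im z * ln k) +i* ((k `^ complex.Re z) * sin (complex.Im z * ln k)))%C.

Definition zeta (M K N : nat) (Kf : 'M[R]_(M, K) -> 'M[R]_(K, N) -> R)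
    (W : set ('M[R]_(M, K) * 'M[R]_(K, N))) (z : R[i]) : R[i] :=
  let W' := (@param_of_tuple M K N) @^-1` W in
  let f w := cpow (Kf w.1 w.2) z in
  (fine (\int[lebn (M * K + K * N)]_(t in W') (complex.Re (f (param_of_tuple t)))%:E)%E
   +i* fine (\int[lebn (M * K + K * N)]_(t in W') (complex.Im (f (param_of_tuple t)))%:E)%E)%C.

(* RLCT and multiplicity: zeta (holomorphic on Re z > 0) extends         *)
(* meromorphically, its largest pole is -lam and that pole has order m.    *)
(* Since the poles of the continuation are real, this means: on some       *)
(* half-plane Re z > -lam - eps, (z + lam)^m zeta(z) extends to a       *)
(* holomorphic function that does not vanish at z = -lam.                  *)
Definition rlct_mult (M K N : nat) (Kf : 'M[R]_(M, K) -> 'M[R]_(K, N) -> R)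
    (W : set ('M[R]_(M, K) * 'M[R]_(K, N))) (lam : R) (m : nat) : Prop :=
  (0 < m)%N /\
  exists eps : R, 0 < eps /\
  exists g : R[i] -> R[i],
    (forall z : R[i], - lam - eps < complex.Re z ->
        derivable (g : R[i]^o -> R[i]^o) z 1) /\
    (forall z : R[i], 0 < complex.Re z ->
        g z = (z + (lam%:C)%C) ^+ m * zeta Kf W z) /\
    g (- (lam%:C)%C) != 0.

Definition regular_at (M K N : nat) (Kf : 'M[R]_(M, K) -> 'M[R]_(K, N) -> R)
    (W : set ('M[R]_(M, K) * 'M[R]_(K, N))) (w0 : 'M[R]_(M, K) * 'M[R]_(K, N)) :
    Prop :=
  [set w | W w /\ Kf w.1 w.2 = 0] = [set w0].

End Defs.

(* Main.v *)
(** The zeta function only sees the volumes V(t) of the sublevel sets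
    {K_1 < t}: writing k^z = T^z - z int_0^T [k < t] t^(z-1) dt and applying
    Fubini, an expansion V(t) = c t^lam + O(t^(lam + 1/2)) with c > 0 yields a
    simple pole at -lam, the error term being holomorphic on
    Re z > -lam - 1/2.

    The Gaussian computation gives
    K_1 = 1/2 tr (D X D^T) + gam/2 tr (E X E^T), with D = A B - A_0 B_0,
    E = B - B_0 and X the second-moment matrix.  As X is positive definite and
    B_0 has full row rank, (A_0, B_0) is the unique zero of K_1 and it is
    nondegenerate.  Rescaling by sqrt t around it compares {K_1 < t} with an
    ellipsoid up to a relative error O(sqrt t), so lam is half the number
    (M + N) K of parameters. *)
Require Import Defs.
From HB Require Import structures.
From mathcomp Require Import all_boot all_order all_algebra.
From mathcomp Require Import all_classical all_reals all_analysis.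
From mathcomp Require Import measurable_realfun complex ring lra.
Set Implicit Arguments.
Unset Strict Implicit.
Unset Printing Implicit Defensive.
Import Order.TTheory GRing.Theory Num.Theory.
Import numFieldNormedType.Exports.
Local Open Scope classical_set_scope.
Local Open Scope ring_scope.

(** * Lebesgue measure on tuples *)

Section Lebn.
Context {R : realType}.
Local Notation leb := (@lebesgue_measure R).

(** The form of the definitions shapes the proof. [lebn] is only a set function given by recursion,
    so it is first identified with a sigma-finite measure [lebM]; integral theorems apply only after
    that. The continuation of zeta is an explicit formula, and its holomorphy is proved directly: a
    second-order bound on the remainder of [k^(z+h)] is integrated against a weight
    ([derivable_mellin]).

    The gain 1/2 in the error exponent comes from the cubic term of K_1 at its zero, which is O(sqrt
    t) relative to the quadratic term on {K_1 < t}; any positive gain would isolate the pole. Two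
    constants stay unevaluated: the volume c of the unit ellipsoid, of which only 0 < c < oo
    matters, and the Gaussian variance term, which cancels in the divergence. *)

Definition consp n (p : R * n.-tuple R) : n.+1.-tuple R := cons_tuple p.1 p.2.

Lemma measurable_consp n : measurable_fun [set: _ * _] (@consp n).
Proof. by apply: measurable_cons; [exact: measurable_fst|exact: measurable_snd]. Qed.

Definition unconsp n (v : n.+1.-tuple R) : R * n.-tuple R :=
  (thead v, [tuple of behead v]).

Lemma measurable_unconsp n : measurable_fun [set: _.-tuple _] (@unconsp n).
Proof.
apply/measurable_fun_pair; first exact: measurable_tnth.
exact: measurable_behead.
Qed.

Lemma conspK n : cancel (@consp n) (@unconsp n).
Proof.
move=> [t v]; rewrite /unconsp /consp /=; congr pair; exact: val_inj.
Qed.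

Lemma lebnS n (A : set (n.+1.-tuple R)) :
  lebn A = (\int[leb]_t lebn [set v | A (consp (t, v))])%E.
Proof. by []. Qed.

Section SigmaFiniteOf.
Context d (T : measurableType d) (nu : {measure set T -> \bar R}).
Hypothesis sf : sigma_finite setT nu.

(** An alias of [nu], so that a sigma-finite structure can be attached to it from the proof [sf]. *)
Definition sigma_finite_of : set T -> \bar R := nu.

HB.instance Definition _ := Measure.copy sigma_finite_of nu.
HB.instance Definition _ := Measure_isSigmaFinite.Build _ _ _ sigma_finite_of sf.

Lemma sigma_finite_measure_of :
  exists mu : {sigma_finite_measure set T -> \bar R},
    (mu : set _ -> \bar R) = nu.
Proof. by exists sigma_finite_of. Qed.

End SigmaFiniteOf.

(** One recursion step of [lebn] is the pushforward along cons of a product measure.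
    Sigma-finiteness is carried through the induction because the product construction requires it
    of the factor. The diagonal rectangles [F k * G k] already cover the space, since both sequences
    increase. *)
Lemma lebn_sigma_finite_measure n :
  exists mu : {sigma_finite_measure set (n.-tuple R) -> \bar R},
    (mu : set _ -> \bar R) = @lebn R n.
Proof.
elim: n => [|n [mu muE]]; first by exists (dirac [tuple]).
pose pr : {measure set (measurableTypeR R * n.-tuple R)%type -> \bar R} := (leb \x mu)%E.
pose nu : set (n.+1.-tuple R) -> \bar R := pushforward pr (@consp n).
have [nuM nuME] : exists nuM : {measure set (n.+1.-tuple R) -> \bar R},
    (nuM : set _ -> \bar R) = pushforward pr (@consp n).
  unshelve (refine (ex_intro _ (pushforward pr (@consp n) : {measure set _ -> \bar R}) _)) => //.
  exact: measurable_consp.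
have nuS : sigma_finite setT nuM.
  have /sigma_finiteP[F [TF ndF Foo]] := sigma_finiteT leb.
  have /sigma_finiteP[G [TG ndG Goo]] := sigma_finiteT mu.
  exists (fun k => (@unconsp n) @^-1` (F k `*` G k)).
    apply/seteqP; split => // v _.
    have [i _ Fi] : (\bigcup_i F i) (unconsp v).1 by rewrite -TF.
    have [j _ Gj] : (\bigcup_i G i) (unconsp v).2 by rewrite -TG.
    exists (maxn i j) => //; split => /=.
      by move: Fi; apply/subsetPset/ndF/leq_maxl.
    by move: Gj; apply/subsetPset/ndG/leq_maxr.
  move=> k; have [mF Fk] := Foo k; have [mG Gk] := Goo k; split.
    rewrite -[X in measurable X]setTI; apply: measurable_unconsp => //.
    exact: measurableX.
  rewrite nuME /pushforward -comp_preimage.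
  rewrite (_ : _ \o _ = id) ?preimage_id; last first.
    by apply/funext => p /=; rewrite conspK.
  rewrite /pr /= product_measure1E//.
  by rewrite lte_mul_pinfty// ge0_fin_numE.
have [nuSM nuE] := sigma_finite_measure_of nuS.
exists nuSM; rewrite nuE nuME; apply/funext => A.
rewrite /pushforward /pr /= /product_measure1 /= -muE.
apply: eq_integral => t _ /=; congr (mu _).
by apply/seteqP; split => v /=; rewrite /xsection /= inE.
Qed.

Definition lebM n : {sigma_finite_measure set (n.-tuple R) -> \bar R} :=
  projT1 (cid (lebn_sigma_finite_measure n)).

Lemma lebME n : @lebn R n = lebM n.
Proof. by rewrite /lebM; case: cid. Qed.

Lemma lebMS n :
  (lebM n.+1 : set _ -> \bar R) = pushforward (product_measure1 leb (lebM n)) (@consp n).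
Proof.
rewrite -lebME; apply/funext => A; rewrite lebnS lebME /pushforward /product_measure1.
apply: eq_integral => t _ /=; congr (lebM n _).
by apply/seteqP; split => v /=; rewrite /xsection /= inE.
Qed.

Lemma measurable_consl n (t : R) : measurable_fun [set: n.-tuple R] (fun v => consp (t, v)).
Proof.
by apply: measurableT_comp; [exact: measurable_consp|exact: measurable_pair1].
Qed.

Lemma lebM0 : (lebM 0 : set _ -> \bar R) = dirac [tuple].
Proof. by rewrite -lebME. Qed.

Local Open Scope ereal_scope.

Lemma ge0_integral_lebM0 (f : 0.-tuple R -> \bar R) :
  \int[lebM 0]_v f v = f [tuple].
Proof.
have -> : f = cst (f [tuple]) by apply/funext => v; rewrite (tuple0 v).
by rewrite lebM0 integral_dirac//= diracT mul1e.
Qed.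

Lemma ge0_integral_lebMS n (f : n.+1.-tuple R -> \bar R) :
  measurable_fun [set: n.+1.-tuple R] f -> (forall v, 0 <= f v) ->
  \int[lebM n.+1]_v f v = \int[leb]_t \int[lebM n]_v f (consp (t, v)).
Proof.
move=> mf f0; rewrite lebMS ge0_integral_pushforward//; last first.
  exact: measurable_consp.
rewrite preimage_setT fubini_tonelli1//; first last.
- by move=> p; exact: f0.
- by apply: measurableT_comp => //; exact: measurable_consp.
Qed.

End Lebn.

Section AffineLebesgue.
Context {R : realType}.
Local Notation leb := (@lebesgue_measure R).
Local Open Scope ereal_scope.

Lemma measurable_affine (s b : R) :
  measurable_fun [set: measurableTypeR R] (fun x : R => s * x + b)%R.
Proof. by apply: measurable_funD => //; exact: mulrl_measurable. Qed.

(** By uniqueness of Lebesgue measure: s times the pushforward along x -> s x + b agrees with it on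
    half-open intervals. *)
Lemma ge0_integral_affine (s b : R) (f : R -> \bar R) : (0 < s)%R ->
  measurable_fun [set: R] f -> (forall x, 0 <= f x) ->
  \int[leb]_x f x = s%:E * \int[leb]_x f (s * x + b)%R.
Proof.
move=> s0 mf f0; pose phi (x : R) := (s * x + b)%R.
have mphi : measurable_fun [set: measurableTypeR R] phi by exact: measurable_affine.
have [nu nuE] : exists nu : {measure set (measurableTypeR R) -> \bar R},
    (nu : set _ -> \bar R) = pushforward leb (phi : _ -> measurableTypeR R).
  unshelve (refine (ex_intro _ (pushforward leb (phi : _ -> measurableTypeR R)
    : {measure set _ -> \bar R}) _)) => //.
pose ss := NngNum (ltW s0).
have lebE (A : set (measurableTypeR R)) : measurable A -> leb A = mscale ss nu A.
  move=> mA; apply: lebesgue_measure_unique => // X /ocitvP[->|[[u v] /= uv ->]].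
    by rewrite !measure0.
  rewrite /mscale nuE /pushforward.
  have -> : phi @^-1` `]u, v]%classic = `]((u - b) / s)%R, ((v - b) / s)%R]%classic.
    apply/seteqP; split => x; rewrite /phi /= !in_itv /=;
      by rewrite ltr_pdivrMr// ler_pdivlMr// ltrBlDr lerBrDr [(x * s)%R]mulrC.
  rewrite !lebesgue_measure_itv /= !lte_fin ltr_pM2r ?invr_gt0// ltrD2r uv.
  rewrite -!EFinD -EFinM; congr EFin; field; exact: lt0r_neq0.
rewrite (eq_measure_integral (mscale ss nu)); last by move=> A mA _; exact: lebE.
rewrite ge0_integral_mscale//; congr (_ * _).
by rewrite nuE ge0_integral_pushforward.
Qed.

End AffineLebesgue.

Section ScaleLebn.
Context {R : realType}.
Local Notation leb := (@lebesgue_measure R).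

Definition afft n (s : R) (b v : n.-tuple R) : n.-tuple R :=
  [tuple s * tnth v i + tnth b i | i < n].

Lemma afft_consp n s (b : n.+1.-tuple R) t (v : n.-tuple R) :
  afft s b (consp (t, v)) = consp (s * t + thead b, afft s [tuple of behead b] v).
Proof.
apply: eq_from_tnth => i; rewrite tnth_mktuple.
case: (unliftP ord0 i) => [j ->|->]; rewrite !(tnthS, tnth0)//=.
by rewrite tnth_mktuple [in LHS](tuple_eta b) tnthS.
Qed.

Lemma measurable_afft n s (b : n.-tuple R) :
  measurable_fun [set: n.-tuple R] (afft s b).
Proof.
apply/measurable_fun_tnthP => i.
rewrite [X in measurable_fun _ X](_ : _ =
  (fun x => s * x + tnth b i) \o (@tnth _ R ^~ i)); last first.
  by apply/funext => v /=; rewrite tnth_mktuple.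
by apply: measurableT_comp; [exact: measurable_affine|exact: measurable_tnth].
Qed.

Local Open Scope ereal_scope.

Lemma measurable_lebM_section n (A : set (n.+1.-tuple R)) : measurable A ->
  measurable_fun [set: R] (fun t => lebM n [set v | A (consp (t, v))]).
Proof.
move=> mA.
have mE : measurable (@consp R n @^-1` A).
  by rewrite -[X in measurable X]setTI; exact: measurable_consp.
have := measurable_fun_xsection (lebM n) mE.
apply: eq_measurable_fun => t _ /=; congr (lebM n _).
by apply/seteqP; split => v; rewrite /xsection /= inE.
Qed.

Lemma lebM_affine n (s : R) (b : n.-tuple R) (A : set (n.-tuple R)) :
  (0 < s)%R -> measurable A -> lebM n A = (s ^+ n)%:E * lebM n (afft s b @^-1` A).
Proof.
move=> s0; elim: n b A => [|n IH] b A mA.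
  rewrite lebM0 expr0 mul1e; congr (dirac _ _).
  by apply/seteqP; split => v /=; rewrite (tuple0 v) (tuple0 (afft _ _ _)).
rewrite -!lebME !lebnS lebME (ge0_integral_affine (thead b) s0)//; last first.
  exact: measurable_lebM_section.
under [X in _ * X = _]eq_integral.
  move=> t _; rewrite (IH [tuple of behead b]); last first.
    rewrite -[X in measurable X]setTI.
    exact: (measurable_consl (s * t + thead b)%R).
  over.
have e t : afft s [tuple of behead b] @^-1`
    [set v | A (consp (s * t + thead b, v)%R)] =
    [set v | (afft s b @^-1` A) (consp (t, v))].
  by apply/seteqP; split => v /=; rewrite afft_consp.
under [X in _ * X = _]eq_integral do rewrite e.
rewrite ge0_integralZl//; last 2 first.
- apply: measurable_lebM_section; rewrite -[X in measurable X]setTI.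
  exact: measurable_afft.
- by rewrite lee_fin exprn_ge0// ltW.
by rewrite muleA -EFinM -exprS.
Qed.

Definition cube n (r : R) : set (n.-tuple R) := [set v | forall i, (`|tnth v i| <= r)%R].

Lemma lebM_cube n (r : R) : (0 <= r)%R -> lebM n (cube r) = ((2 * r) ^+ n)%:E.
Proof.
move=> r0; elim: n => [|n IH].
  by rewrite lebM0 expr0 diracE mem_set// => -[].
rewrite -lebME lebnS lebME.
have e t : [set v | @cube n.+1 r (consp (t, v))] =
    if t \in `[(- r)%R, r] then cube r else set0.
  rewrite in_itv /= -ler_norml; case: ifPn => [tr|tr]; apply/seteqP; split => v //=.
  - by move=> H i; have := H (lift ord0 i); rewrite tnthS.
  - move=> H i; case: (unliftP ord0 i) => [j ->|->]; first by rewrite tnthS.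
    by rewrite tnth0.
  - by move=> /(_ ord0); rewrite tnth0; apply/negP.
under eq_integral do rewrite e.
rewrite (_ : (fun _ => _) = (fun t => ((2 * r) ^+ n)%:E * (\1_(`[(- r)%R, r]) t)%:E)).
  rewrite ge0_integralZl//; last 2 first.
  - by apply/measurable_EFinP; exact: measurable_indic.
  - by rewrite lee_fin exprn_ge0// mulr_ge0.
  rewrite integral_indic// setIT /= lebesgue_measure_itv /= lte_fin.
  case: ltP => [_|h].
    by rewrite -EFinD -EFinM exprS; congr EFin; ring.
  (* For r = 0 the interval is a point, and the length formula takes its degenerate branch. *)
  have -> : r = 0%R by apply/le_anti; rewrite r0 andbT; move: h; lra.
  by rewrite mule0 mulr0 expr0n.
apply/funext => t; rewrite indicE mem_setE; case: ifP => _; first by rewrite IH mule1.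
by rewrite measure0 mule0.
Qed.

End ScaleLebn.

(** * Topology of row vectors against the product sigma-algebra of tuples *)

Section MatrixMeasurable.
Context {R : realType}.

Definition rowt n (t : n.-tuple R) : 'rV[R]_n := \row_i tnth t i.
Definition trow n (u : 'rV[R]_n) : n.-tuple R := [tuple u 0 i | i < n].

Lemma trowK n : cancel (@trow n) (@rowt n).
Proof. by move=> u; apply/rowP => i; rewrite mxE tnth_mktuple. Qed.

(** An open set is the countable union of the boxes with rational centre and radius 1/(k+1) that it
    contains; [F] replaces the other boxes by the empty set. A box of that radius containing t lies
    in the ball of radius 2/(k+1) around t, hence the choice of k. *)
Lemma open_measurable_rowt n (O : set 'rV[R]_n) :
  open O -> measurable (@rowt n @^-1` O).
Proof.
move=> oO.
pose B (q : 'rV[rat]_n * nat) : set (n.-tuple R) :=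
  \bigcap_(i in [set: 'I_n]) ((@tnth n R ^~ i) @^-1` ball (ratr (q.1 0 i) : R) (q.2.+1%:R^-1)).
pose F q := if `[< B q `<=` @rowt n @^-1` O >] then B q else set0.
have mB q : measurable (B q).
  apply: fin_bigcap_measurable => // i _.
  rewrite -[X in measurable X]setTI; apply: measurable_tnth => //.
  exact: measurable_ball.
rewrite (_ : _ @^-1` _ = \bigcup_(q in setT) F q).
  apply: countable_bigcupT_measurable => [|q]; first exact: countableP.
  by rewrite /F; case: asboolP.
apply/seteqP; split => [t /= Ot|t [q _]]; last first.
  by rewrite /F; case: asboolP => // h; exact: h.
have /nbhs_ballP[e /= e0 eO] : nbhs (rowt t) O by exact: open_nbhs_nbhs.
have [k ke] : exists k : nat, 2 / k.+1%:R < e.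
  pose k := Num.truncn (2 / e).
  exists k; rewrite ltr_pdivrMr// mulrC -ltr_pdivrMr//.
  by rewrite (lt_le_trans (truncnS_gt _)).
have hk : 0 < k.+1%:R^-1 :> R by rewrite invr_gt0.
have [q qP] : exists q : 'rV[rat]_n, forall i, `|ratr (q 0 i) - tnth t i| < k.+1%:R^-1.
  have H i : exists q : rat, `|ratr q - tnth t i| < k.+1%:R^-1.
    have [|q] := @rat_in_itvoo R (tnth t i - k.+1%:R^-1) (tnth t i + k.+1%:R^-1).
      by rewrite ltrBlDr -addrA ltrDl addr_gt0.
    by rewrite in_itv /= => h; exists q; rewrite distrC ltr_distlC.
  exists (\row_i projT1 (cid (H i))) => i; rewrite mxE.
  by case: cid.
exists (q, k) => //; rewrite /F; case: asboolP => [_ i _ /=|].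
  by rewrite -ball_normE /=; exact: qP.
case=> v Bv; apply: eO; split => // a i; rewrite ord1 !mxE -ball_normE /=.
have := Bv i I; rewrite /= -ball_normE /= => h1.
rewrite (le_lt_trans (ler_distD (ratr (q 0 i)) _ _))//.
rewrite (lt_trans _ ke)// [in ltRHS](_ : 2 / _ = k.+1%:R^-1 + k.+1%:R^-1); last by ring.
by rewrite ltrD// distrC.
Qed.

Lemma closed_measurable_rowt n (S : set 'rV[R]_n) :
  closed S -> measurable (@rowt n @^-1` S).
Proof.
move=> cS; have := @open_measurable_rowt n (~` S) (closed_openC cS).
by move=> /measurableC; rewrite -preimage_setC setCK.
Qed.

Lemma continuous_measurable_rowt n (f : 'rV[R]_n -> R) :
  continuous f -> measurable_fun [set: n.-tuple R] (f \o @rowt n).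
Proof.
move=> cf; apply: (measurability _ (RGenOInfty.measurableE R)).
move=> _ [_ [x ->] <-]; rewrite setTI comp_preimage.
by apply: open_measurable_rowt; apply: open_comp.
Qed.

End MatrixMeasurable.

(** * Complex powers and Mellin integrals *)

Section ComplexDerivative.
Context {R : realType}.
Implicit Types z h l : R[i].
Local Notation Re := (@complex.Re R).
Local Notation Im := (@complex.Im R).

Lemma ReD z h : Re (z + h) = Re z + Re h. Proof. by case: z; case: h. Qed.
Lemma ImD z h : Im (z + h) = Im z + Im h. Proof. by case: z; case: h. Qed.
Lemma ReN z : Re (- z) = - Re z. Proof. by case: z. Qed.
Lemma ImN z : Im (- z) = - Im z. Proof. by case: z. Qed.
Lemma ReB z h : Re (z - h) = Re z - Re h. Proof. by rewrite ReD ReN. Qed.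
Lemma ImB z h : Im (z - h) = Im z - Im h. Proof. by rewrite ImD ImN. Qed.
Lemma ReM z h : Re (z * h) = Re z * Re h - Im z * Im h.
Proof. by case: z; case: h. Qed.
Lemma ImM z h : Im (z * h) = Re z * Im h + Im z * Re h.
Proof. by case: z; case: h. Qed.

Lemma complex_eqP z h : Re z = Re h -> Im z = Im h -> z = h.
Proof. by case: z => a b; case: h => c d /= -> ->. Qed.

Lemma normc_le_abs z : Normc.normc z <= `|Re z| + `|Im z|.
Proof.
case: z => a b /=; rewrite -(@ler_pXn2r _ 2) ?nnegrE ?sqrtr_ge0 ?addr_ge0//.
rewrite sqr_sqrtr ?addr_ge0 ?sqr_ge0// sqrrD !real_normK ?num_real//.
by rewrite lerD2r lerDl mulrn_wge0// mulr_ge0.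
Qed.

Lemma abs_Re_le z : `|Re z| <= Normc.normc z.
Proof.
case: z => a b /=; rewrite -(@ler_pXn2r _ 2) ?nnegrE ?sqrtr_ge0//.
by rewrite sqr_sqrtr ?addr_ge0 ?sqr_ge0// real_normK ?num_real// lerDl sqr_ge0.
Qed.

Lemma abs_Im_le z : `|Im z| <= Normc.normc z.
Proof.
case: z => a b /=; rewrite -(@ler_pXn2r _ 2) ?nnegrE ?sqrtr_ge0//.
by rewrite sqr_sqrtr ?addr_ge0 ?sqr_ge0// real_normK ?num_real// lerDr sqr_ge0.
Qed.

(** A criterion for complex differentiability that involves only real inequalities on the two
    components of the first-order remainder. *)
Lemma derivable_quadratic (f : R[i] -> R[i]) z l (C d : R) : 0 < d ->
  (forall h, `|Re h| + `|Im h| <= d ->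
    `|Re (f (z + h) - f z - h * l)| <= C * (`|Re h| + `|Im h|) ^+ 2 /\
    `|Im (f (z + h) - f z - h * l)| <= C * (`|Re h| + `|Im h|) ^+ 2) ->
  derivable (f : R[i]^o -> R[i]^o) z 1.
Proof.
move=> d0 H; apply/cvg_ex; exists (l : R[i]^o); apply/cvgrPdist_lt => eps eps0.
(* The norm of [R[i]] is complex-valued, so eps is a complex number, real because it is positive. *)
have eE : eps = (Re eps)%:C%C.
  by move: eps0; rewrite ltcE /= => /andP[/eqP]; case: eps => a b /= ->.
have e0 : 0 < Re eps by move: eps0; rewrite eE ltcR.
have C0 : 0 <= C.
  have := H (d%:C%C); rewrite /= normr0 addr0 gtr0_norm// lexx => /(_ isT)[+ _].
  by move=> /(le_trans (normr_ge0 _)); rewrite pmulr_lge0// exprn_gt0.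
(* Since |Re h| + |Im h| <= 2|h|, each component of the remainder is at most 4C|h|^2, hence 8C for
   the two together; the 1 keeps the denominator positive. *)
pose r := Num.min (d / 2) (Re eps / (8 * C + 1)).
have C1 : 0 < 8 * C + 1 by rewrite ltr_wpDl// mulr_ge0.
have r0 : 0 < r by rewrite lt_min !divr_gt0.
have r0C : 0 < r%:C%C :> R[i] by rewrite ltcR.
near=> h => /=.
have hr : Normc.normc h < r.
  have : `|h| < r%:C%C by near: h; apply/nbhs_ballP; exists (r%:C%C) => //= h;
    rewrite -ball_normE /= sub0r normrN.
  by rewrite ltcR.
have h0 : h != 0 by near: h; exact: nbhs_dnbhs_neq.
have n0 : 0 < Normc.normc h.
  rewrite lt_def; apply/andP; split; last by case: (h) => ? ?; exact: sqrtr_ge0.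
  by apply: contra h0 => /eqP/Normc.eq0_normc ->.
rewrite eE -[h *: 1]/(h * 1) mulr1 [h + z]addrC.
have -> : l - h^-1 *: (f (z + h) - f z) = - (h^-1 * (f (z + h) - f z - h * l)).
  rewrite [_ *: _]/(_ * _) mulrBr [h^-1 * (h * l)]mulrA mulVf// mul1r opprB.
  by [].
set w := _ - h * l.
suff : Normc.normc (h^-1 * w) < Re eps by rewrite normrN -ltcR.
rewrite Normc.normcM Normc.normcV mulrC ltr_pdivrMr//.
have s1 : `|Re h| + `|Im h| <= 2 * Normc.normc h.
  by rewrite mulr2n mulrDl !mul1r lerD// ?abs_Re_le ?abs_Im_le.
have s2 : `|Re h| + `|Im h| <= d.
  rewrite (le_trans s1)// -ler_pdivlMl// mulrC ltW// (lt_le_trans hr)//.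
  by rewrite ge_min lexx.
have [b1 b2] := H h s2.
have s3 : (`|Re h| + `|Im h|) ^+ 2 <= 4 * Normc.normc h ^+ 2.
  have -> : 4 * Normc.normc h ^+ 2 = (2 * Normc.normc h) ^+ 2 by ring.
  by rewrite ler_sqr ?nnegrE ?mulr_ge0 ?addr_ge0// ltW.
apply: (le_lt_trans (normc_le_abs _)); apply: (le_lt_trans (lerD b1 b2)).
apply: (@le_lt_trans _ _ ((8 * C) * Normc.normc h * Normc.normc h)).
  have := ler_wpM2l C0 s3; lra.
rewrite ltr_pM2r//; apply: (@le_lt_trans _ _ ((8 * C) * r)).
  by rewrite ler_wpM2l ?mulr_ge0// ltW.
apply: (@lt_le_trans _ _ ((8 * C + 1) * r)); first by move: r0; lra.
by rewrite mulrC -ler_pdivlMr// ge_min lexx orbT.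
Unshelve. all: by end_near. Qed.

End ComplexDerivative.

(** * Second-order remainder of the complex exponential *)

Section ExpBounds.
Context {R : realType}.
Implicit Types a b x : R.

Lemma norm_expR_sub1 a : `|expR a - 1| <= `|a| * expR `|a|.
Proof.
have e0 := expR_gt0 a; have := expR_ge1Dx (- a); have := expR_ge1Dx a.
have em : expR (- a) * expR a = 1 by rewrite -expRD addNr expR0.
case: (lerP 0 a) => a0 h1 h2.
- rewrite (ger0_norm a0) ger0_norm; last by move: h1 a0; lra.
  by have := ler_wpM2r (ltW e0) h2; rewrite em; lra.
- have e1 : expR a <= 1 by rewrite -expR0 ler_expR ltW.
  rewrite (ltr0_norm a0) ler0_norm ?subr_le0//.
  have : 1 <= expR (- a) by rewrite -expR0 ler_expR oppr_ge0 ltW.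
  nra.
Qed.

(** Multiplying 1 - a <= exp(-a) by exp a gives exp a - 1 - a <= a (exp a - 1), which reduces the
    bound to the first-order one. *)
Lemma norm_expR_sub1D a : `|expR a - 1 - a| <= a ^+ 2 * expR `|a|.
Proof.
have h1 := expR_ge1Dx a.
rewrite ger0_norm; last by move: h1; lra.
have em : expR (- a) * expR a = 1 by rewrite -expRD addNr expR0.
have h2 := expR_ge1Dx (- a).
have e0 := expR_gt0 a.
apply: (@le_trans _ _ (a * (expR a - 1))).
  by have := ler_wpM2r (ltW e0) h2; rewrite em; lra.
apply: (le_trans (ler_norm _)); rewrite normrM.
apply: (le_trans (ler_wpM2l (normr_ge0 a) (norm_expR_sub1 a))).
by rewrite mulrA -expr2 real_normK// num_real.
Qed.

Lemma norm_sin_le b : `|sin b| <= `|b|.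
Proof.
wlog b0 : b / 0 <= b.
  move=> H; case: (lerP 0 b) => [/H//|b0].
  by have := H (- b); rewrite sinN !normrN; apply; rewrite oppr_ge0 ltW.
have D x : x \in `]0, b[ -> is_derive x (1 : R) sin (cos x) by move=> _; exact: is_derive_sin.
have Cs : {within `[0, b], continuous (@sin R)}.
  by apply: continuous_subspaceT => x; exact: continuous_sin.
have [c _] := MVT_segment b0 D Cs.
rewrite sin0 !subr0 => ->; rewrite normrM ler_piMl//.
by rewrite ler_norml cos_geN1 cos_le1.
Qed.

Lemma norm_cos_sub1 b : `|cos b - 1| <= b ^+ 2 / 2.
Proof.
have -> : cos b - 1 = - (2 * sin (b / 2) ^+ 2).
  have := cosD (b / 2) (b / 2); have := cos2Dsin2 (b / 2).
  rewrite -splitr; lra.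
rewrite normrN normrM normrX ger0_norm//.
have := norm_sin_le (b / 2).
rewrite -(@ler_pXn2r _ 2) ?nnegrE// => h.
have -> : b ^+ 2 / 2 = 2 * `|b / 2| ^+ 2; last by rewrite ler_pM2l.
by rewrite real_normK ?num_real//; field.
Qed.

Lemma norm_sin_subx b : `|sin b - b| <= `|b| ^+ 3.
Proof.
wlog b0 : b / 0 <= b.
  move=> H; case: (lerP 0 b) => [/H//|b0].
  have := H (- b); rewrite sinN -opprD !normrN; apply; rewrite oppr_ge0 ltW//.
have d x : x \in `]0, b[ -> is_derive x (1 : R) (fun x => sin x - x) (cos x - 1).
  by move=> _; apply: is_deriveB.
have Cs : {within `[0, b], continuous (fun x : R => sin x - x)}.
  apply: continuous_subspaceT => x; apply: cvgB; last exact: cvg_id.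
  exact: continuous_sin.
have [c cb] := MVT_segment b0 d Cs.
rewrite sin0 !subr0 => ->; rewrite normrM [leRHS]exprSr ler_wpM2r//.
move: cb; rewrite in_itv /= => /andP[c0 cb].
rewrite (le_trans (norm_cos_sub1 c))// ger0_norm//.
have : c ^+ 2 <= b ^+ 2 by rewrite ler_sqr ?nnegrE.
have := sqr_ge0 c; lra.
Qed.

(** This lemma and the next bound the components of exp w - 1 - w for w = a + ib, with |a| + |b| in
    place of the modulus. *)
Lemma expC_sub1D_Re a b :
  `|expR a * cos b - 1 - a| <= 2 * (`|a| + `|b|) ^+ 2 * expR (`|a| + `|b|).
Proof.
have -> : expR a * cos b - 1 - a = expR a * (cos b - 1) + (expR a - 1 - a) by ring.
rewrite (le_trans (ler_normD _ _))// normrM (ger0_norm (expR_ge0 a)).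
have h1 := norm_cos_sub1 b; have h2 := norm_expR_sub1D a.
have m1 : expR a <= expR (`|a| + `|b|).
  by rewrite ler_expR (le_trans (ler_norm _))// lerDl.
have m2 : expR `|a| <= expR (`|a| + `|b|) by rewrite ler_expR lerDl.
have e0 := expR_gt0 (`|a| + `|b|).
have p1 : expR a * `|cos b - 1| <= expR (`|a| + `|b|) * (b ^+ 2 / 2).
  by rewrite ler_pM ?expR_ge0.
have p2 : a ^+ 2 * expR `|a| <= a ^+ 2 * expR (`|a| + `|b|).
  by rewrite ler_wpM2l ?sqr_ge0.
have : a ^+ 2 + b ^+ 2 <= (`|a| + `|b|) ^+ 2.
  rewrite sqrrD !real_normK ?num_real//.
  by have := mulr_ge0 (normr_ge0 a) (normr_ge0 b); lra.
have := sqr_ge0 a; have := sqr_ge0 b; nra.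
Qed.

Lemma expC_sub1D_Im a b :
  `|expR a * sin b - b| <= 2 * (`|a| + `|b|) ^+ 2 * expR (`|a| + `|b|).
Proof.
have -> : expR a * sin b - b = expR a * (sin b - b) + (expR a - 1) * b by ring.
rewrite (le_trans (ler_normD _ _))// !normrM (ger0_norm (expR_ge0 a)).
have h1 := norm_sin_subx b; have h2 := norm_expR_sub1 a.
have A := normr_ge0 a; have B := normr_ge0 b.
have m2 : expR `|a| <= expR (`|a| + `|b|) by rewrite ler_expR lerDl.
(* One of the three factors |b| of the sine remainder is absorbed by the exponential, leaving a
   quadratic bound. *)
have m1 : expR a * `|b| <= expR (`|a| + `|b|).
  apply: (@le_trans _ _ (expR `|a| * expR `|b|)); last by rewrite expRD.
  rewrite ler_pM ?expR_ge0 ?ler_expR ?ler_norm//.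
  by have := expR_ge1Dx `|b|; lra.
have p1 : expR a * `|sin b - b| <= expR (`|a| + `|b|) * `|b| ^+ 2.
  apply: (@le_trans _ _ (expR a * `|b| ^+ 3)); first by rewrite ler_wpM2l ?expR_ge0.
  by rewrite [_ ^+ 3]exprS mulrA ler_wpM2r ?exprn_ge0.
have p2 : `|expR a - 1| * `|b| <= expR (`|a| + `|b|) * (`|a| * `|b|).
  apply: (@le_trans _ _ (`|a| * expR `|a| * `|b|)); first by rewrite ler_wpM2r.
  by rewrite mulrAC mulrC ler_wpM2r// mulr_ge0.
have h : `|b| ^+ 2 + `|a| * `|b| <= 2 * (`|a| + `|b|) ^+ 2 by nra.
by have := ler_wpM2l (expR_ge0 (`|a| + `|b|)) h; lra.
Qed.

End ExpBounds.

(** * Integrals of real and complex functions *)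

Section RealIntegrable.
Context d (T : measurableType d) {R : realType} (mu : {measure set T -> \bar R}).
Variables (D : set T) (mD : measurable D).
Implicit Types f g : T -> R.
Local Notation rint f := (mu.-integrable D (EFin \o f)).

Lemma rintD f g : rint f -> rint g -> rint (fun x => f x + g x).
Proof. by move=> hf hg; exact: (integrableD mD hf hg). Qed.

Lemma rintB f g : rint f -> rint g -> rint (fun x => f x - g x).
Proof. by move=> hf hg; exact: (integrableB mD hf hg). Qed.

Lemma rintZ c f : rint f -> rint (fun x => c * f x).
Proof. by move=> hf; exact: (integrableZl mD c hf). Qed.

Lemma rint_le f g : measurable_fun D f -> (forall x, D x -> `|f x| <= g x) ->
  rint g -> rint f.
Proof.
move=> mf fg; apply: le_integrable => //; first exact/measurable_EFinP.
by move=> x Dx /=; rewrite lee_fin (le_trans (fg _ Dx)) ?ler_norm.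
Qed.

Lemma rint_measurable f : rint f -> measurable_fun D f.
Proof. by move=> /integrableP[/measurable_EFinP]. Qed.

Lemma norm_Rintegral_le f g : rint f -> rint g ->
  (forall x, D x -> `|f x| <= g x) ->
  `|\int[mu]_(x in D) f x| <= \int[mu]_(x in D) g x.
Proof.
move=> hf hg fg; apply: (le_trans (le_normr_Rintegral mD hf)).
by apply: le_Rintegral => //; exact: (integrable_abse hf).
Qed.

End RealIntegrable.

Section ComplexIntegral.
Context d (T : measurableType d) {R : realType} (mu : {measure set T -> \bar R}).
Variables (D : set T) (mD : measurable D).
Implicit Types f g : T -> R[i].
Local Notation Re := (@complex.Re R).
Local Notation Im := (@complex.Im R).

(** Taken componentwise, so that [zeta] unfolds to an instance of it. *)
Definition cintegral f : R[i] :=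
  ((\int[mu]_(x in D) Re (f x))%R +i* (\int[mu]_(x in D) Im (f x))%R)%C.

Definition cintegrable f :=
  mu.-integrable D (EFin \o (Re \o f)) /\ mu.-integrable D (EFin \o (Im \o f)).

Lemma eq_cintegral f g : (forall x, D x -> f x = g x) -> cintegral f = cintegral g.
Proof.
move=> fg; rewrite /cintegral; congr Complex; apply: eq_Rintegral => x;
  by rewrite inE => Dx; rewrite fg.
Qed.

Lemma cintegrableD f g : cintegrable f -> cintegrable g ->
  cintegrable (fun x => f x + g x).
Proof.
move=> [f1 f2] [g1 g2]; split.
- rewrite (_ : _ \o _ = (fun x => Re (f x) + Re (g x))); first exact: rintD.
  by apply/funext => x /=; rewrite ReD.
- rewrite (_ : _ \o _ = (fun x => Im (f x) + Im (g x))); first exact: rintD.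
  by apply/funext => x /=; rewrite ImD.
Qed.

Lemma cintegrableZ (c : R[i]) f : cintegrable f -> cintegrable (fun x => c * f x).
Proof.
move=> [f1 f2]; split.
- rewrite (_ : _ \o _ = (fun x => Re c * Re (f x) - Im c * Im (f x))).
    by apply: rintB => //; exact: rintZ.
  by apply/funext => x /=; rewrite ReM.
- rewrite (_ : _ \o _ = (fun x => Re c * Im (f x) + Im c * Re (f x))).
    by apply: rintD => //; exact: rintZ.
  by apply/funext => x /=; rewrite ImM.
Qed.

Lemma cintegralD f g : cintegrable f -> cintegrable g ->
  cintegral (fun x => f x + g x) = cintegral f + cintegral g.
Proof.
move=> [f1 f2] [g1 g2]; apply: complex_eqP; rewrite ?ReD ?ImD /cintegral /=.
- by rewrite -RintegralD//; apply: eq_Rintegral => x _; rewrite ReD.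
- by rewrite -RintegralD//; apply: eq_Rintegral => x _; rewrite ImD.
Qed.

Lemma cintegralZ (c : R[i]) f : cintegrable f ->
  cintegral (fun x => c * f x) = c * cintegral f.
Proof.
move=> [f1 f2]; apply: complex_eqP; rewrite ?ReM ?ImM /cintegral /=.
- rewrite -!RintegralZl// -RintegralB//; do ?exact: rintZ.
  by apply: eq_Rintegral => x _; rewrite ReM.
- rewrite -!RintegralZl// -RintegralD//; do ?exact: rintZ.
  by apply: eq_Rintegral => x _; rewrite ImM.
Qed.

Lemma cintegrableB f g : cintegrable f -> cintegrable g ->
  cintegrable (fun x => f x - g x).
Proof.
move=> hf hg.
rewrite (_ : (fun _ => _) = (fun x => f x + (-1) * g x)); last first.
  by apply/funext => x; rewrite mulN1r.
by apply: cintegrableD => //; exact: cintegrableZ.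
Qed.

Lemma cintegralB f g : cintegrable f -> cintegrable g ->
  cintegral (fun x => f x - g x) = cintegral f - cintegral g.
Proof.
move=> hf hg; rewrite -mulN1r -cintegralZ// -cintegralD//; last exact: cintegrableZ.
by apply: eq_cintegral => x _; rewrite mulN1r.
Qed.

End ComplexIntegral.

Section ComplexPower.
Context {R : realType}.
Implicit Types (k a : R) (z h : R[i]).
Local Notation Re := (@complex.Re R).
Local Notation Im := (@complex.Im R).

Lemma Re_cpow k z : 0 < k -> Re (cpow k z) = expR (Re z * ln k) * cos (Im z * ln k).
Proof. by move=> k0; rewrite /cpow /powR gt_eqF. Qed.

Lemma Im_cpow k z : 0 < k -> Im (cpow k z) = expR (Re z * ln k) * sin (Im z * ln k).
Proof. by move=> k0; rewrite /cpow /powR gt_eqF. Qed.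

Lemma powRE k a : 0 < k -> k `^ a = expR (a * ln k).
Proof. by move=> k0; rewrite /powR gt_eqF. Qed.

Lemma powRD_gt0 k a b : 0 < k -> k `^ (a + b) = k `^ a * k `^ b.
Proof. by move=> k0; rewrite !powRE// mulrDl expRD. Qed.

Lemma norm_Re_cpow k z : 0 < k -> `|Re (cpow k z)| <= k `^ Re z.
Proof.
move=> k0; rewrite Re_cpow// powRE// normrM ger0_norm ?expR_ge0//.
by rewrite ler_piMr ?expR_ge0// ler_norml cos_geN1 cos_le1.
Qed.

Lemma norm_Im_cpow k z : 0 < k -> `|Im (cpow k z)| <= k `^ Re z.
Proof.
move=> k0; rewrite Im_cpow// powRE// normrM ger0_norm ?expR_ge0//.
by rewrite ler_piMr ?expR_ge0// ler_norml sin_geN1 sin_le1.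
Qed.

Lemma cpowD k z h : 0 < k -> cpow k (z + h) = cpow k z * cpow k h.
Proof.
move=> k0; apply: complex_eqP; rewrite ?ReM ?ImM ?Re_cpow ?Im_cpow//;
  rewrite ReD ImD !mulrDl expRD.
- by rewrite cosD; ring.
- by rewrite sinD; ring.
Qed.

Lemma cpow0 k : 0 < k -> cpow k 0 = 1.
Proof.
move=> k0; apply: complex_eqP; rewrite ?Re_cpow ?Im_cpow//= !mul0r ?cos0 ?sin0.
- by rewrite expR0 mulr1.
- by rewrite mulr0.
Qed.

Lemma cpow_real k a : 0 < k -> cpow k (a%:C)%C = ((k `^ a)%:C)%C.
Proof.
move=> k0; apply: complex_eqP; rewrite ?Re_cpow ?Im_cpow//= !mul0r ?cos0 ?sin0.
- by rewrite mulr1 powRE.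
- by rewrite mulr0.
Qed.

Lemma measurable_Re_cpow d (T : measurableType d) (D : set T) (k : T -> R) z :
  measurable D -> measurable_fun D k -> (forall x, D x -> 0 < k x) ->
  measurable_fun D (fun x => Re (cpow (k x) z)).
Proof.
move=> mD mk k0.
apply: (eq_measurable_fun (fun x => expR (Re z * ln (k x)) * cos (Im z * ln (k x)))).
  by move=> x; rewrite inE => Dx; rewrite Re_cpow ?k0.
have ml : measurable_fun D (fun x => ln (k x)) by exact: measurableT_comp.
apply: measurable_funM.
- by apply: measurableT_comp => //; exact: measurable_funM.
- apply: (@measurableT_comp _ _ _ _ _ _ (@cos R)); last exact: measurable_funM.
  by apply: continuous_measurable_fun; exact: continuous_cos.
Qed.

Lemma measurable_Im_cpow d (T : measurableType d) (D : set T) (k : T -> R) z :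
  measurable D -> measurable_fun D k -> (forall x, D x -> 0 < k x) ->
  measurable_fun D (fun x => Im (cpow (k x) z)).
Proof.
move=> mD mk k0.
apply: (eq_measurable_fun (fun x => expR (Re z * ln (k x)) * sin (Im z * ln (k x)))).
  by move=> x; rewrite inE => Dx; rewrite Im_cpow ?k0.
have ml : measurable_fun D (fun x => ln (k x)) by exact: measurableT_comp.
apply: measurable_funM.
- by apply: measurableT_comp => //; exact: measurable_funM.
- apply: (@measurableT_comp _ _ _ _ _ _ (@sin R)); last exact: measurable_funM.
  by apply: continuous_measurable_fun; exact: continuous_sin.
Qed.

Lemma expR_abs_ln_le k (a : R) : 0 < k -> 0 <= a ->
  expR (a * `|ln k|) <= k `^ a + k `^ (- a).
Proof.
move=> k0 a0; rewrite !powRE//; case: (leP 0 (ln k)) => lk.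
- by rewrite ger0_norm// lerDl expR_ge0.
- by rewrite ltr0_norm// mulrN -mulNr lerDr expR_ge0.
Qed.

(** A logarithm costs only an arbitrarily small power: x <= exp x at x = e |ln k|. *)
Lemma abs_ln_le k (e : R) : 0 < k -> 0 < e ->
  `|ln k| <= e^-1 * (k `^ e + k `^ (- e)).
Proof.
move=> k0 e0; apply: (@le_trans _ _ (e^-1 * expR (e * `|ln k|))).
  rewrite ler_pdivlMl//.
  by have := expR_ge1Dx (e * `|ln k|); lra.
by apply: ler_wpM2l; [rewrite invr_ge0 ltW|apply: expR_abs_ln_le => //; exact: ltW].
Qed.

(** With u = e |ln k|, one factor exp u of exp(2u) pays for u^2, because u^2 <= 2 exp u. *)
Lemma sqr_ln_expR_le k (e : R) : 0 < k -> 0 < e ->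
  ln k ^+ 2 * expR (e * `|ln k|) <= 2 / e ^+ 2 * (k `^ (2 * e) + k `^ (- (2 * e))).
Proof.
move=> k0 e0; apply: (@le_trans _ _ (2 / e ^+ 2 * expR ((2 * e) * `|ln k|))); last first.
  apply: ler_wpM2l; first by rewrite divr_ge0 ?sqr_ge0.
  by apply: expR_abs_ln_le => //; rewrite mulr_ge0// ltW.
have -> : 2 * e * `|ln k| = e * `|ln k| + e * `|ln k| by ring.
rewrite expRD mulrA ler_wpM2r ?expR_ge0//.
have u0 : 0 <= e * `|ln k| by rewrite mulr_ge0// ltW.
have := expR_ge1Dxn 1 u0; rewrite exprMn real_normK ?num_real// => h.
have e2 : 0 < e ^+ 2 by rewrite exprn_gt0.
rewrite mulrAC ler_pdivlMr//; move: h; rewrite (_ : 2`!%:R = 2 :> R)//; lra.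
Qed.

(* k^(z+h) - k^z - h (ln k) k^z factors as k^z (e^w - 1 - w) with w = h ln k *)
Lemma cpow_taylor k z h (e : R) : 0 < k -> 0 < e -> `|Re h| + `|Im h| <= e ->
  let w := cpow k (z + h) - cpow k z - h * (((ln k)%:C)%C * cpow k z) in
  let B := 8 / e ^+ 2 * (k `^ (Re z + 2 * e) + k `^ (Re z - 2 * e)) in
  `|Re w| <= B * (`|Re h| + `|Im h|) ^+ 2 /\
  `|Im w| <= B * (`|Re h| + `|Im h|) ^+ 2.
Proof.
move=> k0 e0 he w B; set n := `|Re h| + `|Im h|.
pose r := cpow k h - 1 - h * ((ln k)%:C)%C.
have wE : w = cpow k z * r by rewrite /w /r cpowD//; ring.
set L := ln k.
have nL : `|Re h * L| + `|Im h * L| = n * `|L| by rewrite !normrM -mulrDl.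
have n0 : 0 <= n by rewrite addr_ge0.
have EE : 2 * (n * `|L|) ^+ 2 * expR (n * `|L|) <=
    2 * n ^+ 2 * (2 / e ^+ 2 * (k `^ (2 * e) + k `^ (- (2 * e)))).
  apply: (@le_trans _ _ (2 * n ^+ 2 * (L ^+ 2 * expR (e * `|L|)))).
    rewrite exprMn real_normK ?num_real//.
    rewrite [leLHS](_ : _ = 2 * n ^+ 2 * (L ^+ 2 * expR (n * `|L|))); last by ring.
    apply: ler_wpM2l; first by rewrite mulr_ge0 ?sqr_ge0.
    by apply: ler_wpM2l; rewrite ?sqr_ge0// ler_expR ler_wpM2r.
  apply: ler_wpM2l; first by rewrite mulr_ge0 ?sqr_ge0.
  exact: sqr_ln_expR_le.
have r1 : `|Re r| <= 2 * n ^+ 2 * (2 / e ^+ 2 * (k `^ (2 * e) + k `^ (- (2 * e)))).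
  apply: le_trans EE; rewrite -nL /r !ReB ReM Re_cpow//= mulr0 subr0.
  exact: expC_sub1D_Re.
have r2 : `|Im r| <= 2 * n ^+ 2 * (2 / e ^+ 2 * (k `^ (2 * e) + k `^ (- (2 * e)))).
  apply: le_trans EE; rewrite -nL /r !ImB ImM Im_cpow//= mulr0 add0r subr0.
  exact: expC_sub1D_Im.
have P := powR_ge0 k (Re z).
have c1 := norm_Re_cpow z k0; have c2 := norm_Im_cpow z k0.
set Q := 2 * n ^+ 2 * _ in r1 r2.
(* Each component of the product k^z r is a sum of two products bounded by [k^Re z * Q], which
   doubles the factor 4 in [Q] to the 8 in [B]. *)
have BE : B * n ^+ 2 = k `^ Re z * Q + k `^ Re z * Q.
  by rewrite /B /Q !powRD_gt0//; ring.
rewrite wE ReM ImM BE; split.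
- rewrite (le_trans (ler_normB _ _))// !normrM lerD// ler_pM//.
- by rewrite (le_trans (ler_normD _ _))// !normrM lerD// ler_pM.
Qed.

End ComplexPower.

(** * Differentiation of Mellin integrals *)

Section MellinDerivable.
Context d (T : measurableType d) {R : realType} (mu : {measure set T -> \bar R}).
Variables (D : set T) (k w : T -> R) (a0 : R).
Hypotheses (mD : measurable D) (mk : measurable_fun D k) (mw : measurable_fun D w).
Hypothesis k0 : forall x, D x -> 0 < k x.
Hypothesis wk : forall a, a0 < a -> mu.-integrable D (EFin \o (fun x => w x * k x `^ a)).
Local Notation Re := (@complex.Re R).
Local Notation Im := (@complex.Im R).

Lemma integrable_abs_powR a : a0 < a ->
  mu.-integrable D (EFin \o (fun x => `|w x| * k x `^ a)).
Proof.
move=> /wk/integrable_abse; apply: eq_integrable => // x _ /=.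
by rewrite normrM (ger0_norm (powR_ge0 _ _)).
Qed.

Lemma cintegrable_cpow z : a0 < Re z ->
  cintegrable mu D (fun x => ((w x)%:C)%C * cpow (k x) z).
Proof.
move=> az; split; apply: (rint_le mD _ _ (integrable_abs_powR az)).
- apply: (eq_measurable_fun (fun x => w x * Re (cpow (k x) z))).
    by move=> x _ /=; rewrite ReM /= mul0r subr0.
  by apply: measurable_funM => //; exact: measurable_Re_cpow.
- move=> x Dx /=; rewrite ReM /= mul0r subr0 normrM ler_wpM2l//.
  by apply: norm_Re_cpow; exact: k0.
- apply: (eq_measurable_fun (fun x => w x * Im (cpow (k x) z))).
    by move=> x _ /=; rewrite ImM /= mul0r addr0.
  by apply: measurable_funM => //; exact: measurable_Im_cpow.
- move=> x Dx /=; rewrite ImM /= mul0r addr0 normrM ler_wpM2l//.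
  by apply: norm_Im_cpow; exact: k0.
Qed.

(** The logarithm shifts the exponent by at most e on either side; with e half the distance from a
    to a0 the exponents stay in the admissible range. *)
Lemma integrable_ln_powR a : a0 < a ->
  mu.-integrable D (EFin \o (fun x => (w x * ln (k x)) * k x `^ a)).
Proof.
move=> aa; pose e := (a - a0) / 2.
have e0 : 0 < e by rewrite divr_gt0// subr_gt0.
have ae : a0 < a - e by rewrite /e; lra.
have ae' : a0 < a + e by rewrite /e; move: aa; lra.
apply: (rint_le mD _ _ (rintZ mD e^-1 (rintD mD (integrable_abs_powR ae')
  (integrable_abs_powR ae)))) => [|x Dx] /=.
- apply: measurable_funM; last exact: measurableT_comp (measurable_powR _) _.
  by apply: measurable_funM => //; exact: measurableT_comp.
- rewrite !normrM (ger0_norm (powR_ge0 _ _)) !powRD_gt0 ?k0//.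
  have h := abs_ln_le (k0 Dx) e0.
  have := ler_wpM2l (mulr_ge0 (normr_ge0 (w x)) (powR_ge0 (k x) a)) h; lra.
Qed.

End MellinDerivable.

Section MellinDerivable2.
Context d (T : measurableType d) {R : realType} (mu : {measure set T -> \bar R}).
Variables (D : set T) (k w : T -> R) (a0 : R).
Hypotheses (mD : measurable D) (mk : measurable_fun D k) (mw : measurable_fun D w).
Hypothesis k0 : forall x, D x -> 0 < k x.
Hypothesis wk : forall a, a0 < a -> mu.-integrable D (EFin \o (fun x => w x * k x `^ a)).
Local Notation Re := (@complex.Re R).
Local Notation Im := (@complex.Im R).

(** The derivative is an integral of the same kind with weight [w * ln k]. The lemmas of the
    preceding section, generalised over the weight, are applied to it. *)
Theorem derivable_mellin z : a0 < Re z ->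
  derivable ((fun z => cintegral mu D (fun x => ((w x)%:C)%C * cpow (k x) z))
    : R[i]^o -> R[i]^o) z 1.
Proof.
(* [cpow_taylor] brings in the exponents Re z + 2e and Re z - 2e, and the smaller one is a0 + e. *)
move=> az; pose e := (Re z - a0) / 3.
have e0 : 0 < e by rewrite divr_gt0// subr_gt0.
have mwl : measurable_fun D (fun x => w x * ln (k x)).
  by apply: measurable_funM => //; exact: measurableT_comp.
have dint := cintegrable_cpow mD mk mwl k0 (integrable_ln_powR mD mk mw k0 wk) az.
pose l := cintegral mu D (fun x => ((w x * ln (k x))%:C)%C * cpow (k x) z).
pose B x := `|w x| * k x `^ (Re z + 2 * e) + `|w x| * k x `^ (Re z - 2 * e).
have iB : mu.-integrable D (EFin \o B).
  by apply: rintD => //; apply: (integrable_abs_powR mD wk); rewrite /e; move: az; lra.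
pose C := 8 / e ^+ 2 * \int[mu]_(x in D) B x.
apply: (@derivable_quadratic R _ z l C e e0) => h he.
set n := `|Re h| + `|Im h| in he *.
have zh : a0 < Re (z + h).
  have : - n <= Re h by have := ler_norm (- Re h); rewrite normrN /n; have := normr_ge0 (Im h); lra.
  rewrite ReD; move: he az; rewrite /e; lra.
pose W x := cpow (k x) (z + h) - cpow (k x) z - h * (((ln (k x))%:C)%C * cpow (k x) z).
have -> : cintegral mu D (fun x => ((w x)%:C)%C * cpow (k x) (z + h)) -
   cintegral mu D (fun x => ((w x)%:C)%C * cpow (k x) z) - h * l =
   cintegral mu D (fun x => ((w x)%:C)%C * W x).
  rewrite /l -cintegralZ// -!cintegralB//; first last.
  - exact: (cintegrable_cpow mD mk mw k0 wk az).
  - exact: (cintegrable_cpow mD mk mw k0 wk zh).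
  - exact: cintegrableZ.
  - by apply: cintegrableB => //; [exact: (cintegrable_cpow mD mk mw k0 wk zh)|exact: (cintegrable_cpow mD mk mw k0 wk az)].
  by apply: eq_cintegral => x _; rewrite /W [in X in _ - X]rmorphM /=; ring.
have iW : cintegrable mu D (fun x => ((w x)%:C)%C * W x).
  rewrite (_ : (fun _ => _) = (fun x => ((w x)%:C)%C * cpow (k x) (z + h) -
   ((w x)%:C)%C * cpow (k x) z - h * (((w x * ln (k x))%:C)%C * cpow (k x) z))).
    apply: cintegrableB => //; last exact: cintegrableZ.
    by apply: cintegrableB => //; [exact: (cintegrable_cpow mD mk mw k0 wk zh)|exact: (cintegrable_cpow mD mk mw k0 wk az)].
  by apply/funext => x; rewrite /W rmorphM /=; ring.
have CE : C * n ^+ 2 = \int[mu]_(x in D) (8 / e ^+ 2 * n ^+ 2 * B x).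
  by rewrite RintegralZl// /C; ring.
have iB' : mu.-integrable D (EFin \o (fun x => 8 / e ^+ 2 * n ^+ 2 * B x)) by exact: rintZ.
have [iW1 iW2] := iW.
rewrite CE; split; apply: norm_Rintegral_le => // x Dx.
- have [b _] := @cpow_taylor R (k x) z h e (k0 Dx) e0 he.
  rewrite ReM /= mul0r subr0 normrM.
  have := ler_wpM2l (normr_ge0 (w x)) b; rewrite -/(W x) /B -/n; lra.
- have [_ b] := @cpow_taylor R (k x) z h e (k0 Dx) e0 he.
  rewrite ImM /= mul0r addr0 normrM.
  have := ler_wpM2l (normr_ge0 (w x)) b; rewrite -/(W x) /B -/n; lra.
Qed.

End MellinDerivable2.

(** * Integrals of real and complex powers *)

Section PowerIntegrals.
Context {R : realType}.
Local Notation leb := (@lebesgue_measure R).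
Local Notation Re := (@complex.Re R).
Local Notation Im := (@complex.Im R).

Lemma FTC2_pos (F f : R -> R) (a b : R) : 0 < a -> a < b ->
  (forall t : R, 0 < t -> is_derive t (1 : R) F (f t)) ->
  (forall t : R, 0 < t -> {for t, continuous f}) ->
  (\int[leb]_(t in `[a, b]) (f t)%:E = (F b - F a)%:E)%E.
Proof.
move=> a0 ab dF cf; have b0 := lt_trans a0 ab.
have cF (t : R) : 0 < t -> {for t, continuous F}.
  move=> /dF[dt _]; apply: differentiable_continuous; exact/derivable1_diffP.
rewrite (@continuous_FTC2 R f F a b ab)//.
- apply: continuous_in_subspaceT => t; rewrite inE /= in_itv /= => /andP[h _].
  by apply: cf; exact: lt_le_trans h.
- split.
  + by move=> t; rewrite in_itv /= => /andP[h _]; have [] := dF _ (lt_trans a0 h).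
  + exact/cvg_at_right_filter/cF.
  + exact/cvg_at_left_filter/cF.
- move=> t; rewrite in_itv /= => /andP[h _].
  by rewrite derive1E; have [_ ->] := dF _ (lt_trans a0 h).
Qed.

Lemma continuous_powR_pos (a t : R) : 0 < t -> {for t, continuous (fun x : R => x `^ a)}.
Proof.
move=> t0; apply: differentiable_continuous; apply/derivable1_diffP.
by have [] := is_derive1_powR a t0.
Qed.

(** For a < 0 the integrand blows up at 0, so the fundamental theorem is applied on an increasing
    sequence of compact intervals and monotone convergence gives the limit. *)
Lemma integral_powR_le (a T : R) : -1 < a -> 0 < T ->
  (\int[leb]_(t in `]0%R, T]) (t `^ a)%:E <= (T `^ (a + 1) / (a + 1))%:E)%E.
Proof.
move=> a1 T0; have a10 : 0 < a + 1 by rewrite -ltrBlDr sub0r.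
(* Starting at T/2 keeps every interval nondegenerate, as [FTC2_pos] requires. *)
pose F n : set R := `[T / n.+2%:R, T]%classic.
have UF : \bigcup_n F n = `]0, T]%classic.
  apply/seteqP; split => [t [n _]|t] /=; rewrite /F /= !in_itv /=.
    by move=> /andP[h ->]; rewrite andbT (lt_le_trans _ h)// divr_gt0.
  move=> /andP[t0 tT]; exists (Num.truncn (T / t)) => //=.
  rewrite in_itv /= tT andbT ler_pdivrMr// mulrC -ler_pdivrMr// ltW//.
  by rewrite (lt_le_trans (truncnS_gt _))// ler_nat.
have mp : measurable_fun setT (fun t : R => (t `^ a)%:E).
  by apply/measurable_EFinP; exact: measurable_powR.
have ndF : {homo F : n m / (n <= m)%N >-> (n <= m)%O}.
  move=> n m nm; apply/subsetPset => t; rewrite /F /= !in_itv /= => /andP[h ->].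
  by rewrite andbT (le_trans _ h)// ler_pM2l// lef_pV2 ?posrE ?ltr0n// ler_nat !ltnS.
have := @ge0_nondecreasing_set_cvg_integral _ (measurableTypeR R) R F (fun t : R => (t `^ a)%:E) leb ndF.
rewrite UF => H.
have {}H : ((\int[leb]_(t in F i) (t `^ a)%:E)%E @[i --> \oo] -->
    (\int[leb]_(t in `]0%R, T]) (t `^ a)%:E)%E).
  apply: H => [i|i|i t _].
  - exact: measurable_itv.
  - exact: measurable_funTS.
  - by rewrite lee_fin powR_ge0.
rewrite -(cvg_lim _ H)//; apply: lime_le.
  by apply/cvg_ex; eexists; exact: H.
apply: nearW => n.
have hT : T / n.+2%:R < T by rewrite gtr_pMr// invf_lt1 ?ltr1n.
have Tn : 0 < T / n.+2%:R by rewrite divr_gt0.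
have D (t : R) : 0 < t ->
    is_derive t (1 : R) (fun t => (a + 1)^-1 * t `^ (a + 1)) (t `^ a).
  move=> t0; have d := is_derive1_powR (a + 1) t0.
  apply: (is_derive_eq (is_deriveZ (a + 1)^-1 d)).
  by rewrite /GRing.scale /= mulrA mulVf ?gt_eqF// mul1r addrK.
rewrite /F (FTC2_pos Tn hT D (@continuous_powR_pos a)) lee_fin mulrC gerBl.
by rewrite mulr_ge0 ?powR_ge0// invr_ge0 ltW.
Qed.

Lemma integrable_powR (a T : R) : -1 < a -> 0 < T ->
  leb.-integrable `]0%R, T] (EFin \o (fun t : R => t `^ a)).
Proof.
move=> a1 T0; apply/integrableP; split.
  by apply/measurable_EFinP; apply: measurable_funTS; exact: measurable_powR.
under eq_integral do rewrite /= ger0_norm ?powR_ge0//.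
by rewrite (le_lt_trans (integral_powR_le a1 T0))// ltry.
Qed.

Lemma Rintegral_powR_le (a T : R) : -1 < a -> 0 < T ->
  \int[leb]_(t in `]0%R, T]) (t `^ a) <= T `^ (a + 1) / (a + 1).
Proof.
move=> a1 T0; rewrite -lee_fin /Rintegral fineK ?integral_powR_le//.
exact: (integrable_fin_num _ (integrable_powR a1 T0)).
Qed.

Lemma cintegrable_cpowB1 (z : R[i]) T : 0 < Re z -> 0 < T ->
  cintegrable leb `]0%R, T] (fun t => cpow t (z - 1)).
Proof.
move=> z0 T0.
rewrite (_ : (fun t => _) = (fun t => ((cst (1 : R) t)%:C)%C * cpow t (z - 1))); last first.
  by apply/funext => t; rewrite /cst mul1r.
apply: (@cintegrable_cpow _ _ R leb `]0, T]%classic id (cst 1) (-1)) => //.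
- by move=> t /=; rewrite in_itv /= => /andP[].
- move=> a a1; have := integrable_powR a1 T0; apply: eq_integrable => // t _ /=.
  by rewrite mul1r.
- by rewrite ReB /= ltrDr.
Qed.

(* d/dt t^z = z t^(z-1), written for real and imaginary parts with z = x + i y *)
Lemma is_derive_Re_cpow (x y t : R) : 0 < t ->
  is_derive t (1 : R) (fun t => expR (x * ln t) * cos (y * ln t))
   (expR ((x - 1) * ln t) * (x * cos (y * ln t) - y * sin (y * ln t))).
Proof.
move=> t0.
have dl := is_derive1_ln t0.
have dx c : is_derive t (1 : R) (fun t => c * ln t) (c * t^-1) by exact: is_deriveZ.
have d1 := @is_derive1_comp R expR (fun t => x * ln t) _ _ _ (is_derive_expR (x * ln t)) (dx x).
have d2 := @is_derive1_comp R cos (fun t => y * ln t) _ _ _ (is_derive_cos (y * ln t)) (dx y).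
apply: (is_derive_eq (is_deriveM d1 d2)); rewrite /GRing.scale /=.
rewrite mulrBl mul1r expRD expRN lnK ?posrE//; ring.
Qed.

Lemma is_derive_Im_cpow (x y t : R) : 0 < t ->
  is_derive t (1 : R) (fun t => expR (x * ln t) * sin (y * ln t))
   (expR ((x - 1) * ln t) * (x * sin (y * ln t) + y * cos (y * ln t))).
Proof.
move=> t0.
have dl := is_derive1_ln t0.
have dx c : is_derive t (1 : R) (fun t => c * ln t) (c * t^-1) by exact: is_deriveZ.
have d1 := @is_derive1_comp R expR (fun t => x * ln t) _ _ _ (is_derive_expR (x * ln t)) (dx x).
have d2 := @is_derive1_comp R sin (fun t => y * ln t) _ _ _ (is_derive_sin (y * ln t)) (dx y).
apply: (is_derive_eq (is_deriveM d1 d2)); rewrite /GRing.scale /=.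
rewrite mulrBl mul1r expRD expRN lnK ?posrE//; ring.
Qed.

Lemma continuous_Re_cpow (x y t : R) : 0 < t ->
  {for t, continuous (fun t => expR (x * ln t) * cos (y * ln t))}.
Proof.
move=> t0; apply: differentiable_continuous; apply/derivable1_diffP.
by have [] := is_derive_Re_cpow x y t0.
Qed.

Lemma continuous_Im_cpow (x y t : R) : 0 < t ->
  {for t, continuous (fun t => expR (x * ln t) * sin (y * ln t))}.
Proof.
move=> t0; apply: differentiable_continuous; apply/derivable1_diffP.
by have [] := is_derive_Im_cpow x y t0.
Qed.

Lemma cintegral_cpow_itv (z : R[i]) (a b : R) : 0 < a -> a < b ->
  cintegral leb `[a, b] (fun t => z * cpow t (z - 1)) = cpow b z - cpow a z.
Proof.
move=> a0 ab; have b0 := lt_trans a0 ab.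
have pos t : (`[a, b]%classic : set R) t -> 0 < t.
  by rewrite /= in_itv /= => /andP[h _]; exact: lt_le_trans h.
apply: complex_eqP; rewrite ?ReB ?ImB /cintegral /=.
- transitivity (\int[leb]_(t in `[a, b]) (expR ((Re z - 1) * ln t) *
    (Re z * cos (Im z * ln t) - Im z * sin (Im z * ln t)))).
    apply: eq_Rintegral => t; rewrite inE => /pos t0.
    by rewrite ReM Re_cpow// Im_cpow// ReB ImB /= subr0; ring.
  rewrite /Rintegral (FTC2_pos a0 ab (is_derive_Re_cpow (Re z) (Im z))).
    by rewrite /= !Re_cpow.
  move=> t t0; rewrite (_ : (fun _ => _) = (fun t =>
    Re z * (expR ((Re z - 1) * ln t) * cos (Im z * ln t)) -
    Im z * (expR ((Re z - 1) * ln t) * sin (Im z * ln t)))); last first.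
    by apply/funext => u; ring.
  by apply: cvgB; apply: cvgMr; [exact: continuous_Re_cpow|exact: continuous_Im_cpow].
- transitivity (\int[leb]_(t in `[a, b]) (expR ((Re z - 1) * ln t) *
    (Re z * sin (Im z * ln t) + Im z * cos (Im z * ln t)))).
    apply: eq_Rintegral => t; rewrite inE => /pos t0.
    by rewrite ImM Re_cpow// Im_cpow// ReB ImB /= subr0; ring.
  rewrite /Rintegral (FTC2_pos a0 ab (is_derive_Im_cpow (Re z) (Im z))).
    by rewrite /= !Im_cpow.
  move=> t t0; rewrite (_ : (fun _ => _) = (fun t =>
    Re z * (expR ((Re z - 1) * ln t) * sin (Im z * ln t)) +
    Im z * (expR ((Re z - 1) * ln t) * cos (Im z * ln t)))); last first.
    by apply/funext => u; ring.
  by apply: cvgD; apply: cvgMr; [exact: continuous_Im_cpow|exact: continuous_Re_cpow].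
Qed.

End PowerIntegrals.

Section ComplexIntegralSet.
Context d (T : measurableType d) {R : realType} (mu : {measure set T -> \bar R}).
Implicit Types (A B D : set T) (f : T -> R[i]).

Lemma cintegrableS A B f : measurable A -> measurable B -> A `<=` B ->
  cintegrable mu B f -> cintegrable mu A f.
Proof. by move=> mA mB AB [f1 f2]; split; apply: integrableS AB _. Qed.

Lemma cintegral_setU A B f : measurable A -> measurable B ->
  cintegrable mu (A `|` B) f -> [disjoint A & B] ->
  cintegral mu (A `|` B) f = cintegral mu A f + cintegral mu B f.
Proof.
move=> mA mB [f1 f2] AB.
by apply: complex_eqP; rewrite ?ReD ?ImD /cintegral /= Rintegral_setU.
Qed.

End ComplexIntegralSet.

Section PowerPrimitive.
Context {R : realType}.
Local Notation leb := (@lebesgue_measure R).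
Local Notation Re := (@complex.Re R).
Local Notation Im := (@complex.Im R).

Lemma itv_oc_split (a b : R) : 0 <= a -> a <= b ->
  (`]0, b]%classic : set R) = `]0, a] `|` `]a, b].
Proof.
move=> a0 ab; apply/seteqP; split => t /=; rewrite !in_itv /=.
- move=> /andP[t0 tb]; case: (leP t a) => ta; [left|right]; first by rewrite t0.
  exact/andP.
- case=> /andP[h1 h2]; first by rewrite h1 (le_trans h2).
  by rewrite (le_lt_trans a0 h1).
Qed.

Lemma disjoint_itv_oc (a b : R) : [disjoint (`]0%R, a]%classic : set R) & `]a, b]%classic].
Proof.
apply/disj_setPS => t [] /=; rewrite !in_itv /= => /andP[_ h] /andP[h' _].
by move: (le_lt_trans h h'); rewrite ltxx.
Qed.

(** This is the limit e -> 0, made explicit by an e for which the bound is at most |r|/2. *)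
Lemma eq0_of_powR_bound (r x C T : R) : 0 < x -> 0 < T ->
  (forall e, 0 < e -> e < T -> `|r| <= C * e `^ x) -> r = 0.
Proof.
move=> x0 T0 H; apply/eqP; rewrite -normr_eq0; apply/negPn/negP => r0.
have {}r0 : 0 < `|r| by rewrite lt_def r0 normr_ge0.
have C1 : 0 < `|C| + 1 by rewrite ltr_wpDl.
pose s := `|r| / (2 * (`|C| + 1)).
have s0 : 0 < s by rewrite divr_gt0// mulr_gt0.
pose e := Num.min (T / 2) (s `^ x^-1).
have e0 : 0 < e by rewrite lt_min divr_gt0//= powR_gt0.
have eT : e < T.
  by rewrite gt_min gtr_pMr// invf_lt1 ?ltr1n.
have := H e e0 eT; apply/negP; rewrite -ltNge.
have es : e `^ x <= s.
  apply: (@le_trans _ _ ((s `^ x^-1) `^ x)).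
    apply: ge0_ler_powR; rewrite ?nnegrE ?powR_ge0 ?(ltW x0) ?(ltW e0)//.
    by rewrite /e ge_min lexx orbT.
  by rewrite -powRrM mulVf ?gt_eqF// powRr1// ltW.
apply: (@le_lt_trans _ _ ((`|C| + 1) * s)).
  apply: (@le_trans _ _ (`|C| * e `^ x)); first by rewrite ler_wpM2r ?powR_ge0// ler_norm.
  by rewrite ler_pM ?powR_ge0// lerDl.
have -> : (`|C| + 1) * s = `|r| / 2 by rewrite /s; field; rewrite gt_eqF.
by rewrite gtr_pMr// invf_lt1 ?ltr1n.
Qed.

(** By the fundamental theorem on [e, T], the difference of the two sides is the same at T and at e
    ([key]). At e it is O(e^Re z), so it vanishes. *)
Lemma cintegral_cpow_oc (z : R[i]) (T : R) : 0 < Re z -> 0 < T ->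
  z * cintegral leb `]0%R, T] (fun t => cpow t (z - 1)) = cpow T z.
Proof.
move=> z0 T0; set f := fun t => cpow t (z - 1).
(* The 1 bounds e^z itself; the quotient bounds z times the integral over ]0, e], each component of
   which is at most e^Re z / Re z. *)
pose C := 1 + (`|Re z| + `|Im z|) / Re z.
have fint (e : R) : 0 < e -> cintegrable leb `]0%R, e] f by exact: cintegrable_cpowB1.
have key (e : R) : 0 < e -> e < T ->
    z * cintegral leb `]0%R, T] f - cpow T z = z * cintegral leb `]0%R, e] f - cpow e z.
  move=> e0 eT.
  rewrite (itv_oc_split (ltW e0) (ltW eT)) cintegral_setU//; last exact: disjoint_itv_oc.
    have eTS : `]e, T] `<=` (`]0, T]%classic : set R).
      by rewrite (itv_oc_split (ltW e0) (ltW eT)); exact: subsetUr.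
    have [f1 f2] : cintegrable leb `]e, T] f by apply: cintegrableS (fint _ T0).
    have -> : cintegral leb `]e, T] f = cintegral leb `[e, T] f.
      by rewrite /cintegral; congr Complex; exact: Rintegral_itv_obnd_cbnd.
    have fi : cintegrable leb `[e, T] f.
      have [g1 g2] := fint _ T0.
      apply: (@cintegrableS _ _ _ leb _ `]0, T]%classic) (fint _ T0) => //.
      by move=> t /=; rewrite !in_itv /= => /andP[h ->]; rewrite (lt_le_trans e0 h).
    rewrite mulrDr -[z * cintegral leb `[e, T] f]cintegralZ//.
    by rewrite cintegral_cpow_itv//; ring.
  by rewrite -(itv_oc_split (ltW e0) (ltW eT)); exact: fint.
have bnd (e : R) : 0 < e -> `|Re (cintegral leb `]0%R, e] f)| <= e `^ Re z / Re z /\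
   `|Im (cintegral leb `]0%R, e] f)| <= e `^ Re z / Re z.
  move=> e0; have [f1 f2] := fint e e0.
  have x1 : -1 < Re z - 1 by rewrite ltrBrDr addNr.
  have ip := integrable_powR x1 e0.
  have B := Rintegral_powR_le x1 e0; rewrite subrK in B.
  have pos (t : R) : (`]0%R, e]%classic : set R) t -> 0 < t.
    by rewrite /= in_itv /= => /andP[].
  split; apply: le_trans B; apply: norm_Rintegral_le => // t /pos t0.
  - by have := norm_Re_cpow (z - 1) t0; rewrite ReB.
  - by have := norm_Im_cpow (z - 1) t0; rewrite ReB.
apply/eqP; rewrite -subr_eq0; apply/eqP.
have xz : `|Re z| = Re z by rewrite gtr0_norm.
apply: complex_eqP; apply: (@eq0_of_powR_bound _ (Re z) C T) => // e e0 eT;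
  rewrite (key e e0 eT); have [b1 b2] := bnd e e0; set I := cintegral _ _ _ in b1 b2 *.
- rewrite ReB ReM (le_trans (ler_normB _ _))// (le_trans (lerD (ler_normB _ _) (norm_Re_cpow z e0)))//.
  rewrite !normrM /C.
  have p1 := ler_wpM2l (normr_ge0 (Re z)) b1; have p2 := ler_wpM2l (normr_ge0 (Im z)) b2.
  by move: p1 p2; lra.
- rewrite ImB ImM (le_trans (ler_normB _ _))// (le_trans (lerD (ler_normD _ _) (norm_Im_cpow z e0)))//.
  rewrite !normrM /C.
  have p1 := ler_wpM2l (normr_ge0 (Re z)) b2; have p2 := ler_wpM2l (normr_ge0 (Im z)) b1.
  by move: p1 p2; lra.
Qed.

Lemma layer_cpow (z : R[i]) (T k : R) : 0 < Re z -> 0 < T -> 0 <= k -> k <= T ->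
  cpow k z = cpow T z -
    z * cintegral leb `]0%R, T] (fun t => ((k < t)%R%:R%:C)%C * cpow t (z - 1)).
Proof.
move=> z0 T0 k0 kT; set f := fun t => cpow t (z - 1).
have fi := cintegrable_cpowB1 z0 T0.
have zi : cintegral leb `]0%R, T] (fun t => ((k < t)%R%:R%:C)%C * f t) =
    cintegral leb `]k, T] f.
  rewrite (itv_oc_split k0 kT) cintegral_setU//.
  - have -> : cintegral leb `]0%R, k] (fun t => ((k < t)%R%:R%:C)%C * f t) = 0.
      transitivity (cintegral leb `]0%R, k] (fun=> 0)).
        apply: eq_cintegral => t /=; rewrite in_itv /= => /andP[_ tk].
        rewrite ltNge tk /= -[RHS](mul0r (f t)); congr (_ * _).
      by apply: complex_eqP; rewrite /cintegral /= Rintegral_cst// mul0r.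
    rewrite add0r; apply: eq_cintegral => t /=.
    by rewrite in_itv /= => /andP[-> _]; rewrite mul1r.
  - rewrite -(itv_oc_split k0 kT).
    rewrite (_ : (fun _ => _) = (fun t => ((\1_(`]k, +oo[) t)%:C)%C * f t)).
      have [f1 f2] := fi.
      have mk : measurable_fun `]0, T]%classic (\1_(`]k, +oo[%classic) : R -> R).
        by apply: measurable_funTS; exact: measurable_indic.
      have b1 t : `|\1_(`]k, +oo[%classic : set R) t : R| <= 1.
        by rewrite indicE; case: (_ \in _); rewrite ?normr1 ?normr0.
      split; [apply: (rint_le _ _ _ (integrable_abse f1)) | apply: (rint_le _ _ _ (integrable_abse f2))] => //.
      + apply: (eq_measurable_fun (fun t => \1_(`]k, +oo[%classic) t * Re (f t))).
          by move=> t _ /=; rewrite ReM /= mul0r subr0.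
        by apply: measurable_funM => //; exact: rint_measurable f1.
      + by move=> t _ /=; rewrite ReM /= mul0r subr0 normrM ler_piMl.
      + apply: (eq_measurable_fun (fun t => \1_(`]k, +oo[%classic) t * Im (f t))).
          by move=> t _ /=; rewrite ImM /= mul0r addr0.
        by apply: measurable_funM => //; exact: rint_measurable f2.
      + by move=> t _ /=; rewrite ImM /= mul0r addr0 normrM ler_piMl.
    apply/funext => t; rewrite indicE; congr ((_ %:R %:C)%C * _).
    by rewrite mem_setE in_itv /= andbT.
  - exact: disjoint_itv_oc.
(* At k = 0 the convention 0^z = 0 is consistent with the formula: z times the integral over all of
   ]0, T] is T^z. *)
rewrite zi; have := k0; rewrite le_eqVlt => /predU1P[<-|kp].
  rewrite cintegral_cpow_oc// subrr; apply: complex_eqP; rewrite /cpow eqxx//.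
have := cintegral_cpow_oc z0 T0; rewrite (itv_oc_split k0 kT) cintegral_setU//.
- by rewrite mulrDr (cintegral_cpow_oc z0 kp) => <-; ring.
- by rewrite -(itv_oc_split k0 kT).
- exact: disjoint_itv_oc.
Qed.

Lemma derivable_cpow (k : R) (z : R[i]) : 0 < k ->
  derivable (cpow k : R[i]^o -> R[i]^o) z 1.
Proof.
move=> k0.
apply: (@derivable_quadratic R _ z (((ln k)%:C)%C * cpow k z) _ 1 ltr01) => h he.
exact: (@cpow_taylor R k z h 1 k0 ltr01 he).
Qed.

End PowerPrimitive.

(** * Layer-cake formula and continuation of the zeta function *)

Lemma measurable_sublevel d (S : measurableType d) {R : realType} (k : S -> R) (t : R) :
  measurable_fun setT k -> measurable [set x | k x < t].
Proof.
move=> mk; rewrite -[X in measurable X]setTI.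
have -> : [set x | k x < t] = k @^-1` `]-oo, t[.
  by apply/seteqP; split => x /=; rewrite in_itv.
by apply: mk => //; exact: measurable_itv.
Qed.

Section LayerFubini.
Context d (S : measurableType d) {R : realType}.
Variables (m : {sigma_finite_measure set S -> \bar R}) (D : set S).
Variables (k : S -> R) (G : R -> R) (T : R).
Hypotheses (mD : measurable D) (Dfin : (m D < +oo)%E).
Hypothesis mk : measurable_fun setT k.
Local Notation leb := (@lebesgue_measure R).
Local Notation I := (`]0%R, T]%classic : set R).
Hypothesis iG : leb.-integrable I (EFin \o G).

(** The restrictions to [D] and to ]0, T] are put into the integrand, so that Fubini applies on the
    whole product space. *)
Let f (p : S * measurableTypeR R) : \bar R :=
  (\1_D p.1 * ((G \_ I) p.2 * (k p.1 < p.2)%R%:R))%:E.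

Let mlt : measurable [set p : S * measurableTypeR R | k p.1 < p.2].
Proof.
have h : measurable_fun setT (fun p : S * measurableTypeR R => k p.1 < p.2).
  apply: (@measurable_fun_ltr _ _ R _ (fun p : S * measurableTypeR R => k p.1)
    (fun p : S * measurableTypeR R => p.2)).
  - by apply: measurableT_comp => //; exact: measurable_fst.
  - exact: measurable_snd.
have := h measurableT [set true] Logic.I.
by rewrite setTI; congr measurable; apply/seteqP; split => p /=.
Qed.

Let mGI : measurable_fun [set: measurableTypeR R] (G \_ I).
Proof.
apply/(measurable_restrictT _ _).1; first exact: measurable_itv.
exact: (rint_measurable iG).
Qed.

Let mf : measurable_fun setT f.
Proof.
apply/measurable_EFinP; apply: measurable_funM.
  by apply: measurableT_comp; [exact: measurable_indic|exact: measurable_fst].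
apply: measurable_funM; first exact: measurableT_comp measurable_snd.
rewrite (_ : (fun _ => _) = \1_[set p : S * measurableTypeR R | k p.1 < p.2]).
  exact: measurable_indic.
by apply/funext => p; rewrite indicE mem_setE.
Qed.

Let intG : (\int[leb]_t `|(G \_ I) t|%:E < +oo)%E.
Proof.
have /integrableP[_] := iG.
congr (_ < _)%E; rewrite [LHS]integral_mkcond; apply: eq_integral => t _.
by rewrite /patch; case: ifP => _ //=; rewrite normr0.
Qed.

(** |f| is dominated by the product of the indicator of [D], which has finite measure, and of |G|,
    which is integrable. *)
Let intf : (m \x leb)%E.-integrable setT f.
Proof.
apply/(integrable12ltyP _ _ mf).
have intG' := intG; set C := (\int[leb]_t `|(G \_ I) t|%:E)%E in intG'.
have C0 : (0 <= C)%E by apply: integral_ge0 => t _; rewrite lee_fin.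
have mG1 : measurable_fun [set: measurableTypeR R] (fun t => `|(G \_ I) t|%:E).
  by apply/measurable_EFinP; exact: measurableT_comp.
apply: (@le_lt_trans _ _ (\int[m]_x (C * (\1_D x)%:E))%E).
  apply: ge0_le_integral => //=.
  - by move=> x _; exact: integral_ge0.
  - apply: (@measurable_fun_fubini_tonelli_F _ _ _ _ _ leb (abse \o f)).
      exact: measurableT_comp.
    by move=> x; exact: abse_ge0.
  - by apply: measurable_funeM; apply/measurable_EFinP; exact: measurable_indic.
  - move=> x _; rewrite muleC -ge0_integralZl//.
    apply: ge0_le_integral => //=.
    + move/measurable_EFinP : mf => mfr.
      apply/measurable_EFinP; apply: measurableT_comp => //.
      exact: (measurableT_comp mfr (measurable_pair1 x)).
    + exact: measurable_funeM.
    + move=> t _; rewrite lee_fin !normrM ger0_norm ?indicE//.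
      rewrite ler_wpM2l// ler_piMr//.
      by case: (_ < _); rewrite ?normr1 ?normr0.
rewrite ge0_integralZl//.
  by rewrite integral_indic// setIT muleC lte_mul_pinfty// ge0_fin_numE.
by apply/measurable_EFinP; exact: measurable_indic.
Qed.

Let FE x : fubini_F leb f x = ((\1_D x)%:E * \int[leb]_(t in I) ((k x < t)%R%:R * G t)%:E)%E.
Proof.
rewrite /fubini_F; case: (boolP (x \in D)) => xD; rewrite indicE ?xD ?(negbTE xD).
- rewrite mul1e [RHS]integral_mkcond; apply: eq_integral => t _.
  rewrite /f /= indicE xD mul1r /patch; case: ifP => _; first by rewrite mulrC.
  by rewrite mul0r.
- rewrite mul0e; apply: integral0_eq => t _; rewrite /f /= indicE (negbTE xD) mul0r //.
Qed.

Let GE t : fubini_G m f t = ((G \_ I) t * fine (m (D `&` [set x | k x < t])))%:E.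
Proof.
have mkt := measurable_sublevel t mk.
have mDk : measurable (D `&` [set x | k x < t]) by exact: measurableI.
rewrite /fubini_G EFinM fineK; last first.
  by rewrite ge0_fin_numE// (le_lt_trans _ Dfin)// le_measure ?inE.
rewrite -[X in m X]setIT -integral_indic//.
rewrite -integralZl//; last first.
  apply/integrableP; split.
    by apply/measurable_EFinP; exact: measurable_indic.
  under eq_integral do rewrite /= ger0_norm//.
  by rewrite integral_indic// setIT (le_lt_trans _ Dfin)// le_measure ?inE.
apply: eq_integral => x _; rewrite /f /= -EFinM; congr EFin.
by rewrite indicI /= !indicE [X in _ = _ * (_ * X)](_ : _ = (k x < t)%R%:R) ?mem_setE//; ring.
Qed.

Lemma fine_inner x : (\int[leb]_(t in I) ((k x < t)%R%:R * G t)%:E)%E \is a fin_num.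
Proof.
apply: integrable_fin_num => //.
apply: (rint_le _ _ _ (integrable_abse iG)) => //.
- apply: measurable_funM; last exact: rint_measurable iG.
  rewrite (_ : (fun _ => _) = (\1_(`]k x, +oo[%classic) : R -> R)).
    by apply: measurable_funTS; exact: measurable_indic.
  by apply/funext => t; rewrite indicE mem_setE in_itv /= andbT.
- move=> t _ /=; rewrite normrM ler_piMl//.
  by case: (_ < _); rewrite ?normr1 ?normr0.
Qed.

Lemma layer_integrable_inner :
  m.-integrable D (EFin \o (fun x => \int[leb]_(t in I) ((k x < t)%R%:R * G t))).
Proof.
have := integrable_fubini_F intf.
move=> /(integrableS measurableT mD (@subsetT _ _)).
apply: eq_integrable => // x xD /=.
by rewrite FE indicE xD mul1e /Rintegral fineK// fine_inner.
Qed.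

Lemma layer_integrable_outer :
  leb.-integrable I (EFin \o (fun t => G t * fine (m (D `&` [set x | k x < t])))).
Proof.
have mG := measurable_fubini_G intf.
have mIt : measurable_fun (I : set (measurableTypeR R)) (fun t => G t * fine (m (D `&` [set x | k x < t]))).
  apply/measurable_EFinP; have := measurable_funTS mG.
  move=> /(_ I); apply: eq_measurable_fun => t tI /=.
  by rewrite GE /patch tI.
have iB : leb.-integrable I (EFin \o (fun t => fine (m D) * `|G t|)).
  by apply: rintZ; [exact: measurable_itv|exact: (integrable_abse iG)].
apply: (rint_le _ mIt _ iB) => [|t _]; first exact: measurable_itv.
rewrite normrM mulrC ler_wpM2r// ger0_norm ?fine_ge0//.
have mkt := measurable_sublevel t mk.
have le : (m (D `&` [set x | k x < t]%R) <= m D)%E.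
  by rewrite le_measure ?inE//; exact: measurableI.
by rewrite fine_le// ge0_fin_numE// (le_lt_trans le).
Qed.

Lemma layer_fubini :
  \int[m]_(x in D) (\int[leb]_(t in I) ((k x < t)%R%:R * G t)) =
  \int[leb]_(t in I) (G t * fine (m (D `&` [set x | k x < t]))).
Proof.
have := Fubini intf; rewrite -/(fubini_F _ _) -/(fubini_G _ _) => H.
rewrite /Rintegral; congr fine; rewrite [LHS]integral_mkcond [RHS]integral_mkcond.
transitivity (\int[m]_x fubini_F leb f x)%E.
  apply: eq_integral => x _; rewrite FE /patch indicE; case: ifP => _.
    by rewrite mul1e fineK// fine_inner.
  by rewrite mul0e.
transitivity (\int[leb]_t fubini_G m f t)%E; first exact: H.
apply: eq_integral => t _; rewrite GE /patch; case: ifP => _ //.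
by rewrite mul0r.
Qed.

End LayerFubini.

Section ComplexDerivableRules.
Context {R : realType}.
Implicit Types (f g : R[i] -> R[i]) (z : R[i]).
Local Notation cderivable f z := (derivable (f : R[i]^o -> R[i]^o) z 1).

Lemma cderivableD f g z : cderivable f z -> cderivable g z ->
  cderivable (fun u => f u + g u) z.
Proof. exact: derivableD. Qed.

Lemma cderivableB f g z : cderivable f z -> cderivable g z ->
  cderivable (fun u => f u - g u) z.
Proof. exact: derivableB. Qed.

Lemma cderivableM f g z : cderivable f z -> cderivable g z ->
  cderivable (fun u => f u * g u) z.
Proof. exact: derivableM. Qed.

Lemma cderivable_id z : cderivable id z.
Proof. exact: derivable_id. Qed.

Lemma cderivable_cst (c : R[i]) z : cderivable (fun=> c) z.
Proof. exact: derivable_cst. Qed.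

(** The shape of the continuation [g] constructed below, with its building blocks left abstract. *)
Lemma cderivable_combination f g h (a b v : R[i]) z :
  cderivable f z -> cderivable g z -> cderivable h z ->
  cderivable (fun u => (u + a) * (f u + v * h u - u * g u) - b * (u * h u)) z.
Proof.
move=> df dg dh; have di := @cderivable_id z.
apply: cderivableB; last first.
  by apply: cderivableM; [exact: cderivable_cst|exact: cderivableM].
apply: cderivableM; first by apply: cderivableD; [|exact: cderivable_cst].
apply: cderivableB; last exact: cderivableM.
by apply: cderivableD; [|apply: cderivableM; [exact: cderivable_cst|]].
Qed.

End ComplexDerivableRules.

(** * From a volume expansion to the leading pole *)

Section AbstractRLCT.
Context d (S : measurableType d) {R : realType}.
Variables (m : {sigma_finite_measure set S -> \bar R}).
Variables (k : S -> R).
Hypothesis mk : measurable_fun setT k.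
Local Notation leb := (@lebesgue_measure R).
Local Notation Re := (@complex.Re R).
Local Notation Im := (@complex.Im R).

Lemma layer_cfubini (D : set S) (T : R) (f : R -> R[i]) :
  measurable D -> (m D < +oo)%E -> cintegrable leb `]0%R, T] f ->
  cintegrable m D (fun x => cintegral leb `]0%R, T]
    (fun t => ((k x < t)%R%:R%:C)%C * f t)) /\
  cintegral m D (fun x => cintegral leb `]0%R, T]
    (fun t => ((k x < t)%R%:R%:C)%C * f t)) =
  cintegral leb `]0%R, T] (fun t => ((fine (m (D `&` [set x | k x < t])))%:C)%C * f t).
Proof.
move=> mD Df [f1 f2].
have e1 x : Re (cintegral leb `]0%R, T] (fun t => ((k x < t)%R%:R%:C)%C * f t)) =
    \int[leb]_(t in `]0%R, T]) ((k x < t)%R%:R * Re (f t)).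
  by apply: eq_Rintegral => t _; rewrite ReM /= mul0r subr0.
have e2 x : Im (cintegral leb `]0%R, T] (fun t => ((k x < t)%R%:R%:C)%C * f t)) =
    \int[leb]_(t in `]0%R, T]) ((k x < t)%R%:R * Im (f t)).
  by apply: eq_Rintegral => t _; rewrite ImM /= mul0r addr0.
split; first split.
- apply: eq_integrable (layer_integrable_inner mD Df mk f1) => // x _ /=.
  by congr EFin; rewrite -e1.
- apply: eq_integrable (layer_integrable_inner mD Df mk f2) => // x _ /=.
  by congr EFin; rewrite -e2.
- apply: complex_eqP.
  + rewrite [LHS](eq_Rintegral _ (g := fun x => \int[leb]_(t in `]0%R, T])
      ((k x < t)%R%:R * Re (f t)))); last by move=> x _; rewrite e1.
    rewrite (layer_fubini mD Df mk f1); apply: eq_Rintegral => t _.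
    by rewrite ReM /= mul0r subr0 mulrC.
  + rewrite [LHS](eq_Rintegral _ (g := fun x => \int[leb]_(t in `]0%R, T])
      ((k x < t)%R%:R * Im (f t)))); last by move=> x _; rewrite e2.
    rewrite (layer_fubini mD Df mk f2); apply: eq_Rintegral => t _.
    by rewrite ImM /= mul0r addr0 mulrC.
Qed.

Lemma rint_cst (D : set S) (r : R) : measurable D -> (m D < +oo)%E ->
  m.-integrable D (EFin \o (fun=> r)).
Proof.
move=> mD Df; apply/integrableP; split; first exact: measurable_cst.
by rewrite /= integral_cst// lte_mul_pinfty.
Qed.

Lemma cintegrable_cst (D : set S) (c : R[i]) : measurable D -> (m D < +oo)%E ->
  cintegrable m D (fun=> c).
Proof.
move=> mD Df.
by split; exact: rint_cst.
Qed.

Lemma cintegral_cst (D : set S) (c : R[i]) : measurable D -> (m D < +oo)%E ->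
  cintegral m D (fun=> c) = ((fine (m D))%:C)%C * c.
Proof.
move=> mD Df; apply: complex_eqP; rewrite ?ReM ?ImM /cintegral /= Rintegral_cst//.
- by rewrite mul0r subr0 mulrC.
- by rewrite mul0r addr0 mulrC.
Qed.

Variables (D0 : set S) (Kx lam c C T : R).
Hypotheses (mD0 : measurable D0) (D0fin : (m D0 < +oo)%E).
Hypothesis k_ge0 : forall x, D0 x -> 0 <= k x.
Hypothesis k_le : forall x, D0 x -> k x <= Kx.
Hypotheses (lam0 : 0 < lam) (c0 : 0 < c) (T0 : 0 < T).
Hypothesis volE : forall t, 0 < t -> t <= T ->
  `|fine (m (D0 `&` [set x | k x < t])) - c * t `^ lam| <= C * t `^ (lam + 1 / 2).

(** The volume expansion is known only up to level T. Above that level k lies between T and [Kx], so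
    [D2] contributes an entire function. *)
Let D1 := D0 `&` ~` [set x | T < k x].
Let D2 := D0 `&` [set x | T < k x].

Let mgt : measurable [set x | T < k x].
Proof.
rewrite -[X in measurable X]setTI.
have -> : [set x | T < k x] = k @^-1` `]T, +oo[.
  by apply/seteqP; split => x /=; rewrite in_itv /= andbT.
by apply: mk => //; exact: measurable_itv.
Qed.

Let mD1 : measurable D1. Proof. by apply: measurableI => //; exact: measurableC. Qed.
Let mD2 : measurable D2. Proof. exact: measurableI. Qed.
Let D1fin : (m D1 < +oo)%E.
Proof. by rewrite (le_lt_trans _ D0fin)// le_measure ?inE//; exact: subIsetl. Qed.
Let D2fin : (m D2 < +oo)%E.
Proof. by rewrite (le_lt_trans _ D0fin)// le_measure ?inE//; exact: subIsetl. Qed.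

Let D12 : D0 = D1 `|` D2. Proof. by rewrite setUC setUIDK. Qed.

Let D12_disj : [disjoint D1 & D2].
Proof. by apply/disj_setPS => x [[_ h] [_ h']]. Qed.

Let V t := fine (m (D1 `&` [set x | k x < t])).
Let E t := V t - c * t `^ lam.
Let w t := E t * t^-1.

Let VE t : t <= T -> V t = fine (m (D0 `&` [set x | k x < t])).
Proof.
move=> tT; rewrite /V; congr (fine (m _)); apply/seteqP; split => x /= [].
  by move=> [].
move=> D0x kt; split => //; split => //=; apply/negP; rewrite -leNgt.
exact: ltW (lt_le_trans kt tT).
Qed.

Let mV : measurable_fun (`]0, T]%classic : set (measurableTypeR R)) V.
Proof.
(* The constant weight 1, written as t^0 so that [integrable_powR] covers it. *)
have iG : leb.-integrable `]0, T] (EFin \o (fun t : R => t `^ 0)).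
  by apply: integrable_powR => //; rewrite ltrN10.
have := rint_measurable (layer_integrable_outer mD1 D1fin mk iG).
by apply: eq_measurable_fun => t _; rewrite powRr0 mul1r.
Qed.

Let posI t : (`]0%R, T]%classic : set R) t -> 0 < t.
Proof. by rewrite /= in_itv /= => /andP[]. Qed.

Let mw : measurable_fun (`]0, T]%classic : set (measurableTypeR R)) w.
Proof.
apply: measurable_funM; last first.
  apply: (eq_measurable_fun (fun t => t `^ (-1))).
    by move=> t; rewrite inE => /posI t0; rewrite powRN powRr1// ltW.
  by apply: measurable_funTS; exact: measurable_powR.
apply: measurable_funB => //; apply: measurable_funM => //.
by apply: measurable_funTS; exact: measurable_powR.
Qed.

(** |w t| t^a <= C t^(lam - 1/2 + a), integrable at 0 when the exponent exceeds -1. This sets the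
    half-plane of the continuation. *)
Let wk a : - lam - 1 / 2 < a ->
  leb.-integrable `]0%R, T] (EFin \o (fun t => w t * t `^ a)).
Proof.
move=> ha; have h1 : -1 < lam - 1 / 2 + a by move: ha; lra.
apply: (rint_le _ _ _ (rintZ _ C (integrable_powR h1 T0))) => //.
  by apply: measurable_funM => //; apply: measurable_funTS; exact: measurable_powR.
move=> t tI; have t0 := posI tI.
have tT : t <= T by move: tI; rewrite /= in_itv /= => /andP[].
have := volE t0 tT; rewrite -VE// -/(E t) => vE.
rewrite /w !normrM normfV (gtr0_norm t0) (ger0_norm (powR_ge0 _ _)) -mulrA.
have tp : 0 <= t^-1 * t `^ a by rewrite mulr_ge0 ?powR_ge0 ?invr_ge0 ?ltW.
apply: le_trans (ler_wpM2r tp vE) _.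
rewrite -[t^-1]powR_inv1 ?(ltW t0)// -mulrA -!powRD_gt0//.
have -> : lam + 1 / 2 + (-1 + a) = lam - 1 / 2 + a by field.
exact: lexx.
Qed.

Let H z := cintegral leb `]0%R, T] (fun t => ((w t)%:C)%C * cpow t z).
Let zfar z := cintegral m D2 (fun x => ((cst (1 : R) x)%:C)%C * cpow (k x) z).
Let VT := ((fine (m D1))%:C)%C.
Let lamC : R[i] := (lam%:C)%C.
Let cC : R[i] := (c%:C)%C.

(** On [D1] the layer-cake formula gives V(T) T^z - z int_0^T V(t) t^(z-1) dt. The main term c t^lam
    of V integrates to c T^(z+lam) / (z+lam) and the error term to [H z]; multiplying by z + lam
    clears the denominator. *)
Let g z := (z + lamC) * (zfar z + VT * cpow T z - z * H z) - cC * z * cpow T (z + lamC).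

Let k0D2 x : D2 x -> 0 < k x. Proof. by move=> [_ /=]; exact: lt_trans. Qed.

Let farint a : m.-integrable D2 (EFin \o (fun x => cst (1 : R) x * k x `^ a)).
Proof.
(* The sum covers both signs of a: k^a is at most [Kx^a] for a >= 0 and at most T^a for a < 0. *)
apply: (rint_le mD2 _ _ (_ : m.-integrable D2 (EFin \o (fun=> T `^ a + Kx `^ a)))).
- apply: measurable_funM => //.
  exact: (measurable_funTS (measurableT_comp (measurable_powR a) mk)).
- move=> x Dx; rewrite mul1r ger0_norm ?powR_ge0//.
  have k0 := k0D2 Dx; have [D0x /= Tk] := Dx; have kK := k_le D0x.
  have K0 : 0 < Kx by exact: lt_le_trans kK.
  case: (leP 0 a) => a0.
  + apply: (@le_trans _ _ (Kx `^ a)); last by rewrite lerDr powR_ge0.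
    by apply: ge0_ler_powR; rewrite ?nnegrE ?(ltW k0) ?(ltW K0).
  + apply: (@le_trans _ _ (T `^ a)); last by rewrite lerDl powR_ge0.
    rewrite !powRE// ler_expR; apply: ler_wnM2l; first exact: ltW.
    by rewrite ler_ln ?posrE// ltW.
- exact: rint_cst.
Qed.

Let zfar_derivable z : derivable (zfar : R[i]^o -> R[i]^o) z 1.
Proof.
apply: (@derivable_mellin _ _ R m D2 k (cst 1) (Re z - 1)) => //.
- exact: measurable_funTS.
- by rewrite ltrBlDr ltrDl.
Qed.

Let H_derivable z : - lam - 1 / 2 < Re z -> derivable (H : R[i]^o -> R[i]^o) z 1.
Proof.
move=> hz; apply: (@derivable_mellin _ _ R leb `]0, T]%classic id w (- lam - 1 / 2)) => //.
Qed.

Let g_derivable z : - lam - 1 / 2 < Re z -> derivable (g : R[i]^o -> R[i]^o) z 1.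
Proof.
move=> hz.
have dH := @H_derivable z hz; have dz := @zfar_derivable z.
have dT := @derivable_cpow R T z T0.
have -> : g = fun u => (u + lamC) * (zfar u + VT * cpow T u - u * H u) -
    (cC * cpow T lamC) * (u * cpow T u).
  apply/funext => u; rewrite /g cpowD//.
  by move: (zfar u) (H u) (cpow T u) (cpow T lamC) lamC VT cC => *; ring.
exact: cderivable_combination.
Qed.

Let cint_cpowk z (D : set S) : measurable D -> D `<=` D0 -> 0 < Re z ->
  cintegrable m D (fun x => cpow (k x) z).
Proof.
move=> mD DD hz.
(* [D] may contain zeros of k, where [cpow] is 0 by convention; this indicator lets one formula
   describe both cases. *)
have mk0 : measurable_fun setT (\1_([set~ 0] : set R) : R -> R).
  by apply: measurable_indic; exact: measurableC.
have mln : measurable_fun setT (@ln R) by exact: measurable_ln.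
have mc : measurable_fun setT (fun u : R => cos (Im z * ln u)).
  apply: (@measurableT_comp _ _ _ _ _ _ (@cos R)); last exact: measurable_funM.
  by apply: continuous_measurable_fun; exact: continuous_cos.
have ms : measurable_fun setT (fun u : R => sin (Im z * ln u)).
  apply: (@measurableT_comp _ _ _ _ _ _ (@sin R)); last exact: measurable_funM.
  by apply: continuous_measurable_fun; exact: continuous_sin.
have mp : measurable_fun setT (fun u : R => u `^ Re z) by exact: measurable_powR.
have Dfin : (m D < +oo)%E by rewrite (le_lt_trans _ D0fin)// le_measure ?inE.
have ib : m.-integrable D (EFin \o (fun=> Kx `^ Re z)).
  exact: rint_cst.
have bound x : D x -> k x != 0 -> k x `^ Re z <= Kx `^ Re z.
  move=> Dx _; have D0x := DD _ Dx; apply: ge0_ler_powR; rewrite ?nnegrE ?(ltW hz) ?k_ge0 ?k_le//.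
  exact: le_trans (k_ge0 D0x) (k_le D0x).
have kpos x : D x -> k x != 0 -> 0 < k x.
  by move=> /DD Dx h; rewrite lt_def h k_ge0.
split; apply: (rint_le mD _ _ ib).
- rewrite (_ : _ \o _ = (fun u => \1_([set~ 0] : set R) u * (u `^ Re z * cos (Im z * ln u))) \o k).
    apply: measurableT_comp; last exact: measurable_funTS.
    by apply: measurable_funM => //; exact: measurable_funM.
  apply/funext => x /=; rewrite /cpow indicE; case: eqVneq => [->|h] /=.
    by rewrite memNset//= mul0r.
  by rewrite mem_set ?mul1r//=; apply/eqP.
- move=> x Dx /=; have [k0|kn] := eqVneq (k x) 0.
    by rewrite /cpow k0 eqxx normr0 powR_ge0.
  exact: le_trans (norm_Re_cpow z (kpos _ Dx kn)) (bound _ Dx kn).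
- rewrite (_ : _ \o _ = (fun u => \1_([set~ 0] : set R) u * (u `^ Re z * sin (Im z * ln u))) \o k).
    apply: measurableT_comp; last exact: measurable_funTS.
    by apply: measurable_funM => //; exact: measurable_funM.
  apply/funext => x /=; rewrite /cpow indicE; case: eqVneq => [->|h] /=.
    by rewrite memNset//= mul0r.
  by rewrite mem_set ?mul1r//=; apply/eqP.
- move=> x Dx /=; have [k0|kn] := eqVneq (k x) 0.
    by rewrite /cpow k0 eqxx normr0 powR_ge0.
  exact: le_trans (norm_Im_cpow z (kpos _ Dx kn)) (bound _ Dx kn).
Qed.

Let g_zeta z : 0 < Re z ->
  g z = (z + lamC) * cintegral m D0 (fun x => cpow (k x) z).
Proof.
move=> hz; pose f t := cpow t (z - 1).
have fi : cintegrable leb `]0%R, T] f by exact: cintegrable_cpowB1.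
have [ii iE] := layer_cfubini mD1 D1fin fi.
have hw : - lam - 1 / 2 < Re z by move: hz lam0; lra.
have iH : cintegrable leb `]0%R, T] (fun t => ((w t)%:C)%C * cpow t z).
  by apply: (@cintegrable_cpow _ _ R leb `]0, T]%classic id w (- lam - 1 / 2)).
have hzl : 0 < Re (z + lamC) by rewrite ReD /= addr_gt0.
have fl : cintegrable leb `]0%R, T] (fun t => cpow t (z + lamC - 1)).
  exact: cintegrable_cpowB1.
have split12 : cintegral m D0 (fun x => cpow (k x) z) =
    cintegral m D1 (fun x => cpow (k x) z) + cintegral m D2 (fun x => cpow (k x) z).
  rewrite {1}D12 cintegral_setU//; rewrite -D12; exact: cint_cpowk.
have farE : cintegral m D2 (fun x => cpow (k x) z) = zfar z.
  by apply: eq_cintegral => x _; rewrite /cst mul1r.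
have nearE : cintegral m D1 (fun x => cpow (k x) z) = VT * cpow T z -
    z * cintegral leb `]0%R, T] (fun t => ((V t)%:C)%C * f t).
  rewrite -[X in z * X]iE -cintegralZ// -cintegral_cst// -cintegralB//.
  - apply: eq_cintegral => x [D0x /= Tk]; apply: layer_cpow => //; first exact: k_ge0.
    by rewrite leNgt; apply/negP.
  - exact: cintegrable_cst.
  - exact: cintegrableZ.
have VfE : cintegral leb `]0%R, T] (fun t => ((V t)%:C)%C * f t) =
    cC * cintegral leb `]0%R, T] (fun t => cpow t (z + lamC - 1)) + H z.
  rewrite /H -cintegralZ// -cintegralD//; last exact: cintegrableZ.
  apply: eq_cintegral => t /posI t0.
  have tN : cpow t (-1) = ((t^-1)%:C)%C.
    by rewrite (_ : -1 = ((-1)%:C)%C) ?cpow_real// ?powR_inv1 ?ltW// rmorphN.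
  have -> : V t = c * t `^ lam + E t by rewrite /E; ring.
  rewrite /f /w /lamC /cC !cpowD// tN cpow_real//; move: (E t) => e.
  by rewrite !rmorphD !rmorphM /=; ring.
have Jl := cintegral_cpow_oc hzl T0.
rewrite /g split12 farE nearE VfE -Jl; ring.
Qed.

Lemma rlct_of_volume : exists eps : R, 0 < eps /\
  exists g : R[i] -> R[i],
    (forall z : R[i], - lam - eps < complex.Re z ->
        derivable (g : R[i]^o -> R[i]^o) z 1) /\
    (forall z : R[i], 0 < complex.Re z ->
        g z = (z + (lam%:C)%C) ^+ 1 * cintegral m D0 (fun x => cpow (k x) z)) /\
    g (- (lam%:C)%C) != 0.
Proof.
exists (1 / 2); split; first by rewrite divr_gt0.
exists g; split; first exact: g_derivable.
split; first by move=> z hz; rewrite expr1 g_zeta.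
(* At z = -lam only the last term of [g] survives, with value c lam. *)
rewrite /g addNr mul0r sub0r cpow0// mulr1 mulrN opprK mulf_neq0//.
- by rewrite /cC -[0]/((0%:C)%C) (inj_eq (@complexI R)) gt_eqF.
- by rewrite /lamC -[0]/((0%:C)%C) (inj_eq (@complexI R)) gt_eqF.
Qed.

End AbstractRLCT.

(** * The Kullback-Leibler divergence *)

Section TonelliCat.
Context {R : realType}.
Local Notation leb := (@lebesgue_measure R).
Local Open Scope ereal_scope.

Lemma measurable_cat_tuple n1 n2 :
  measurable_fun [set: n1.-tuple R * n2.-tuple R]
    (fun p => cat_tuple p.1 p.2 : (n1 + n2).-tuple R).
Proof.
apply/measurable_fun_tnthP => i; case: (split_ordP i) => j ->.
- rewrite (_ : _ \o _ = (fun v : n1.-tuple R => tnth v j) \o fst).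
    by apply: measurableT_comp; [exact: measurable_tnth|exact: measurable_fst].
  by apply/funext => p /=; rewrite tnth_lshift.
- rewrite (_ : _ \o _ = (fun v : n2.-tuple R => tnth v j) \o snd).
    by apply: measurableT_comp; [exact: measurable_tnth|exact: measurable_snd].
  by apply/funext => p /=; rewrite tnth_rshift.
Qed.

Lemma measurable_integral_cat n1 n2 (f : (n1 + n2).-tuple R -> \bar R) :
  measurable_fun [set: (n1 + n2).-tuple R] f -> (forall v, 0 <= f v) ->
  measurable_fun [set: n1.-tuple R] (fun x => \int[lebM n2]_y f (cat_tuple x y)).
Proof.
move=> mf f0; apply: (@measurable_fun_fubini_tonelli_F _ _ _ _ _ (lebM n2)
  (fun p => f (cat_tuple p.1 p.2))).
- by apply: measurableT_comp => //; exact: measurable_cat_tuple.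
- by move=> p; exact: f0.
Qed.

(** Separates x from (y, c) in [K1], which integrates over a single concatenated vector. *)
Lemma ge0_integral_lebM_cat n1 n2 (f : (n1 + n2).-tuple R -> \bar R) :
  measurable_fun [set: (n1 + n2).-tuple R] f -> (forall v, 0 <= f v) ->
  \int[lebM (n1 + n2)]_v f v =
  \int[lebM n1]_x \int[lebM n2]_y f (cat_tuple x y).
Proof.
elim: n1 f => [|n1 IH] f mf f0.
  rewrite ge0_integral_lebM0; apply: eq_integral => y _.
  by congr f; exact: val_inj.
rewrite [LHS](@ge0_integral_lebMS R (n1 + n2) f mf f0).
rewrite (@ge0_integral_lebMS R n1 (fun x => \int[lebM n2]_y f (cat_tuple x y))).
- apply: eq_integral => t _; rewrite IH//.
    apply: eq_integral => x _; apply: eq_integral => y _.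
    by congr f; exact: val_inj.
  by apply: measurableT_comp => //; exact: measurable_consl.
- exact: measurable_integral_cat.
- by move=> x; exact: integral_ge0.
Qed.

End TonelliCat.

Section ProductDensity.
Context {R : realType}.
Local Notation leb := (@lebesgue_measure R).

Lemma measurable_density_sum n (g h : 'I_n -> R -> R) (a : R) :
  (forall i, measurable_fun setT (g i)) -> (forall i, measurable_fun setT (h i)) ->
  measurable_fun [set: n.-tuple R]
    (fun v => (\prod_i g i (tnth v i) * (a + \sum_i h i (tnth v i)))%:E).
Proof.
move=> mg mh; apply/measurable_EFinP; apply: measurable_funM.
  by apply: measurable_prod => i _; apply: measurableT_comp => //; exact: measurable_tnth.
apply: measurable_funD => //; apply: measurable_sum => i.
by apply: measurableT_comp => //; exact: measurable_tnth.
Qed.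

Lemma density_sum_ge0 n (g h : 'I_n -> R -> R) (a : R) (v : n.-tuple R) :
  (forall i s, 0 <= g i s) -> (forall i s, 0 <= h i s) -> 0 <= a ->
  (0 <= (\prod_i g i (tnth v i) * (a + \sum_i h i (tnth v i)))%:E)%E.
Proof.
move=> g0 h0 a0; rewrite lee_fin mulr_ge0//; first exact: prodr_ge0.
by rewrite addr_ge0//; exact: sumr_ge0.
Qed.

(** The expectation of a sum of one-coordinate functions under a product of probability densities.
    The constant [a] is generalised in the induction because it absorbs the term of the coordinate
    being peeled off. *)
Lemma ge0_integral_product_density n (g h : 'I_n -> R -> R) (I : 'I_n -> R) (a : R) :
  (forall i, measurable_fun setT (g i)) -> (forall i, measurable_fun setT (h i)) ->
  (forall i s, 0 <= g i s) -> (forall i s, 0 <= h i s) -> 0 <= a ->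
  (forall i, \int[leb]_s (g i s)%:E = 1)%E ->
  (forall i, \int[leb]_s (g i s * h i s)%:E = (I i)%:E)%E ->
  (\int[lebM n]_v (\prod_i g i (tnth v i) * (a + \sum_i h i (tnth v i)))%:E =
   (a + \sum_i I i)%:E)%E.
Proof.
move=> mg mh g0 h0; elim: n g h I mg mh g0 h0 a => [|n IH] g h I mg mh g0 h0 a a0 g1 gh.
  by rewrite ge0_integral_lebM0 !big_ord0 mul1r.
have I0 i : 0 <= I i.
  by rewrite -lee_fin -gh; apply: integral_ge0 => s _; rewrite lee_fin mulr_ge0.
rewrite ge0_integral_lebMS; last 2 first.
- exact: measurable_density_sum.
- by move=> v; exact: density_sum_ge0.
have ah t : 0 <= a + h ord0 t by rewrite addr_ge0.
transitivity (\int[leb]_t ((g ord0 t * ((a + \sum_(i < n) I (lift ord0 i)) + h ord0 t))%:E))%E.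
  apply: eq_integral => t _.
  transitivity (\int[lebM n]_v ((g ord0 t)%:E * (\prod_i g (lift ord0 i) (tnth v i) *
      ((a + h ord0 t) + \sum_i h (lift ord0 i) (tnth v i)))%:E))%E.
    apply: eq_integral => v _; rewrite -EFinM !big_ord_recl !tnth0.
    rewrite (eq_bigr (fun i => g (lift ord0 i) (tnth v i))); last first.
      by move=> i _; rewrite tnthS.
    rewrite [X in _ * (a + (_ + X))](eq_bigr (fun i => h (lift ord0 i) (tnth v i))).
      by congr EFin; ring.
    by move=> i _; rewrite tnthS.
  rewrite ge0_integralZl//; last 3 first.
  - by apply: (@measurable_density_sum n (fun i => g (lift ord0 i)) (fun i => h (lift ord0 i))).
  - move=> v _.
    by apply: (@density_sum_ge0 n (fun i => g (lift ord0 i)) (fun i => h (lift ord0 i))).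
  - by rewrite lee_fin.
  rewrite (IH (fun i => g (lift ord0 i)) (fun i => h (lift ord0 i)) (fun i => I (lift ord0 i)))//.
  by rewrite -EFinM; congr EFin; ring.
set b := a + _; have b0 : 0 <= b by rewrite addr_ge0// sumr_ge0.
transitivity (\int[leb]_t (b%:E * (g ord0 t)%:E + (g ord0 t * h ord0 t)%:E))%E.
  by apply: eq_integral => t _; rewrite -EFinM -EFinD; congr EFin; ring.
rewrite ge0_integralD//; last 4 first.
- by move=> t _; rewrite -EFinM lee_fin mulr_ge0.
- by apply: measurable_funeM; apply/measurable_EFinP; exact: mg.
- by move=> t _; rewrite lee_fin mulr_ge0 ?g0 ?h0.
- by apply/measurable_EFinP; apply: measurable_funM; [exact: mg|exact: mh].
rewrite ge0_integralZl//; last 2 first.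
- by apply/measurable_EFinP; exact: mg.
- by move=> t _; rewrite lee_fin.
by rewrite g1 gh mule1 -EFinD /b big_ord_recl; congr EFin; ring.
Qed.

End ProductDensity.

(** * One-dimensional Gaussian integrals *)

Section Gaussian1D.
Context {R : realType}.
Local Notation leb := (@lebesgue_measure R).

Lemma ge0_integral_opp (f : R -> \bar R) :
  measurable_fun [set: R] f -> (forall x, 0 <= f x)%E ->
  (\int[leb]_x f x = \int[leb]_x f (- x)%R)%E.
Proof.
move=> mf f0; pose phi (x : R) := - x.
have mphi : measurable_fun [set: measurableTypeR R] phi by exact: oppr_measurable.
have [nu nuE] : exists nu : {measure set (measurableTypeR R) -> \bar R},
    (nu : set _ -> \bar R) = pushforward leb (phi : _ -> measurableTypeR R).
  unshelve (refine (ex_intro _ (pushforward leb (phi : _ -> measurableTypeR R)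
    : {measure set _ -> \bar R}) _)) => //.
have lebE (A : set (measurableTypeR R)) : measurable A -> leb A = nu A.
  move=> mA; apply: lebesgue_measure_unique => // X /ocitvP[->|[[u v] /= uv ->]].
    by rewrite !measure0.
  rewrite nuE /pushforward.
  have -> : phi @^-1` `]u, v]%classic = `[(- v)%R, (- u)%R[%classic.
    apply/seteqP; split => x; rewrite /phi /= !in_itv /= => /andP[h1 h2];
      by apply/andP; split; [rewrite 1?lerNl 1?ltrNr|rewrite 1?lerNl 1?ltrNr];
      move: h1 h2; lra.
  rewrite !lebesgue_measure_itv /= !lte_fin ltrN2 uv.
  by rewrite -!EFinD opprK addrC.
rewrite (eq_measure_integral nu); last by move=> A mA _; exact: lebE.
by rewrite nuE ge0_integral_pushforward.
Qed.

(** The normal density with mean [mu] and precision [tau], that is, variance 1/tau. *)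
Definition gd (tau mu s : R) : R :=
  Num.sqrt (tau / (2 * pi)) * expR (- tau * (s - mu) ^+ 2 / 2).

Lemma gd_ge0 tau mu s : 0 <= gd tau mu s.
Proof. by rewrite mulr_ge0 ?sqrtr_ge0 ?expR_ge0. Qed.

Lemma measurable_gd tau mu : measurable_fun setT (gd tau mu).
Proof.
apply: measurable_funM => //; apply: measurableT_comp => //.
apply: measurable_funM => //; apply: measurable_funM => //.
by apply: measurable_funX; exact: measurable_funB.
Qed.

Lemma gdE tau mu : 0 < tau -> gd tau mu = normal_pdf mu (Num.sqrt tau)^-1.
Proof.
move=> t0; apply/funext => s.
have s0 : (Num.sqrt tau)^-1 != 0 by rewrite invr_neq0// sqrtr_eq0 -ltNge.
rewrite normal_pdfE// /normal_peak /normal_fun /gd exprVn sqr_sqrtr ?(ltW t0)//.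
have p0 := pi_gt0 R.
congr (_ * expR _); last first.
  by rewrite -mulr_natr; field; rewrite gt_eqF.
rewrite -sqrtrV; last by rewrite mulrn_wge0// mulr_ge0 ?pi_ge0// invr_ge0 ltW.
congr Num.sqrt; move: (@pi R) p0 => p p0; rewrite -mulr_natr; field.
by rewrite !gt_eqF.
Qed.

Lemma integral_gd tau mu : 0 < tau -> (\int[leb]_s (gd tau mu s)%:E = 1)%E.
Proof. by move=> t0; rewrite gdE// integral_normal_pdf. Qed.

(** Half of the exponent absorbs the square: with u = tau s^2 / 4, u exp(-u) <= 1, and what remains
    is a multiple of the density of precision tau/2. *)
Lemma gd_second_moment_fin tau : 0 < tau ->
  (\int[leb]_s (gd tau 0 s * (tau / 2 * s ^+ 2))%:E < +oo)%E.
Proof.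
move=> t0; have t20 : 0 < tau / 2 by rewrite divr_gt0.
(* The 2 comes from tau s^2 / 2 = 2u; the quotient exchanges the two normalising constants. *)
pose c := 2 * Num.sqrt (tau / (2 * pi)) / Num.sqrt (tau / 2 / (2 * pi)).
have sp : 0 < Num.sqrt (tau / 2 / (2 * pi)).
  by rewrite sqrtr_gt0 divr_gt0// mulr_gt0 ?pi_gt0.
have c0 : 0 <= c by rewrite divr_ge0 ?mulr_ge0 ?sqrtr_ge0.
have mg : measurable_fun setT (fun s => (gd (tau / 2) 0 s)%:E).
  by apply/measurable_EFinP; exact: measurable_gd.
apply: (@le_lt_trans _ _ (\int[leb]_s (c%:E * (gd (tau / 2) 0 s)%:E))%E); last first.
  rewrite ge0_integralZl//; first by rewrite integral_gd// mule1 ltry.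
  by move=> s _; rewrite lee_fin gd_ge0.
apply: ge0_le_integral => //.
- move=> s _; rewrite lee_fin; apply: mulr_ge0; first exact: gd_ge0.
  by apply: mulr_ge0; [exact: ltW|exact: sqr_ge0].
- apply/measurable_EFinP; apply: measurable_funM; first exact: measurable_gd.
  by apply: measurable_funM => //; exact: measurable_funX.
- exact: measurable_funeM.
move=> s _; rewrite -EFinM lee_fin /gd subr0.
rewrite /c [leRHS]mulrA divfK ?gt_eqF//.
set S := Num.sqrt (tau / (2 * pi)).
have -> : expR (- tau * s ^+ 2 / 2) = expR (- (tau / 2) * s ^+ 2 / 2) * expR (- (tau / 4 * s ^+ 2)).
  by rewrite -expRD; congr expR; field.
set X := expR (- (tau / 2) * s ^+ 2 / 2).
set u := tau / 4 * s ^+ 2.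
have u0 : 0 <= u by rewrite mulr_ge0 ?sqr_ge0// divr_ge0// ltW.
have eu : expR (- u) * u <= 1.
  have := expR_ge1Dx u; have e1 : expR (- u) * expR u = 1 by rewrite -expRD addNr expR0.
  have := expR_gt0 (- u); nra.
have SX : 0 <= 2 * S * X by rewrite !mulr_ge0 ?sqrtr_ge0 ?expR_ge0.
have := ler_wpM2l SX eu; rewrite mulr1; apply: le_trans.
by rewrite /u le_eqVlt; apply/orP; left; apply/eqP; field.
Qed.

(** Left unevaluated: it enters both terms of the divergence and cancels in [K1E]. *)
Definition gkappa tau := fine (\int[leb]_s (gd tau 0 s * (tau / 2 * s ^+ 2))%:E)%E.

Lemma measurable_gd_sqr tau mu c d :
  measurable_fun [set: R] (fun s => (gd tau mu s * (c * (s + d) ^+ 2))%:E).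
Proof.
apply/measurable_EFinP; apply: measurable_funM; first exact: measurable_gd.
by apply: measurable_funM => //; apply: measurable_funX; exact: measurable_funD.
Qed.

(** After centring, the shifts dl and -dl give equal integrals by reflection, and their sum has no
    cross term by the parallelogram identity. All integrands thus stay nonnegative. *)
Lemma integral_gd_second_moment tau mu dl : 0 < tau ->
  (\int[leb]_s (gd tau mu s * (tau / 2 * (s - mu + dl) ^+ 2))%:E =
   (gkappa tau + tau / 2 * dl ^+ 2)%:E)%E.
Proof.
move=> t0; have t20 : 0 <= tau / 2 by rewrite divr_ge0// ltW.
pose F dl s := (gd tau 0 s * (tau / 2 * (s + dl) ^+ 2))%:E.
have mF d : measurable_fun [set: R] (F d) by exact: measurable_gd_sqr.
have G0 mu' d s : (0 <= (gd tau mu' s * (tau / 2 * (s + d) ^+ 2))%:E)%E.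
  by rewrite lee_fin; apply: mulr_ge0; [exact: gd_ge0|apply: mulr_ge0 => //; exact: sqr_ge0].
have F0 d s : (0 <= F d s)%E by exact: G0.
have -> : (\int[leb]_s (gd tau mu s * (tau / 2 * ((s - mu)%R + dl)%R ^+ 2))%:E =
    \int[leb]_s F dl s)%E.
  transitivity (\int[leb]_s (gd tau mu s * (tau / 2 * (s + (dl - mu)%R) ^+ 2))%:E)%E.
    by apply: eq_integral => s _; congr EFin; ring.
  rewrite (@ge0_integral_affine R 1 mu)// ?mul1e; last exact: measurable_gd_sqr.
  apply: eq_integral => s _; rewrite /F /gd mul1r addrK subr0.
  by congr EFin; ring.
have sym : (\int[leb]_s F (- dl)%R s = \int[leb]_s F dl s)%E.
  rewrite ge0_integral_opp//; apply: eq_integral => s _.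
  by rewrite /F /gd !subr0 sqrrN -opprD sqrrN.
have kE : (\int[leb]_s F 0%R s = (gkappa tau)%:E)%E.
  rewrite /gkappa fineK.
    by apply: eq_integral => s _; rewrite /F addr0.
  rewrite ge0_fin_numE ?gd_second_moment_fin//.
  by apply: integral_ge0 => s _; rewrite lee_fin; apply: mulr_ge0; [exact: gd_ge0|apply: mulr_ge0 => //; exact: sqr_ge0].
have D : (\int[leb]_s F dl s + \int[leb]_s F (- dl)%R s =
    (2 * gkappa tau + tau * dl ^+ 2)%:E)%E.
  rewrite -(ge0_integralD leb measurableT (fun s _ => F0 dl s) (mF dl)
    (fun s _ => F0 (- dl)%R s) (mF (- dl)%R)).
  transitivity (\int[leb]_s (2%:E * F 0%R s + (tau * dl ^+ 2)%:E * (gd tau 0 s)%:E))%E.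
    by apply: eq_integral => s _; rewrite /F -!EFinM -!EFinD; congr EFin; field.
  have tdl : 0 <= tau * dl ^+ 2 by rewrite mulr_ge0 ?sqr_ge0// ltW.
  have mg : measurable_fun setT (fun s => (gd tau 0 s)%:E).
    by apply/measurable_EFinP; exact: measurable_gd.
  rewrite ge0_integralD//; last 4 first.
  - by move=> s _; rewrite mule_ge0.
  - by apply: measurable_funeM; first [exact: (mF 0)|exact: mg].
  - by move=> s _; rewrite mule_ge0// lee_fin gd_ge0.
  - by apply: measurable_funeM; first [exact: (mF 0)|exact: mg].
  have -> : (\int[leb]_s (2%:E * F 0%R s) = 2%:E * (gkappa tau)%:E)%E.
    by rewrite -kE; apply: ge0_integralZl => //; exact: (mF 0).
  have -> : (\int[leb]_s ((tau * dl ^+ 2)%:E * (gd tau 0 s)%:E) = (tau * dl ^+ 2)%:E)%E.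
    rewrite ge0_integralZl//; first by rewrite integral_gd// mule1.
    by move=> s _; rewrite lee_fin gd_ge0.
  by rewrite -EFinM -EFinD.
move: D; rewrite sym.
have : (0 <= \int[leb]_s F dl s)%E by exact: integral_ge0.
case: (\int[leb]_s F dl s)%E => [r||] //= _; rewrite -EFinD => -[] h.
by congr EFin; move: h; lra.
Qed.

End Gaussian1D.

Section RintegralSum.
Context d (T : measurableType d) {R : realType} (mu : {measure set T -> \bar R}).
Variables (D : set T) (mD : measurable D).

Lemma rint_sum (J : Type) (s : seq J) (f : J -> T -> R) :
  (forall j, mu.-integrable D (EFin \o f j)) ->
  mu.-integrable D (EFin \o (fun x => \sum_(j <- s) f j x)).
Proof.
move=> fi; elim: s => [|j s IH].
  rewrite (_ : _ \o _ = cst 0%E); first exact: integrable0.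
  by apply/funext => x /=; rewrite big_nil.
rewrite (_ : (fun _ => _) = (fun x => f j x + \sum_(i <- s) f i x)); first exact: rintD.
by apply/funext => x; rewrite big_cons.
Qed.

Lemma Rintegral_sum (J : Type) (s : seq J) (f : J -> T -> R) :
  (forall j, mu.-integrable D (EFin \o f j)) ->
  \int[mu]_(x in D) (\sum_(j <- s) f j x) = \sum_(j <- s) \int[mu]_(x in D) f j x.
Proof.
move=> fi; elim: s => [|j s IH].
  rewrite big_nil; under eq_Rintegral do rewrite big_nil.
  by rewrite Rintegral_cst// mul0r.
rewrite big_cons -IH -RintegralD//; last exact: rint_sum.
by apply: eq_Rintegral => x _; rewrite big_cons.
Qed.

End RintegralSum.

Section SecondMoment.
Context {R : realType} (N : nat) (q' : 'cV[R]_N -> R).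
Hypothesis qd : is_density q'.
Hypothesis q2 : forall i,
  (intRn (fun x : 'cV[R]_N => ((x i 0) ^+ 2 * q' x)%:E) < +oo)%E.
Local Notation vec := (@vec_of_tuple R N).

Lemma measurable_q : measurable_fun [set: N.-tuple R] (fun t => q' (vec t)).
Proof. by case: qd => _ []. Qed.

Lemma measurable_coord n (i : 'I_n) :
  measurable_fun [set: n.-tuple R] (fun t => vec_of_tuple t i 0).
Proof.
rewrite (_ : (fun _ => _) = @tnth _ R ^~ i); first exact: measurable_tnth.
by apply/funext => t; rewrite mxE.
Qed.

(** The mixed moments are dominated through |x_i x_j| <= x_i^2 + x_j^2. *)
Lemma integrable_xx (i j : 'I_N) :
  (lebM N).-integrable setT (EFin \o (fun t => vec t i 0 * vec t j 0 * q' (vec t))).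
Proof.
have q0 x : 0 <= q' x by case: qd.
have sq l : (lebM N).-integrable setT (EFin \o (fun t => vec t l 0 ^+ 2 * q' (vec t))).
  apply/integrableP; split.
    apply/measurable_EFinP; apply: measurable_funM; last exact: measurable_q.
    by apply: measurable_funX; exact: measurable_coord.
  have e t : `|vec t l 0 ^+ 2 * q' (vec t)| = vec t l 0 ^+ 2 * q' (vec t).
    by apply: ger0_norm; apply: mulr_ge0 => //; exact: sqr_ge0.
  under eq_integral do rewrite /= e.
  by have := q2 l; rewrite /intRn lebME.
apply: (rint_le measurableT _ _ (rintD measurableT (sq i) (sq j))).
  apply: measurable_funM; last exact: measurable_q.
  by apply: measurable_funM; exact: measurable_coord.
move=> t _; rewrite normrM (ger0_norm (q0 _)) -mulrDl; apply: ler_wpM2r => //.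
rewrite ler_norml; have := sqr_ge0 (vec t i 0 - vec t j 0).
have := sqr_ge0 (vec t i 0 + vec t j 0).
have := sqr_ge0 (vec t i 0); have := sqr_ge0 (vec t j 0).
by move=> h1 h2 h3 h4; apply/andP; split; nra.
Qed.

Lemma second_momentE (i j : 'I_N) : second_moment q' i j =
  \int[lebM N]_t (vec t i 0 * vec t j 0 * q' (vec t)).
Proof. by rewrite mxE /intRn lebME. Qed.

Lemma integral_quadratic (P : nat) (D : 'M[R]_(P, N)) (tau : 'I_P -> R) :
  let f t := q' (vec t) * \sum_i tau i / 2 * ((D *m vec t) i 0) ^+ 2 in
  (lebM N).-integrable setT (EFin \o f) /\
  \int[lebM N]_t f t =
    \sum_i tau i / 2 * (D *m second_moment q' *m D^T) i i.
Proof.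
move=> f.
have fE : f = (fun t => \sum_i \sum_j \sum_l (tau i / 2 * (D i j * D i l)) *
    (vec t j 0 * vec t l 0 * q' (vec t))).
  apply/funext => t; rewrite /f mulr_sumr; apply: eq_bigr => i _.
  rewrite mxE expr2 mulrCA big_distrl /= mulr_sumr mulr_sumr.
  apply: eq_bigr => j _; rewrite mulr_sumr mulr_sumr mulr_sumr.
  by apply: eq_bigr => l _; ring.
have ix i j l : (lebM N).-integrable setT (EFin \o (fun t =>
    (tau i / 2 * (D i j * D i l)) * (vec t j 0 * vec t l 0 * q' (vec t)))).
  by apply: rintZ => //; exact: integrable_xx.
have ix2 i j : (lebM N).-integrable setT (EFin \o (fun t =>
    \sum_l (tau i / 2 * (D i j * D i l)) * (vec t j 0 * vec t l 0 * q' (vec t)))).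
  exact: rint_sum.
have ix1 i : (lebM N).-integrable setT (EFin \o (fun t => \sum_j
    \sum_l (tau i / 2 * (D i j * D i l)) * (vec t j 0 * vec t l 0 * q' (vec t)))).
  exact: rint_sum.
split; first by rewrite fE; exact: rint_sum.
rewrite fE Rintegral_sum//; apply: eq_bigr => i _.
rewrite Rintegral_sum// mxE mulr_sumr.
transitivity (\sum_j \sum_l tau i / 2 * (D i j * D i l) * second_moment q' j l).
  apply: eq_bigr => j _; rewrite Rintegral_sum//; apply: eq_bigr => l _.
  by rewrite RintegralZl// ?second_momentE//; exact: integrable_xx.
rewrite exchange_big /=; apply: eq_bigr => l _; rewrite !mxE mulr_suml mulr_sumr.
by apply: eq_bigr => j _; ring.
Qed.

End SecondMoment.

(** * The divergence as a quadratic form in the joint mean *)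

Section KullbackLeibler.
Context {R : realType} (M K N : nat) (gam : R) (q' : 'cV[R]_N -> R).
Hypothesis gam0 : 0 < gam.
Hypothesis qd : is_density q'.
Hypothesis q2 : forall i,
  (intRn (fun x : 'cV[R]_N => ((x i 0) ^+ 2 * q' x)%:E) < +oo)%E.
Implicit Types (A : 'M[R]_(M, K)) (B : 'M[R]_(K, N)).
Implicit Types (S : 'M[R]_(M + K, N)) (x : 'cV[R]_N) (w : 'cV[R]_(M + K)).

(* The joint mean of (y, c) given x is [stack A B *m x]; [prec] lists the
   precisions of its coordinates. *)
Definition stack A B : 'M[R]_(M + K, N) := col_mx (A *m B) B.

Definition prec (i : 'I_(M + K)) : R :=
  (col_mx (const_mx 1 : 'cV[R]_M) (const_mx gam : 'cV[R]_K)) i 0.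

Lemma prec_gt0 i : 0 < prec i.
Proof. by rewrite /prec; case: (split_ordP i) => j ->; rewrite ?col_mxEu ?col_mxEd mxE. Qed.

Definition gdens S x w := \prod_i gd (prec i) ((S *m x) i 0) (w i 0).
Definition gquad S x w := \sum_i prec i / 2 * (w i 0 - (S *m x) i 0) ^+ 2.

Lemma p1E A B x (y : 'cV[R]_M) (c : 'cV[R]_K) :
  p1 gam A B x y c = gdens (stack A B) x (col_mx y c).
Proof.
rewrite /p1 /gdens big_split_ord /=; congr (_ * _).
- rewrite (eq_bigr (fun i => (Num.sqrt (2 * pi))^-1 *
    expR (- (((y - A *m B *m x) i 0) ^+ 2) / 2))).
    rewrite big_split /= prodr_const card_ord -exprVn -expR_sum; congr (_ * expR _).
    by rewrite -mulr_suml -sumrN.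
  move=> i _; rewrite /gd /prec /stack mul_col_mx !col_mxEu !mxE.
  rewrite mulN1r; congr (_ * _).
  by rewrite div1r sqrtrV// mulr_ge0 ?pi_ge0.
- rewrite (eq_bigr (fun i => Num.sqrt (gam / (2 * pi)) *
    expR (- gam * (((c - B *m x) i 0) ^+ 2) / 2))).
    rewrite big_split /= prodr_const card_ord -expR_sum; congr (_ * expR _).
    by rewrite -mulr_suml -mulr_sumr.
  by move=> i _; rewrite /gd /prec /stack mul_col_mx !col_mxEd !mxE.
Qed.

Lemma gdensE S x w : gdens S x w =
  (\prod_i Num.sqrt (prec i / (2 * pi))) * expR (- gquad S x w).
Proof.
rewrite /gdens big_split /= -expR_sum; congr (_ * expR _).
rewrite /gquad -sumrN; apply: eq_bigr => i _; ring.
Qed.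

(** The normalising constants depend only on the precisions, so they cancel in the ratio. *)
Lemma ln_gdens S0 S x w :
  ln (gdens S0 x w / gdens S x w) = gquad S x w - gquad S0 x w.
Proof.
have C0 : 0 < \prod_i Num.sqrt (prec i / (2 * pi)).
  by apply: prodr_gt0 => i _; rewrite sqrtr_gt0 divr_gt0 ?prec_gt0// mulr_gt0 ?pi_gt0.
rewrite !gdensE; move: C0; set C := \prod_i _ => C0; rewrite invfM mulrACA divff ?gt_eqF// mul1r -expRN -expRD expRK opprK.
by rewrite addrC.
Qed.

Lemma gquad_ge0 S x w : 0 <= gquad S x w.
Proof.
by apply: sumr_ge0 => i _; rewrite mulr_ge0 ?sqr_ge0// divr_ge0// ltW// prec_gt0.
Qed.

Lemma gdens_ge0 S x w : 0 <= gdens S x w.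
Proof. by apply: prodr_ge0 => i _; exact: gd_ge0. Qed.

(** The integrand of [K1] is [F S0 S - F S0 S0]. It has no fixed sign, but each of the two terms is
    nonnegative and can be integrated by Tonelli. *)
Let F S0 S (v : (N + (M + K)).-tuple R) : R :=
  let x := usubmx (vec_of_tuple v) in let w := dsubmx (vec_of_tuple v) in
  q' x * (gdens S0 x w * gquad S x w).

Let F_ge0 S0 S v : 0 <= F S0 S v.
Proof.
by rewrite /F mulr_ge0 ?mulr_ge0 ?gdens_ge0 ?gquad_ge0//; case: qd.
Qed.

Let mean_measurable S i :
  measurable_fun [set: (N + (M + K)).-tuple R]
    (fun v => (S *m usubmx (vec_of_tuple v)) i 0).
Proof.
rewrite (_ : (fun _ => _) =
  (fun v => \sum_j S i j * vec_of_tuple v (lshift (M + K) j) 0)).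
  by apply: measurable_sum => j; apply: measurable_funM => //; exact: measurable_coord.
by apply/funext => v; rewrite mxE; apply: eq_bigr => j _; rewrite [X in _ * X]mxE.
Qed.

Let w_measurable i :
  measurable_fun [set: (N + (M + K)).-tuple R]
    (fun v => dsubmx (vec_of_tuple v) i 0).
Proof.
rewrite (_ : (fun _ => _) = (fun v => vec_of_tuple v (rshift N i) 0)).
  exact: measurable_coord.
by apply/funext => v; rewrite [LHS]mxE.
Qed.

Let q_measurable :
  measurable_fun [set: (N + (M + K)).-tuple R] (fun v => q' (usubmx (vec_of_tuple v))).
Proof.
pose xt (v : (N + (M + K)).-tuple R) : N.-tuple R :=
  [tuple tnth v (lshift (M + K) i) | i < N].
rewrite (_ : (fun _ => _) = (fun t => q' (vec_of_tuple t)) \o xt).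
  apply: measurableT_comp; first exact: measurable_q.
  apply/measurable_fun_tnthP => i; rewrite (_ : _ \o _ = @tnth _ R ^~ (lshift (M + K) i)).
    exact: measurable_tnth.
  by apply/funext => v /=; rewrite tnth_mktuple.
apply/funext => v /=; congr q'; apply/colP => i.
by rewrite !mxE tnth_mktuple.
Qed.

Let F_measurable S0 S : measurable_fun [set: (N + (M + K)).-tuple R] (F S0 S).
Proof.
apply: measurable_funM; first exact: q_measurable.
apply: measurable_funM.
  apply: measurable_prod => i _; apply: measurable_funM => //.
  apply: measurableT_comp => //; apply: measurable_funM => //.
  apply: measurable_funM => //; apply: measurable_funX.
  by apply: measurable_funB; [exact: w_measurable|exact: mean_measurable].
apply: measurable_sum => i; apply: measurable_funM => //; apply: measurable_funX.
by apply: measurable_funB; [exact: w_measurable|exact: mean_measurable].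
Qed.

Let kap : R := \sum_i gkappa (prec i).

(** Writing w - S x = (w - S0 x) + (S0 - S) x makes each coordinate a shifted Gaussian second
    moment. *)
Let inner_integral S0 S x :
  (\int[lebM (M + K)]_w (gdens S0 x (vec_of_tuple w) * gquad S x (vec_of_tuple w))%:E =
   (kap + \sum_i prec i / 2 * (((S0 - S) *m x) i 0) ^+ 2)%:E)%E.
Proof.
have H := @ge0_integral_product_density R (M + K)
  (fun i => gd (prec i) ((S0 *m x) i 0))
  (fun i s => prec i / 2 * (s - (S0 *m x) i 0 + ((S0 - S) *m x) i 0) ^+ 2)
  (fun i => gkappa (prec i) + prec i / 2 * (((S0 - S) *m x) i 0) ^+ 2) 0.
transitivity (\int[lebM (M + K)]_w (\prod_i gd (prec i) ((S0 *m x) i 0) (tnth w i) *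
  (0 + \sum_i prec i / 2 * (tnth w i - (S0 *m x) i 0 + ((S0 - S) *m x) i 0) ^+ 2))%:E)%E.
  apply: eq_integral => w _; congr EFin; rewrite add0r /gdens /gquad; congr (_ * _).
    by apply: eq_bigr => i _; rewrite [vec_of_tuple w i 0]mxE.
  apply: eq_bigr => i _; rewrite [vec_of_tuple w i 0]mxE mulmxBl.
  have -> : (S0 *m x - S *m x) i 0 = (S0 *m x) i 0 - (S *m x) i 0 by rewrite !mxE.
  ring.
rewrite H//.
- by rewrite add0r big_split.
- by move=> i; exact: measurable_gd.
- move=> i; apply: measurable_funM => //; apply: measurable_funX.
  by apply: measurable_funD => //; exact: measurable_funB.
- by move=> i s; exact: gd_ge0.
- by move=> i s; rewrite mulr_ge0 ?sqr_ge0// divr_ge0// ltW// prec_gt0.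
- by move=> i; apply: integral_gd; exact: prec_gt0.
- by move=> i; apply: integral_gd_second_moment; exact: prec_gt0.
Qed.

Let qform S := \sum_i prec i / 2 * (S *m second_moment q' *m S^T) i i.

Let F_integral S0 S :
  (\int[lebM (N + (M + K))]_v (F S0 S v)%:E = (kap + qform (S0 - S))%:E)%E.
Proof.
rewrite ge0_integral_lebM_cat; last 2 first.
- by apply/measurable_EFinP; exact: F_measurable.
- by move=> v; rewrite lee_fin F_ge0.
have [fi fE] := integral_quadratic qd q2 (S0 - S) prec.
have q0 x : 0 <= q' x by case: qd.
transitivity (\int[lebM N]_t ((kap * q' (vec_of_tuple t))%:E +
  (q' (vec_of_tuple t) * \sum_i prec i / 2 * ((S0 - S) *m vec_of_tuple t) i 0 ^+ 2)%:E))%E.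
  apply: eq_integral => t _.
  transitivity (\int[lebM (M + K)]_w ((q' (vec_of_tuple t))%:E *
     (gdens S0 (vec_of_tuple t) (vec_of_tuple w) * gquad S (vec_of_tuple t) (vec_of_tuple w))%:E))%E.
    apply: eq_integral => w _; rewrite /F.
    have -> : usubmx (vec_of_tuple (cat_tuple t w)) = vec_of_tuple t.
      by apply/colP => i; rewrite !mxE tnth_lshift.
    have -> : dsubmx (vec_of_tuple (cat_tuple t w)) = vec_of_tuple w.
      by apply/colP => i; rewrite !mxE tnth_rshift.
    by [].
  rewrite ge0_integralZl//.
  - by rewrite inner_integral -EFinM -EFinD; congr EFin; ring.
  - apply/measurable_EFinP; apply: measurable_funM.
      apply: measurable_prod => i _; apply: measurableT_comp; first exact: measurable_gd.
      exact: measurable_coord.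
    apply: measurable_sum => i; apply: measurable_funM => //; apply: measurable_funX.
    by apply: measurable_funB => //; exact: measurable_coord.
  - by move=> w _; rewrite lee_fin mulr_ge0 ?gdens_ge0 ?gquad_ge0.
  - by rewrite lee_fin.
have q1 : (\int[lebM N]_t (q' (vec_of_tuple t))%:E = 1)%E.
  by case: qd => _ [_]; rewrite /intRn lebME.
have iq : (lebM N).-integrable setT (EFin \o (fun t => q' (vec_of_tuple t))).
  apply/integrableP; split; first by apply/measurable_EFinP; exact: measurable_q.
  by under eq_integral do rewrite /= ger0_norm//; rewrite q1 ltry.
rewrite integralD//; last exact: (rintZ measurableT kap iq).
rewrite EFinD; congr (_ + _)%E.
- transitivity (kap%:E * \int[lebM N]_t (q' (vec_of_tuple t))%:E)%E; last by rewrite q1 mule1.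
  by rewrite -integralZl//; apply: eq_integral => t _; rewrite EFinM.
- rewrite -(fineK (integrable_fin_num measurableT fi)); congr EFin.
  exact: fE.
Qed.

Let F_integrable S0 S : (lebM (N + (M + K))).-integrable setT (EFin \o F S0 S).
Proof.
apply/integrableP; split; first by apply/measurable_EFinP; exact: F_measurable.
under eq_integral do rewrite /= ger0_norm ?F_ge0//.
by rewrite F_integral ltry.
Qed.

(** Both terms integrate to [kap] plus a quadratic form in the difference of the means, and that
    form is zero for the term with S = S0. *)
Theorem K1E A0 B0 A B : K1 gam q' A0 B0 A B = qform (stack A B - stack A0 B0).
Proof.
have qfN S : qform (- S) = qform S.
  by rewrite /qform; apply: eq_bigr => i _; rewrite linearN /= mulmxN !mulNmx opprK.
have qf0 : qform 0 = 0.
  by rewrite /qform big1// => i _; rewrite !mul0mx mxE mulr0.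
rewrite /K1 /intRn lebME -[RHS]qfN opprB.
set S0 := stack A0 B0; set S := stack A B.
transitivity (fine (\int[lebM (N + (M + K))]_v ((F S0 S v)%:E - (F S0 S0 v)%:E)))%E.
  congr fine; apply: eq_integral => v _; rewrite !p1E vsubmxK -EFinB ln_gdens /F.
  by congr EFin; ring.
rewrite integralB//; do ?exact: F_integrable.
rewrite !F_integral subrr qf0 addr0 -EFinB /=; ring.
Qed.

End KullbackLeibler.

(** * Volumes of small sublevel sets *)

Definition homogeneous {R : realType} (n p : nat) (f : 'rV[R]_n -> R) :=
  forall (s : R) h, f (s *: h) = s ^+ p * f h.

Section Homogeneous.
Context {R : realType} (n : nat).
Implicit Types (h u : 'rV[R]_n.+1) (f : 'rV[R]_n.+1 -> R).

Lemma norm_rV_le (h : 'rV[R]_n.+1) (r : R) : 0 <= r ->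
  (forall i, `|h 0 i| <= r) -> `|h| <= r.
Proof.
move=> r0 H; rewrite /Num.Def.normr /= mx_normrE; apply: bigmax_le => //= -[i j] _ /=.
by rewrite ord1.
Qed.

Lemma coord_le_norm (h : 'rV[R]_n.+1) i : `|h 0 i| <= `|h|.
Proof.
rewrite [leRHS]/Num.Def.normr /= mx_normrE.
exact: (le_bigmax _ (fun ij : 'I_1 * 'I_n.+1 => `|h ij.1 ij.2|) (0, i)).
Qed.

Definition sphere : set 'rV[R]_n.+1 := [set h | `|h| = 1].

Lemma sphere_compact : compact sphere.
Proof.
apply: bounded_closed_compact.
- exists 1; split; first exact: num_real.
  by move=> r r1 h /= ->; exact: ltW.
- rewrite (_ : sphere = (fun h : 'rV[R]_n.+1 => `|h|) @^-1` [set 1]); last by [].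
  apply: closed_comp; last exact: closed_eq.
  by move=> h _; exact: norm_continuous.
Qed.

Lemma sphere_neq0 : sphere !=set0.
Proof.
exists (const_mx 1); rewrite /sphere /=; apply/eqP; rewrite eq_le; apply/andP; split.
- by apply: norm_rV_le => // i; rewrite mxE normr1.
- by have := coord_le_norm (const_mx 1) ord0; rewrite mxE normr1.
Qed.

Lemma sphere_normalize h : h != 0 -> sphere (`|h|^-1 *: h).
Proof.
move=> h0; rewrite /sphere /= normrZ ger0_norm ?invr_ge0//.
by rewrite mulVf// normr_eq0.
Qed.

Lemma homogeneous_normalize p f h : homogeneous p f -> h != 0 ->
  f h = `|h| ^+ p * f (`|h|^-1 *: h).
Proof.
by move=> hf h0; rewrite -hf scalerA mulfV ?scale1r// normr_eq0.
Qed.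

Lemma homogeneous0 p f : homogeneous p f -> (0 < p)%N -> f 0 = 0.
Proof. by move=> hf p0; have := hf 0 0; rewrite scale0r expr0n gtn_eqF// mul0r. Qed.

(** Here and in [homogeneous_lb], an extremum on the compact unit sphere is transferred to all
    vectors by scaling. *)
Lemma homogeneous_ub p f : continuous f -> homogeneous p f -> (0 < p)%N ->
  exists2 C, 0 <= C & forall h, `|f h| <= C * `|h| ^+ p.
Proof.
move=> cf hf p0.
have cs : {within sphere, continuous (fun h => `|f h|)}.
  apply: continuous_subspaceT => h; apply: continuous_comp; first exact: cf.
  exact: norm_continuous.
have [c _ cM] := compact_EVT_max sphere_neq0 sphere_compact cs.
exists `|f c| => // h; have [->|h0] := eqVneq h 0.
  by rewrite (homogeneous0 hf)// !normr0 mulr_ge0// exprn_ge0.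
rewrite (homogeneous_normalize hf h0) normrM normrX normr_id mulrC ler_wpM2r ?exprn_ge0//.
by apply: cM; rewrite inE; exact: sphere_normalize.
Qed.

Lemma homogeneous_lb p f : continuous f -> homogeneous p f -> (0 < p)%N ->
  (forall h, h != 0 -> 0 < f h) ->
  exists2 c, 0 < c & forall h, c * `|h| ^+ p <= f h.
Proof.
move=> cf hf p0 f0.
have cs : {within sphere, continuous f} by exact: continuous_subspaceT.
have [c cS cm] := compact_EVT_min sphere_neq0 sphere_compact cs.
have c0 : c != 0.
  apply/eqP => c0; move: cS; rewrite inE /sphere /= c0 normr0 => /esym/eqP.
  by rewrite oner_eq0.
exists (f c); first exact: f0.
move=> h; have [->|h0] := eqVneq h 0.
  by rewrite (homogeneous0 hf)// normr0 expr0n gtn_eqF// mulr0.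
rewrite (homogeneous_normalize hf h0) mulrC ler_wpM2l ?exprn_ge0//.
by apply: cm; rewrite inE; exact: sphere_normalize.
Qed.

End Homogeneous.

Lemma measurable_cube {R : realType} n (r : R) : measurable (cube r : set (n.-tuple R)).
Proof.
rewrite (_ : cube r = \bigcap_(i in [set: 'I_n]) ((@tnth _ R ^~ i) @^-1` `[- r, r])).
  apply: fin_bigcap_measurable => // i _; rewrite -[X in measurable X]setTI.
  by apply: measurable_tnth => //; exact: measurable_itv.
apply/seteqP; split => p H i /=; first by move=> _; rewrite in_itv /= -ler_norml; exact: H.
by have := H i I; rewrite /= in_itv /= -ler_norml.
Qed.

Section ContinuousSublevel.
Context {R : realType} (T : topologicalType).

Lemma open_lt_fun (f : T -> R) (y : R) : continuous f -> open [set u | f u < y].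
Proof.
move=> cf; rewrite (_ : [set u | _] = f @^-1` [set x | x < y])//.
by apply: open_comp => [u _|]; [exact: cf|exact: (@open_lt R y)].
Qed.

Lemma closed_ge_fun (f : T -> R) (y : R) : continuous f -> closed [set u | y <= f u].
Proof.
move=> cf; rewrite (_ : [set u | _] = f @^-1` [set x | y <= x])//.
by apply: closed_comp => [u _|]; [exact: cf|exact: (@closed_ge R y)].
Qed.

End ContinuousSublevel.

(** * Comparison with ellipsoids near a nondegenerate minimum *)

Section VolumeAsymptotics.
Context {R : realType} (n : nat).
Local Notation V := 'rV[R]_n.+1.
Local Notation mu := (lebM n.+1).
Variables (k Q c1 c2 : V -> R) (u0 : V) (W : set V).
Hypotheses (ck : continuous k) (cQ : continuous Q) (cc1 : continuous c1) (cc2 : continuous c2).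
Hypotheses (hQ : homogeneous 2 Q) (hc1 : homogeneous 3 c1) (hc2 : homogeneous 4 c2).
Hypothesis Q_gt0 : forall h, h != 0 -> 0 < Q h.
Hypothesis kE : forall h, k (u0 + h) = Q h + c1 h + c2 h.
Hypothesis k_ge0 : forall u, 0 <= k u.
Hypothesis cW : compact W.
Hypothesis k_eq0 : forall u, W u -> k u = 0 -> u = u0.
Hypothesis W_nbhs : nbhs u0 W.

Let Q_ge0 h : 0 <= Q h.
Proof.
have [->|/Q_gt0/ltW//] := eqVneq h 0.
by rewrite (homogeneous0 hQ).
Qed.

(** Indexed by the radius t of the ellipsoid, not by the level t^2, so that its volume is a multiple
    of t^(n+1). *)
Let sub (t : R) : set (n.+1.-tuple R) :=
  [set p | Q (rowt p - u0) < t ^+ 2].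

Let msub t : measurable (sub t).
Proof.
apply: (@open_measurable_rowt R n.+1 [set u | Q (u - u0) < t ^+ 2]).
apply: open_lt_fun => u.
apply: (@continuous_comp _ _ _ (fun u : V => u - u0) Q); last exact: cQ.
exact: (cvgB cvg_id (cvg_cst u0)).
Qed.

Let sub1 : set (n.+1.-tuple R) := [set p | Q (rowt p) < 1].

Let msub1 : measurable sub1.
Proof.
by apply: (@open_measurable_rowt R n.+1 [set u | Q u < 1]); exact: open_lt_fun.
Qed.

Let mu_sub t : 0 < t -> mu (sub t) = ((t ^+ n.+1)%:E * mu sub1)%E.
Proof.
move=> t0; rewrite (lebM_affine (trow u0) t0 (msub t)); congr (_ * mu _)%E.
have e p : rowt (afft t (trow u0) p) - u0 = t *: rowt p.
  by apply/rowP => i; rewrite !mxE !tnth_mktuple; ring.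
have E p : (Q (rowt (afft t (trow u0) p) - u0) < t ^+ 2) = (Q (rowt p) < 1).
  by rewrite e hQ -{2}[t ^+ 2]mulr1 ltr_pM2l// exprn_gt0.
by apply/seteqP; split => p; rewrite /sub /sub1 /= E.
Qed.

Let sub1_fin : (mu sub1 < +oo)%E.
Proof.
have [c c0 cle] := homogeneous_lb cQ hQ isT Q_gt0.
pose r := (Num.sqrt c)^-1.
have r0 : 0 <= r by rewrite invr_ge0 sqrtr_ge0.
apply: (@le_lt_trans _ _ (mu (cube r))); last by rewrite lebM_cube// ltry.
have mcube := @measurable_cube R n.+1 r.
apply: le_measure; rewrite ?inE// => p; rewrite /sub1 /= => Qp i.
have := coord_le_norm (rowt p) i; rewrite mxE => /le_trans; apply.
rewrite -(@ler_pXn2r _ 2) ?nnegrE// /r exprVn sqr_sqrtr ?(ltW c0)//.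
by rewrite -[leRHS]mul1r ler_pdivlMr// mulrC (le_trans (cle _))// ltW.
Qed.

Let c := fine (mu sub1).

Let c_gt0 : 0 < c.
Proof.
have [C C0 Cle] := homogeneous_ub cQ hQ isT.
(* On the cube of half-side r, Q <= C r^2 = C / (4 (C + 1)) < 1. *)
pose r := (Num.sqrt (C + 1))^-1 / 2.
have C1 : 0 < C + 1 by rewrite ltr_wpDl.
have r0 : 0 < r by rewrite divr_gt0// invr_gt0 sqrtr_gt0.
have mcube := @measurable_cube R n.+1 r.
rewrite /c fine_gt0// sub1_fin andbT.
apply: (@lt_le_trans _ _ (mu (cube r))).
  by rewrite lebM_cube ?ltW// lte_fin exprn_gt0// mulr_gt0.
apply: le_measure; rewrite ?inE// => p H; rewrite /sub1 /=.
have nr : `|rowt p| <= r by apply: norm_rV_le; [exact: ltW|move=> i; rewrite mxE].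
have := Cle (rowt p); rewrite ger0_norm// => /le_lt_trans; apply.
have r2 : r ^+ 2 = (C + 1)^-1 / 4.
  by rewrite /r expr_div_n exprVn sqr_sqrtr ?ltW// -natrX.
apply: (@le_lt_trans _ _ (C * r ^+ 2)).
  by rewrite ler_wpM2l// ler_sqr ?nnegrE// ltW.
rewrite r2 mulrA ltr_pdivrMr// mul1r ltr_pdivrMr//; lra.
Qed.

Let sub1K : mu sub1 = c%:E.
Proof.
have m0 : (0 <= mu sub1)%E by exact: (measure_ge0 mu).
have f1 : mu sub1 \is a fin_num by rewrite (ge0_fin_numE m0) sub1_fin.
by rewrite /c (fineK f1).
Qed.

Let mu_subE t : 0 < t -> mu (sub t) = (c * t ^+ n.+1)%:E.
Proof. by move=> t0; rewrite (mu_sub t0) sub1K -EFinM mulrC. Qed.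

Let subE t : 0 < t -> fine (mu (sub t)) = c * t ^+ n.+1.
Proof. by move=> /mu_subE ->. Qed.

Let sub_fin t : 0 < t -> mu (sub t) \is a fin_num.
Proof. by move=> /mu_subE ->. Qed.

Let D0 : set (n.+1.-tuple R) := @rowt R n.+1 @^-1` W.
Let kk := k \o @rowt R n.+1.

Let mD0 : measurable D0.
Proof. by apply: closed_measurable_rowt; exact: compact_closed. Qed.

(** The base 3 makes the induction close: for p >= 1 and y <= 1, the terms y, p y and p y^2 are each
    at most p y. *)
Lemma exp_onePlus_le m (y : R) : 0 <= y -> y <= 1 -> (1 + y) ^+ m <= 1 + 3 ^+ m * y.
Proof.
move=> y0 y1; elim: m => [|m IH]; first by rewrite !expr0 mul1r lerDl.
rewrite exprS; apply: (@le_trans _ _ ((1 + y) * (1 + 3 ^+ m * y))).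
  by rewrite ler_wpM2l// addr_ge0.
have p : 1 <= 3 ^+ m :> R by rewrite exprn_ege1// ler1n.
rewrite exprS; move: (3 ^+ m) p => p p1.
have py : 0 <= p * y by rewrite mulr_ge0// (le_trans _ p1).
have := ler_wpM2l py y1; have := ler_wpM2r y0 p1; lra.
Qed.

Lemma exp_oneMinus_ge m (y : R) : 0 <= y -> y <= 1 -> 1 - 3 ^+ m * y <= (1 - y) ^+ m.
Proof.
move=> y0 y1; elim: m => [|m IH]; first by rewrite !expr0 mul1r gerBl.
rewrite [leRHS]exprS; apply: (@le_trans _ _ ((1 - y) * (1 - 3 ^+ m * y))).
  have p : 1 <= 3 ^+ m :> R by rewrite exprn_ege1// ler1n.
  rewrite exprS; move: (3 ^+ m) p => p p1.
  have py : 0 <= p * y by rewrite mulr_ge0// (le_trans _ p1).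
  have := mulr_ge0 py y0; have := ler_wpM2r y0 p1; lra.
by rewrite ler_wpM2l// subr_ge0.
Qed.

(* With s = sqrt t, both inclusions
   {Q < s^2 (1 - C s)^2} <= {k < t} <= {Q < s^2 (1 + 4 C s)^2} hold near u0,
   because k = Q (1 + O(sqrt Q)) there. *)
Lemma sandwich : exists C T : R, [/\ 0 <= C, 0 < T &
  forall s, 0 < s -> s <= T -> [/\ C * s <= 1 / 4,
    sub (s * (1 - C * s)) `<=` D0 `&` [set p | kk p < s ^+ 2] &
    D0 `&` [set p | kk p < s ^+ 2] `<=` sub (s * (1 + 4 * C * s))]].
Proof.
have [q q0 qle] := homogeneous_lb cQ hQ isT Q_gt0.
have [a1 a10 a1le] := homogeneous_ub cc1 hc1 isT.
have [a2 a20 a2le] := homogeneous_ub cc2 hc2 isT.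
pose a := a1 + a2; have a0 : 0 <= a by rewrite addr_ge0.
have kQ h : `|h| <= 1 -> `|k (u0 + h) - Q h| <= a * `|h| ^+ 3.
  move=> h1; rewrite kE (_ : _ - Q h = c1 h + c2 h); last by ring.
  rewrite (le_trans (ler_normD _ _))// /a mulrDl lerD// (le_trans (a2le _))//.
  by rewrite ler_wpM2l// [_ ^+ 4]exprS ler_piMl// exprn_ge0.
pose sq := Num.sqrt q; have sq0 : 0 < sq by rewrite sqrtr_gt0.
have sq2 : sq ^+ 2 = q by rewrite sqr_sqrtr// ltW.
have hn h : sq * `|h| <= Num.sqrt (Q h).
  rewrite -(@ler_pXn2r _ 2) ?nnegrE ?mulr_ge0 ?sqrtr_ge0 ?(ltW sq0)//.
  by rewrite exprMn sq2 sqr_sqrtr.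
(* As |h| <= sqrt(Q h) / sqrt q, the error a |h|^3 is at most C sqrt(Q h)^3. *)
pose C := a / sq ^+ 3; have C0 : 0 <= C by rewrite divr_ge0// exprn_ge0// ltW.
have kn h : `|h| <= 1 -> `|k (u0 + h) - Num.sqrt (Q h) ^+ 2| <= C * Num.sqrt (Q h) ^+ 3.
  move=> h1; rewrite sqr_sqrtr//; apply: (le_trans (kQ _ h1)).
  rewrite /C mulrAC ler_pdivlMr ?exprn_gt0// -mulrA ler_wpM2l//.
  by rewrite -exprMn mulrC lerXn2r ?nnegrE ?mulr_ge0 ?sqrtr_ge0 ?(ltW sq0).
have [e /= e0 eW] : exists2 e, 0 < e & forall h, `|h| < e -> W (u0 + h).
  have /nbhs_ballP[e /= e0 eW] := W_nbhs; exists e => // h he; apply: eW.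
  by rewrite -ball_normE /= opprD addNKr normrN.
(* The three bounds keep u0 + h in [W], let the cubic bound cover the quartic term, and make the
   error at most half of Q. *)
pose rho := Num.min (Num.min (e / 2) 1) (q / (2 * a + 1)).
have a1' : 0 < 2 * a + 1 by rewrite ltr_wpDl// mulr_ge0.
have rho0 : 0 < rho by rewrite !lt_min divr_gt0//= ltr01 divr_gt0.
have rhoe : rho < e.
  by rewrite !gt_min gtr_pMr// invf_lt1 ?ltr1n.
have rho1 : rho <= 1 by rewrite !ge_min lexx orbT.
have rhoq : (2 * a + 1) * rho <= q by rewrite mulrC -ler_pdivlMr// !ge_min lexx orbT.
have khalf h : `|h| <= rho -> Q h <= 2 * k (u0 + h).
  move=> hr; have h1 := le_trans hr rho1; have := kQ h h1.
  rewrite ler_norml => /andP[lo _].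
  have := qle h; have := normr_ge0 h => h0.
  have : 2 * a * `|h| ^+ 3 <= q * `|h| ^+ 2.
    rewrite exprS mulrA ler_wpM2r ?exprn_ge0//.
    apply: le_trans rhoq; apply: (@le_trans _ _ (2 * a * rho)).
      by rewrite ler_wpM2l// mulr_ge0.
    by apply: ler_wpM2r; [exact: ltW|rewrite lerDl].
  move: lo; lra.
(* Uniqueness of the zero and compactness bound k below away from u0, so small sublevel sets lie
   within distance rho of it. *)
have [dl dl0 far] : exists2 dl, 0 < dl & forall u, W u -> rho <= `|u - u0| -> dl <= k u.
  pose Z := W `&` [set u | rho <= `|u - u0|].
  have cZ : compact Z.
    apply: compact_closedI => //.
    apply: closed_ge_fun => u.
    apply: (@continuous_comp _ _ _ (fun u : V => u - u0) (@Num.Def.normr _ _)).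
      exact: (cvgB cvg_id (cvg_cst u0)).
    exact: norm_continuous.
  have [Z0|/set0P Zn] := eqVneq Z set0.
    exists 1 => // u Wu ur; suff : Z u by rewrite Z0.
    by [].
  have ckZ : {within Z, continuous k} by exact: continuous_subspaceT.
  have [z zZ zmin] := compact_EVT_min Zn cZ ckZ.
  move: zZ; rewrite inE => -[Wz /= zr].
  exists (k z); last by move=> u Wu ur; apply: zmin; rewrite inE.
  rewrite lt_def k_ge0 andbT; apply/eqP => kz.
  by move: zr; rewrite (k_eq0 Wz kz) subrr normr0 leNgt rho0.
have sd0 : 0 < Num.sqrt dl by rewrite sqrtr_gt0.
(* The first two bounds force the sublevel set and the inner ellipsoid, respectively, into |h| <
   rho; the third gives C s <= 1/16 for the polynomial inequalities below. *)
pose T := Num.min (Num.min (Num.sqrt dl) (sq * rho)) ((4 * C + 1)^-1 / 4).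
have C1 : 0 < 4 * C + 1 by rewrite ltr_wpDl// mulr_ge0.
exists C, T; split => //.
  by rewrite !lt_min sd0 mulr_gt0//= divr_gt0// invr_gt0.
move=> s s0; rewrite !le_min => /andP[/andP[sdl srho] sC].
have Cs0 : 0 <= C * s by rewrite mulr_ge0// ltW.
have Cs : 4 * (C * s) <= 1 / 4.
  have : (4 * C + 1) * s <= 1 / 4.
    by rewrite mulrC -ler_pdivlMr// (le_trans sC)// [leRHS]mulrAC mul1r.
  by move: s0; lra.
split.
- by move: Cs Cs0; lra.
- move=> p; rewrite /sub /=; set h := rowt p - u0.
  have ph : rowt p = u0 + h by rewrite /h addrC subrK.
  have x0 : 0 <= 1 - C * s by move: Cs Cs0; lra.
  move=> Qh; have nh : Num.sqrt (Q h) < s * (1 - C * s).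
    rewrite -(@ltr_pXn2r _ 2) ?nnegrE ?sqrtr_ge0 ?mulr_ge0 ?(ltW s0)//.
    by rewrite sqr_sqrtr.
  set m := Num.sqrt (Q h) in nh *; have m0 : 0 <= m by exact: sqrtr_ge0.
  have ms : m < s.
    by apply: (lt_le_trans nh); rewrite ler_piMr ?(ltW s0)//; move: Cs0; lra.
  have hr : `|h| < rho.
    rewrite -(ltr_pM2l sq0); apply: (le_lt_trans (hn h)).
    exact: lt_le_trans srho.
  split; first by rewrite /D0 /= ph; apply: eW; exact: lt_trans rhoe.
  rewrite /kk /= ph.
  have := kn h (le_trans (ltW hr) rho1); rewrite -/m ler_norml => /andP[_ up].
  apply: (@le_lt_trans _ _ (m ^+ 2 * (1 + C * s))).
    have : C * m ^+ 3 <= C * s * m ^+ 2.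
      by rewrite exprS mulrA ler_wpM2r ?exprn_ge0// ler_wpM2l// ltW.
    by move: up; lra.
  have m2 : m ^+ 2 < (s * (1 - C * s)) ^+ 2.
    by rewrite ltr_pXn2r ?nnegrE ?mulr_ge0// ltW.
  have y0 : 0 < 1 + C * s by rewrite ltr_wpDr.
  apply: (@lt_le_trans _ _ ((s * (1 - C * s)) ^+ 2 * (1 + C * s))).
    by rewrite ltr_pM2r.
  rewrite exprMn -[leLHS]mulrA; apply: ler_piMr; first exact: sqr_ge0.
  move: Cs Cs0; set y := C * s; move=> Cs Cs0.
  have -> : (1 - y) ^+ 2 * (1 + y) = (1 - y) * (1 - y ^+ 2) by ring.
  have : y ^+ 2 <= 1 by nra.
  have := sqr_ge0 y; nra.
- move=> p [Wp /= kp]; rewrite /sub /=; set h := rowt p - u0.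
  have ph : rowt p = u0 + h by rewrite /h addrC subrK.
  have hr : `|h| < rho.
    rewrite ltNge; apply/negP => hr; have := far _ Wp hr; apply/negP; rewrite -ltNge.
    apply: (lt_le_trans kp); rewrite -[leRHS]sqr_sqrtr ?(ltW dl0)//.
    by rewrite ler_sqr ?nnegrE ?sqrtr_ge0// ltW.
  have h2 := khalf _ (ltW hr).
  move: kp; rewrite /kk /= ph => kp.
  set m := Num.sqrt (Q h); have m0 : 0 <= m by exact: sqrtr_ge0.
  have m2 : m ^+ 2 = Q h by rewrite sqr_sqrtr.
  (* A crude bound from Q <= 2k, which turns the cubic error into a relative error 2 C s. *)
  have ms : m <= 2 * s.
    rewrite -(@ler_pXn2r _ 2) ?nnegrE ?mulr_ge0 ?(ltW s0)// m2 exprMn.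
    have := sqr_ge0 s; move: h2 kp; lra.
  have := kn h (le_trans (ltW hr) rho1); rewrite -/m ler_norml => /andP[lo _].
  have lo' : m ^+ 2 * (1 - 2 * (C * s)) < s ^+ 2.
    apply: le_lt_trans kp.
    have : C * m ^+ 3 <= 2 * (C * s) * m ^+ 2.
      rewrite exprS [leLHS]mulrA; apply: ler_wpM2r; first exact: exprn_ge0.
      by have := ler_wpM2l C0 ms; lra.
    by move: lo; lra.
  rewrite -m2.
  have z0 : 0 < 1 - 2 * (C * s) by move: Cs Cs0; lra.
  rewrite -(ltr_pM2r z0); apply: (lt_le_trans lo').
  rewrite exprMn -[leRHS]mulrA; apply: ler_peMr; first exact: sqr_ge0.
  move: Cs Cs0; rewrite -mulrA; set y := C * s; move=> Cs Cs0.
  (* The coefficient 4 makes the y^2 terms cancel; for y <= 1/16 the linear term outweighs the cubic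
     one. *)
  have -> : (1 + 4 * y) ^+ 2 * (1 - 2 * y) = 1 + 6 * y - 32 * y ^+ 3 by ring.
  have y1 : y <= 1 / 16 by lra.
  have : y ^+ 2 <= 1 / 16 by nra.
  have e3 : y ^+ 3 = y * y ^+ 2 by rewrite exprS.
  rewrite e3; nra.
Qed.

Let D0fin : (mu D0 < +oo)%E.
Proof.
have [M [_ HM]] := compact_bounded cW.
pose r := `|M| + 1; have r0 : 0 <= r by rewrite addr_ge0.
have mcube := @measurable_cube R n.+1 r.
apply: (@le_lt_trans _ _ (mu (cube r))); last by rewrite lebM_cube// ltry.
apply: le_measure; rewrite ?inE// => p Wp i.
have Mr : M < r by rewrite /r (le_lt_trans (ler_norm _))// ltrDl.
have := HM r Mr _ Wp; apply: le_trans.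
by have := coord_le_norm (rowt p) i; rewrite mxE.
Qed.

Theorem volume_asymptotics : exists c C T : R, [/\ 0 < c, 0 < T &
  forall t, 0 < t -> t <= T ->
  `|fine (mu (D0 `&` [set p | kk p < t])) - c * t `^ (n.+1%:R / 2)| <=
     C * t `^ (n.+1%:R / 2 + 1 / 2)].
Proof.
have [C [T [C0 T0 H]]] := sandwich.
(* The constant comes from the outer ellipsoid, whose relative radius error 4 C s is the larger one;
   the range is T^2 because t = s^2. *)
exists c, (c * (3 ^+ n.+1 * (4 * C))), (T ^+ 2); split => //; first exact: exprn_gt0.
move=> t t0 tT; pose s := Num.sqrt t.
have s0 : 0 < s by rewrite sqrtr_gt0.
have s2 : s ^+ 2 = t by rewrite sqr_sqrtr// ltW.
have sT : s <= T.
  by rewrite -(@ler_pXn2r _ 2) ?nnegrE ?(ltW s0) ?(ltW T0)// s2.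
have [Cs inc1 inc2] := H s s0 sT.
have sE : s = t `^ (1 / 2) by rewrite div1r powR12_sqrt// ltW.
have tE : t `^ (n.+1%:R / 2) = s ^+ n.+1.
  by rewrite sE -powR_mulrn ?powR_ge0// -powRrM; congr (_ `^ _); field.
have tE' : t `^ (n.+1%:R / 2 + 1 / 2) = s ^+ n.+1 * s by rewrite powRD_gt0// tE -sE.
rewrite tE tE'.
rewrite -s2; set Vt := fine _.
have mA : measurable (D0 `&` [set p | kk p < s ^+ 2]).
  apply: measurableI => //.
  by apply: (@open_measurable_rowt R n.+1 [set u | k u < s ^+ 2]); exact: open_lt_fun.
have Afin : mu (D0 `&` [set p | kk p < s ^+ 2]) \is a fin_num.
  rewrite ge0_fin_numE//; apply: le_lt_trans D0fin.
  by apply: le_measure; rewrite ?inE//; exact: subIsetl.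
have Cs0 : 0 <= C * s by rewrite mulr_ge0// ltW.
have lo0 : 0 < s * (1 - C * s) by rewrite mulr_gt0//; move: Cs; lra.
have hi0 : 0 < s * (1 + 4 * C * s) by rewrite mulr_gt0//; move: Cs0; lra.
have lo : c * (s * (1 - C * s)) ^+ n.+1 <= Vt.
  rewrite -subE//; apply: fine_le => //; first exact: sub_fin.
  by apply: le_measure; rewrite ?inE.
have hi : Vt <= c * (s * (1 + 4 * C * s)) ^+ n.+1.
  rewrite -subE//; apply: fine_le => //; first exact: sub_fin.
  by apply: le_measure; rewrite ?inE.
have y0 : 0 <= 4 * C * s by move: Cs0; lra.
have y1 : 4 * C * s <= 1 by move: Cs; lra.
have e1 := exp_onePlus_le n.+1 y0 y1.
have z1 : C * s <= 1 by move: Cs; lra.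
have e2 := exp_oneMinus_ge n.+1 Cs0 z1.
have P0 : 0 <= c * s ^+ n.+1 by rewrite mulr_ge0 ?exprn_ge0// ltW.
move: lo hi; rewrite !exprMn => lo hi.
have f1 := ler_wpM2l P0 e1; have f2 := ler_wpM2l P0 e2.
have p2 : 0 <= c * s ^+ n.+1 * (3 ^+ n.+1 * (C * s)).
  by rewrite mulr_ge0// mulr_ge0// exprn_ge0.
rewrite ler_norml; apply/andP; split; move: lo hi f1 f2 p2; lra.
Qed.

Lemma volume_domain_fin : (mu D0 < +oo)%E. Proof. exact: D0fin. Qed.

End VolumeAsymptotics.

(** The dimension M K + K N is positive but not syntactically a successor. *)
Lemma volume_asymptotics_pos (R : realType) (n : nat)
    (k Q c1 c2 : 'rV[R]_n -> R) (u0 : 'rV[R]_n) (W : set 'rV[R]_n) :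
  (0 < n)%N ->
  continuous k -> continuous Q -> continuous c1 -> continuous c2 ->
  homogeneous 2 Q -> homogeneous 3 c1 -> homogeneous 4 c2 ->
  (forall h, h != 0 -> 0 < Q h) ->
  (forall h, k (u0 + h) = Q h + c1 h + c2 h) ->
  (forall u, 0 <= k u) -> compact W ->
  (forall u, W u -> k u = 0 -> u = u0) -> nbhs u0 W ->
  (lebM n (@rowt R n @^-1` W) < +oo)%E /\
  exists c C T : R, [/\ 0 < c, 0 < T &
  forall t, 0 < t -> t <= T ->
  `|fine (lebM n (@rowt R n @^-1` W `&` [set p | (k \o @rowt R n) p < t])) -
    c * t `^ (n%:R / 2)| <= C * t `^ (n%:R / 2 + 1 / 2)].
Proof.
case: n k Q c1 c2 u0 W => // n k Q c1 c2 u0 W _ ck cQ cc1 cc2 hQ hc1 hc2 Q0 kE k0 cW kz nW.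
by split; [exact: volume_domain_fin|exact: volume_asymptotics cQ cc1 cc2 _ _ _ _ kE _ _ _ _].
Qed.

(** * The concept bottleneck model *)

Section MatrixContinuity.
Context {R : realType} (T : topologicalType).

Lemma continuous_matrix m n (f : T -> 'M[R]_(m, n)) :
  (forall i j, continuous (fun t => f t i j)) -> continuous f.
Proof.
move=> cf t; apply/cvg_ballP => e e0.
have H : \forall t' \near t, forall i j, ball (f t i j) e (f t' i j).
  apply: filter_forall => i; apply: filter_forall => j.
  by have /cvg_ballP := cf i j t; apply.
by apply: filterS H => t' Ht'; split.
Qed.

Lemma continuous_sum (I : Type) (s : seq I) (f : I -> T -> R) :
  (forall i, continuous (f i)) -> continuous (fun t => \sum_(i <- s) f i t).
Proof.
move=> cf; elim: s => [|i s IH] t.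
  by under eq_fun do rewrite big_nil; exact: cvg_cst.
by under eq_fun do rewrite big_cons; apply: cvgD; [exact: cf|exact: IH].
Qed.

Lemma continuous_mulmx m n p (f : T -> 'M[R]_(m, n)) (g : T -> 'M[R]_(n, p)) :
  (forall i j, continuous (fun t => f t i j)) ->
  (forall i j, continuous (fun t => g t i j)) ->
  forall i j, continuous (fun t => (f t *m g t) i j).
Proof.
move=> cf cg i j; rewrite (_ : (fun _ => _) = (fun t => \sum_l f t i l * g t l j)).
  by apply: continuous_sum => l t; apply: cvgM; [exact: cf|exact: cg].
by apply/funext => t; rewrite mxE.
Qed.

Lemma continuous_entryD m n (f g : T -> 'M[R]_(m, n)) :
  (forall i j, continuous (fun t => f t i j)) ->
  (forall i j, continuous (fun t => g t i j)) ->
  forall i j, continuous (fun t => (f t + g t) i j).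
Proof.
move=> cf cg i j; rewrite (_ : (fun _ => _) = (fun t => f t i j + g t i j)).
  by move=> t; apply: cvgD; [exact: cf|exact: cg].
by apply/funext => t; rewrite mxE.
Qed.

Lemma continuous_col_mx m1 m2 n (f : T -> 'M[R]_(m1, n)) (g : T -> 'M[R]_(m2, n)) :
  (forall i j, continuous (fun t => f t i j)) ->
  (forall i j, continuous (fun t => g t i j)) ->
  forall i j, continuous (fun t => (col_mx (f t) (g t)) i j).
Proof.
move=> cf cg i j; case: (split_ordP i) => l ->.
- rewrite (_ : (fun _ => _) = (fun t => f t l j)); first exact: cf.
  by apply/funext => t; rewrite col_mxEu.
- rewrite (_ : (fun _ => _) = (fun t => g t l j)); first exact: cg.
  by apply/funext => t; rewrite col_mxEd.
Qed.

Lemma continuous_entry_cst m n (A : 'M[R]_(m, n)) i j :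
  continuous (fun _ : T => A i j).
Proof. by move=> t; exact: cvg_cst. Qed.

End MatrixContinuity.

Section WeightedForm.
Context {R : realType} (P N : nat) (tau : 'I_P -> R) (X : 'M[R]_N).

(** The bilinear form behind the quadratic form of [K1E]; bilinearity is what expands K_1 into
    homogeneous pieces. *)
Definition wform (D D' : 'M[R]_(P, N)) : R :=
  \sum_i tau i / 2 * (D *m X *m D'^T) i i.

Lemma wformDl D1 D2 D' : wform (D1 + D2) D' = wform D1 D' + wform D2 D'.
Proof.
rewrite /wform -big_split; apply: eq_bigr => i _ /=.
by rewrite !mulmxDl [((_ + _) : 'M[R]_P) i i]mxE mulrDr.
Qed.

Lemma wformDr D D1 D2 : wform D (D1 + D2) = wform D D1 + wform D D2.
Proof.
rewrite /wform -big_split; apply: eq_bigr => i _ /=.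
by rewrite linearD mulmxDr [((_ + _) : 'M[R]_P) i i]mxE mulrDr.
Qed.

Lemma wformZ a b D D' : wform (a *: D) (b *: D') = a * b * wform D D'.
Proof.
rewrite /wform mulr_sumr; apply: eq_bigr => i _.
rewrite linearZ /= -!scalemxAl -!scalemxAr !scalerA.
by rewrite [((_ *: _) : 'M[R]_P) i i]mxE; ring.
Qed.

Hypothesis tau0 : forall i, 0 < tau i.
Hypothesis X0 : posdefmx X.

Lemma wform_row (D : 'M[R]_(P, N)) i : (D *m X *m D^T) i i = (row i D *m X *m (row i D)^T) 0 0.
Proof.
rewrite -row_mul [LHS]mxE [RHS]mxE; apply: eq_bigr => j _.
by congr (_ * _); rewrite !mxE.
Qed.

Lemma wform_row_ge0 (D : 'M[R]_(P, N)) i : 0 <= (D *m X *m D^T) i i.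
Proof.
rewrite wform_row; have [->|h] := eqVneq (row i D) 0.
  by rewrite !mul0mx mxE.
have [_ H] := X0; have := H (row i D)^T; rewrite trmxK => /(_ _)/ltW; apply.
by apply: contra h => /eqP/(congr1 trmx); rewrite trmxK trmx0 => ->.
Qed.

Lemma wform_ge0 D : 0 <= wform D D.
Proof.
by apply: sumr_ge0 => i _; rewrite mulr_ge0 ?wform_row_ge0// divr_ge0// ltW.
Qed.

Lemma wform_eq0 D : wform D D = 0 -> D = 0.
Proof.
move=> /eqP; rewrite psumr_eq0; last first.
  by move=> i _; rewrite mulr_ge0 ?wform_row_ge0// divr_ge0// ltW.
move=> /allP H; apply/row_matrixP => i; rewrite row0; apply/eqP/negPn/negP => h.
have := H i (mem_index_enum _); rewrite /= mulf_eq0 => /orP[|].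
  by rewrite mulf_eq0 invr_eq0 pnatr_eq0 orbF gt_eqF.
rewrite wform_row; have [_ HX] := X0; have := HX (row i D)^T; rewrite trmxK => pos.
rewrite gt_eqF// pos//.
by apply: contra h => /eqP/(congr1 trmx); rewrite trmxK trmx0 => ->.
Qed.

Lemma continuous_wform (T : topologicalType) (f g : T -> 'M[R]_(P, N)) :
  (forall i j, continuous (fun t => f t i j)) ->
  (forall i j, continuous (fun t => g t i j)) ->
  continuous (fun t => wform (f t) (g t)).
Proof.
move=> cf cg.
have H i : continuous (fun t => (f t *m X *m (g t)^T) i i).
  apply: (continuous_mulmx (f := fun t => f t *m X) (g := fun t => (g t)^T)).
  - by apply: continuous_mulmx => // a b; exact: continuous_entry_cst.
  - move=> a b; rewrite (_ : (fun _ => _) = (fun t => g t b a)); first exact: cg.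
    by apply/funext => u; rewrite mxE.
by apply: continuous_sum => i t; apply: cvgMr; exact: H.
Qed.

End WeightedForm.

Section Parametrization.
Context {R : realType} (M K N : nat).
Local Notation d := (M * K + K * N)%N.
Local Notation V := 'rV[R]_d.

(** Same layout as [param_of_tuple], so that [param_of_tuple t] is convertible to the pair of
    [parA (rowt t)] and [parB (rowt t)]. *)
Definition parA (u : V) : 'M[R]_(M, K) := vec_mx (lsubmx u).
Definition parB (u : V) : 'M[R]_(K, N) := vec_mx (rsubmx u).
Definition unpar (w : 'M[R]_(M, K) * 'M[R]_(K, N)) : V :=
  row_mx (mxvec w.1) (mxvec w.2).

Lemma unparK w : (parA (unpar w), parB (unpar w)) = w.
Proof. by case: w => A B; rewrite /parA /parB row_mxKl row_mxKr !mxvecK. Qed.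

Lemma parK u : unpar (parA u, parB u) = u.
Proof. by rewrite /unpar /parA /parB /= !vec_mxK hsubmxK. Qed.

Lemma parAD u v : parA (u + v) = parA u + parA v.
Proof. by rewrite /parA linearD linearD. Qed.

Lemma parBD u v : parB (u + v) = parB u + parB v.
Proof. by rewrite /parB linearD linearD. Qed.

Lemma parAZ s u : parA (s *: u) = s *: parA u.
Proof. by rewrite /parA linearZ linearZ. Qed.

Lemma parBZ s u : parB (s *: u) = s *: parB u.
Proof. by rewrite /parB linearZ linearZ. Qed.

Lemma par_eq0 u : parA u = 0 -> parB u = 0 -> u = 0.
Proof. by move=> a b; rewrite -[u]parK a b /unpar /= !linear0 row_mx0. Qed.

Lemma continuous_parA i j : continuous (fun u : V => parA u i j).
Proof.
rewrite (_ : (fun _ => _) = (fun u : V => u 0 (lshift _ (mxvec_index i j)))).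
  by move=> u; exact: coord_continuous.
by apply/funext => u; rewrite !mxE.
Qed.

Lemma continuous_parB i j : continuous (fun u : V => parB u i j).
Proof.
rewrite (_ : (fun _ => _) = (fun u : V => u 0 (rshift _ (mxvec_index i j)))).
  by move=> u; exact: coord_continuous.
by apply/funext => u; rewrite !mxE.
Qed.

Lemma continuous_par : continuous (fun u : V => (parA u, parB u)).
Proof.
have cA : continuous (@parA) by exact: continuous_matrix continuous_parA.
have cB : continuous (@parB) by exact: continuous_matrix continuous_parB.
by move=> u; exact: (cvg_pair (cA u) (cB u)).
Qed.

Lemma continuous_unpar : continuous unpar.
Proof.
apply: continuous_matrix => a i; case: (split_ordP i) => j ->.
- rewrite (_ : (fun _ => _) = (fun w => mxvec w.1 a j)).
    case/mxvec_indexP: j => p q.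
    rewrite (_ : (fun _ => _) = (fun A : 'M[R]_(M, K) => A p q) \o fst).
      move=> w; apply: continuous_comp; first exact: cvg_fst.
      exact: coord_continuous.
    by apply/funext => w /=; rewrite ord1 mxvecE.
  by apply/funext => w; rewrite /unpar row_mxEl.
- rewrite (_ : (fun _ => _) = (fun w => mxvec w.2 a j)).
    case/mxvec_indexP: j => p q.
    rewrite (_ : (fun _ => _) = (fun B : 'M[R]_(K, N) => B p q) \o snd).
      move=> w; apply: continuous_comp; first exact: cvg_snd.
      exact: coord_continuous.
    by apply/funext => w /=; rewrite ord1 mxvecE.
  by apply/funext => w; rewrite /unpar row_mxEr.
Qed.

Lemma compact_par (W : set ('M[R]_(M, K) * 'M[R]_(K, N))) : compact W ->
  compact [set u : V | W (parA u, parB u)].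
Proof.
move=> cW; rewrite (_ : [set u | _] = unpar @` W).
  by apply: continuous_compact => //; apply: continuous_subspaceT; exact: continuous_unpar.
apply/seteqP; split => [u /= Wu|_ [w Ww <-] /=]; last by rewrite unparK.
by exists (parA u, parB u) => //; rewrite parK.
Qed.

End Parametrization.

(** * Uniqueness and nondegeneracy of the true parameter *)

Section ConceptBottleneck.
Context {R : realType} (N K M : nat) (gam : R) (X : 'M[R]_N).
Variables (A0 : 'M[R]_(M, K)) (B0 : 'M[R]_(K, N)).
Hypotheses (gam0 : 0 < gam) (X0 : posdefmx X) (rB0 : \rank B0 = K).
Local Notation d := (M * K + K * N)%N.
Local Notation V := 'rV[R]_d.
Local Notation form := (@wform R (M + K) N (@prec R M K gam) X).

Let B0_inj (D : 'M[R]_(M, K)) : D *m B0 = 0 -> D = 0.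
Proof.
move=> h; have rf : row_free B0 by rewrite /row_free rB0.
by apply: (row_free_inj rf); rewrite mul0mx.
Qed.

(** The concept block determines B, which removes the freedom to replace (A, B) by (A P^-1, P B);
    the rank of B_0 then determines A from A B_0. *)
Lemma stack_inj A B : stack A B - stack A0 B0 = 0 -> A = A0 /\ B = B0.
Proof.
move=> /eqP; rewrite subr_eq0 => /eqP/eq_col_mx[h BE]; subst B; split => //.
move/eqP: h; rewrite -subr_eq0 -mulmxBl => /eqP/B0_inj/eqP.
by rewrite subr_eq0 => /eqP.
Qed.

(* stack (A0 + D) (B0 + E) - stack A0 B0 is the sum of its linear part
   [lin] and its quadratic part [quad] in (D, E). *)
Let lin (h : V) : 'M[R]_(M + K, N) :=
  col_mx (parA h *m B0 + A0 *m parB h) (parB h).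
Let quad (h : V) : 'M[R]_(M + K, N) := col_mx (parA h *m parB h) 0.

Let u0 : V := unpar (A0, B0).
Let kf (u : V) : R := form (stack (parA u) (parB u) - stack A0 B0)
                           (stack (parA u) (parB u) - stack A0 B0).
Let Q (h : V) : R := form (lin h) (lin h).
Let c1 (h : V) : R := form (lin h) (quad h) + form (quad h) (lin h).
Let c2 (h : V) : R := form (quad h) (quad h).

Let parA0 : parA u0 = A0. Proof. by have [] := unparK (A0, B0). Qed.
Let parB0 : parB u0 = B0. Proof. by have [] := unparK (A0, B0). Qed.

Let stackE h : stack (parA (u0 + h)) (parB (u0 + h)) - stack A0 B0 = lin h + quad h.
Proof.
rewrite parAD parBD parA0 parB0 /stack /lin /quad opp_col_mx !add_col_mx.
congr col_mx; last by rewrite addr0 addrC addKr.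
by rewrite mulmxDl !mulmxDr; apply/matrixP => i j; rewrite !mxE; ring.
Qed.

Let kfE h : kf (u0 + h) = Q h + c1 h + c2 h.
Proof.
rewrite /kf stackE /Q /c1 /c2 wformDl !wformDr; ring.
Qed.

Let linZ s h : lin (s *: h) = s *: lin h.
Proof.
by rewrite /lin parAZ parBZ scale_col_mx scalerDr -scalemxAl -scalemxAr.
Qed.

Let quadZ s h : quad (s *: h) = s ^+ 2 *: quad h.
Proof.
by rewrite /quad parAZ parBZ scale_col_mx scaler0 -scalemxAl -scalemxAr scalerA.
Qed.

Let hQ : homogeneous 2 Q.
Proof. by move=> s h; rewrite /Q linZ wformZ expr2. Qed.

Let hc1 : homogeneous 3 c1.
Proof. by move=> s h; rewrite /c1 linZ quadZ !wformZ; ring. Qed.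

Let hc2 : homogeneous 4 c2.
Proof. by move=> s h; rewrite /c2 quadZ wformZ; ring. Qed.

Let lin_continuous i j : continuous (fun h => lin h i j).
Proof.
apply: continuous_col_mx => [a b|]; last exact: continuous_parB.
apply: continuous_entryD => p q; apply: continuous_mulmx => ? ?;
  solve [exact: continuous_parA|exact: continuous_parB|exact: continuous_entry_cst].
Qed.

Let quad_continuous i j : continuous (fun h => quad h i j).
Proof.
apply: continuous_col_mx => a b; last exact: continuous_entry_cst.
by apply: continuous_mulmx => ? ?; [exact: continuous_parA|exact: continuous_parB].
Qed.

Let stack_continuous i j :
  continuous (fun u : V => (stack (parA u) (parB u) - stack A0 B0) i j).
Proof.
apply: continuous_entryD => a b; last exact: continuous_entry_cst.
apply: continuous_col_mx => p q; last exact: continuous_parB.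
by apply: continuous_mulmx => ? ?; [exact: continuous_parA|exact: continuous_parB].
Qed.

Lemma bottleneck_continuous : continuous kf.
Proof. by apply: continuous_wform. Qed.

Let cQ : continuous Q. Proof. by apply: continuous_wform. Qed.

Let cc1 : continuous c1.
Proof.
have a : continuous (fun h => form (lin h) (quad h)) by apply: continuous_wform.
have b : continuous (fun h => form (quad h) (lin h)) by apply: continuous_wform.
by move=> u; exact: (cvgD (a u) (b u)).
Qed.

Let cc2 : continuous c2. Proof. by apply: continuous_wform. Qed.

Let prec0 := @prec_gt0 R M K gam gam0.

(** The linearised form of [stack_inj]: if [lin h] vanishes, its lower block gives [parB h = 0], and
    then [parA h *m B0 = 0]. *)
Let Q_gt0 h : h != 0 -> 0 < Q h.
Proof.
move=> h0; rewrite lt_def wform_ge0// andbT; apply: contra h0 => /eqP/wform_eq0.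
move=> /(_ prec0 X0); rewrite /lin -[0]col_mx0 => /eq_col_mx[e1 e2].
apply/eqP/par_eq0 => //; apply: B0_inj.
by move: e1; rewrite e2 mulmx0 addr0.
Qed.

Lemma bottleneck_ge0 u : 0 <= kf u. Proof. exact: wform_ge0. Qed.

Lemma bottleneck_eq0 u : kf u = 0 -> u = u0.
Proof.
move=> /wform_eq0 => /(_ prec0 X0)/stack_inj[eA eB].
by rewrite -[u]parK eA eB.
Qed.

Lemma bottleneck_volume (W : set V) : (0 < K)%N -> (0 < M)%N -> compact W ->
  nbhs u0 W ->
  (lebM d (@rowt R d @^-1` W) < +oo)%E /\
  exists c C T : R, [/\ 0 < c, 0 < T &
  forall t, 0 < t -> t <= T ->
  `|fine (lebM d (@rowt R d @^-1` W `&` [set p | (kf \o @rowt R d) p < t])) -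
    c * t `^ (d%:R / 2)| <= C * t `^ (d%:R / 2 + 1 / 2)].
Proof.
move=> K0 M0 cW nW; apply: (@volume_asymptotics_pos R d kf Q c1 c2 u0 W) => //.
- by rewrite addn_gt0 muln_gt0 M0 K0.
- exact: bottleneck_continuous.
- exact: bottleneck_ge0.
- by move=> u _; exact: bottleneck_eq0.
Qed.

End ConceptBottleneck.

(** If B_0 had rank below K, every (A_0 + D, B_0) with D B_0 = 0 would be a zero of K_1 and
    regularity would fail. That (A_0, B_0) is interior to W expresses that W is sufficiently large.
    Finiteness of the second moments is a separate hypothesis because [fine] in [second_moment]
    sends infinite values to 0. *)
Theorem theorem1 (R : realType) (N K M : nat) (gam : R)
    (q' : 'cV[R]_N -> R) (A0 : 'M[R]_(M, K)) (B0 : 'M[R]_(K, N))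
    (W : set ('M[R]_(M, K) * 'M[R]_(K, N))) :
  (0 < N)%N -> (0 < K)%N -> (0 < M)%N -> 0 < gam ->
  is_density q' ->
  (forall x, 0 < q' x) ->
  (exists C : R, forall x, q' x <= C) ->
  (forall i, (intRn (fun x : 'cV[R]_N => ((x i 0) ^+ 2 * q' x)%:E) < +oo)%E) ->
  posdefmx (second_moment q') ->
  \rank B0 = K ->
  compact W ->
  interior W (A0, B0) ->
  regular_at (K1 gam q' A0 B0) W (A0, B0) /\
  rlct_mult (K1 gam q' A0 B0) W ((M + N)%:R * K%:R / 2) 1.
Proof.
move=> N0 K0 M0 gam0 qd _ _ q2 X0 rB0 cW iW.
pose form := @wform R (M + K) N (@prec R M K gam) (second_moment q').
have KE A B : K1 gam q' A0 B0 A B = form (stack A B - stack A0 B0) (stack A B - stack A0 B0).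
  by rewrite (K1E gam0 qd q2).
have prec0 := @prec_gt0 R M K gam gam0.
split.
  apply/seteqP; split => [[A B] /= [_]|[A B] [-> ->]] /=; last first.
    by split; [exact: interior_subset|rewrite KE subrr /form /wform big1// => i _;
      rewrite !mul0mx mxE mulr0].
  by rewrite KE => /wform_eq0 => /(_ prec0 X0)/(stack_inj rB0)[-> ->].
pose W' := [set u : 'rV[R]_(M * K + K * N) | W (parA u, parB u)].
pose kf (u : 'rV[R]_(M * K + K * N)) := K1 gam q' A0 B0 (parA u) (parB u).
have kfE : kf = (fun u => form (stack (parA u) (parB u) - stack A0 B0)
    (stack (parA u) (parB u) - stack A0 B0)) by apply/funext => u; exact: KE.
have cW' : compact W' by exact: compact_par.
have nW' : nbhs (unpar (A0, B0)) W'.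
  apply: (@continuous_par R M K N (unpar (A0, B0)) W).
  by rewrite unparK; exact: iW.
have ckf : continuous kf by rewrite kfE; exact: bottleneck_continuous.
have [Dfin [c [C [T [c0 T0 vol]]]]] := bottleneck_volume gam0 X0 rB0 K0 M0 cW' nW'.
(* The maximum of K_1 on the compact domain serves as the upper bound [Kx] in [rlct_of_volume]. *)
have [z _ zmax] := compact_EVT_max (ex_intro _ _ (nbhs_singleton nW')) cW'
  (continuous_subspaceT ckf).
have lamE : (M + N)%:R * K%:R / 2 = (M * K + K * N)%:R / 2 :> R.
  by rewrite -natrM mulnDl [(N * K)%N]mulnC.
have lam0 : 0 < (M * K + K * N)%:R / 2 :> R.
  by rewrite divr_gt0// ltr0n addn_gt0 muln_gt0 M0 K0.
have mk := continuous_measurable_rowt ckf.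
have mW' : measurable (@rowt R (M * K + K * N) @^-1` W').
  by apply: closed_measurable_rowt; exact: compact_closed.
have k0 p : (@rowt R (M * K + K * N) @^-1` W') p -> 0 <= (kf \o @rowt R _) p.
  by move=> _; rewrite kfE; exact: bottleneck_ge0.
have kz p : (@rowt R (M * K + K * N) @^-1` W') p -> (kf \o @rowt R _) p <= kf z.
  by move=> Wp; apply: zmax; rewrite inE.
have vol' t : 0 < t -> t <= T ->
   `|fine (lebM _ (@rowt R (M * K + K * N) @^-1` W' `&` [set p | (kf \o @rowt R _) p < t])) -
    c * t `^ ((M * K + K * N)%:R / 2)| <= C * t `^ ((M * K + K * N)%:R / 2 + 1 / 2).
  by rewrite kfE; exact: vol.
have [eps [eps0 [g [g1 [g2 g3]]]]] :=
  rlct_of_volume mk mW' Dfin k0 kz lam0 c0 T0 vol'.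
split => //; rewrite lamE; exists eps; split => //; exists g; split; first exact: g1.
split; last exact: g3.
by move=> u hu; rewrite g2//; congr (_ * _); rewrite /zeta lebME.
Qed.
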